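(* Let $p\in[1,\infty)$ and $q=p(p-1)^{-1}$. Let $(\rho_{st})_{0\le s\le t\le T}$ be a strong time-consistent fully-dynamic convex risk measure on $(L_p(\mathcal F_t))_t$ such that $\rho_{0T}$ is dominated (with constant $K$) and sensitive. Then: 1. For all $t\in[0,T]$, the risk measure $\rho_{0t}$ is dominated and sensitive. 2. For all $0\le s\le t\le T$, $$\rho_{st}(X)=\operatorname*{ess\,sup}_{R\in\mathcal P_{st}}\big(E_R(-X|\mathcal F_s)-\alpha_{st}(R)\big),\qquad X\in L_p(\mathcal F_t).$$ 3. For all $0\le s\le t\le T$, $Q\in\mathcal Q$ and $R\in\widetilde{\mathcal P}_{st}$, there exists $h\in L_q(\mathcal F_t)$ with $\|h\|_q\le K$ such that $$E_Q\big(E_R(X|\mathcal F_s)\big)=E(hX),\qquad X\in L_p(\mathcal F_t).$$ 4. For all $0\le s\le t\le T$, $$\rho_{st}(X)=\operatorname*{ess\,sup}_{R\in\widetilde{\mathcal P}_{st}}\big(E_R(-X|\mathcal F_s)-\alpha_{st}(R)\big),\qquad X\in L_p(\mathcal F_t).$$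
   Context: Let $T\in(0,\infty)$ and let $(\Omega,\mathcal F,(\mathcal F_t)_{t\in[0,T]},P)$ be a complete filtered probability space with $\mathcal F_0$ trivial; $L_p(\mathcal F_t)=L_p(\Omega,\mathcal F_t,P)$, $E$ is expectation under $P$, $E_Q$ under $Q$. Relations between random variables hold $P$-a.s. A fully-dynamic convex risk measure on $(L_p(\mathcal F_t))_t$ ($p<\infty$) is a family of mappings $\rho_{st}:L_p(\mathcal F_t)\to L_p(\mathcal F_s)$, $0\le s\le t\le T$, each monotone ($\rho_{st}(X')\le\rho_{st}(X'')$ if $X'\ge X''$), convex, and $\mathcal F_s$-translation invariant ($\rho_{st}(X+f)=\rho_{st}(X)-f$, $f\in L_p(\mathcal F_s)$). It is strong time-consistent if $\rho_{rt}(X)=\rho_{rs}(-\rho_{st}(X))$ for all $r\le s\le t$, $X\in L_p(\mathcal F_t)$. Minimal penalty: $\alpha_{st}(Q)=\operatorname{ess\,sup}_{X\in L_p(\mathcal F_t)}\big(E_Q(-X|\mathcal F_s)-\rho_{st}(X)\big)$. A real-valued convex risk measure $\rho$ on $L_p(\mathcal F_t)$ is dominated if there is a sublinear (coherent) risk measure $\tilde\rho:L_p(\mathcal F_t)\to\mathbb R$ with $\rho(X)-\rho(0)\le\tilde\rho(X)$ for all $X$; equivalently, there are $K>0$, $C\in\mathbb R$ with $\rho(X)\le K\|X\|_p+C$ for all $X$. Such a $K$ is called a constant in the domination. It is sensitive if there is a probability measure $\tilde Q\sim P$ (on $\mathcal F_t$) with $\alpha(\tilde Q)<\infty$, where $\alpha$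 is the minimal penalty of $\rho$. $\mathcal Q=\{Q\sim P:\ \alpha_{0T}(Q)<\infty\}$ (probability measures on $\mathcal F_T$). For $s\le t$, on $(\Omega,\mathcal F_t)$, $\mathcal P_{st}=\{R\sim P:\ R_{|\mathcal F_s}=P,\ \alpha_{st}(R)\in L_p(\mathcal F_s)\}$ and $\widetilde{\mathcal P}_{st}=\{R\sim P:\ R_{|\mathcal F_s}=P,\ \sup_{Q\in\mathcal Q}E_Q(\alpha_{st}(R))<\infty\}$. *)

(* Defs.v *)
From HB Require Import structures.
From mathcomp Require Import all_boot all_order all_algebra.
From mathcomp Require Import all_classical all_reals all_analysis.
From mathcomp Require Import measurable_realfun.

Set Implicit Arguments.
Unset Strict Implicit.
Unset Printing Implicit Defensive.

Import Order.TTheory GRing.Theory Num.Theory.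
Import numFieldNormedType.Exports.

Local Open Scope classical_set_scope.
Local Open Scope ring_scope.

(* Random variables are genuine functions; identification of a.s. equal ones is
   expressed by stating every relation between random variables P-a.s. *)

Definition measurable_wrt {d d'} {U : measurableType d} {V : sigmaRingType d'}
    (G : set (set U)) (f : U -> V) : Prop :=
  measurable_fun (setT : set (g_sigma_algebraType G))
    (f : g_sigma_algebraType G -> V).

Section conditional_expectation.
Context {d} {U : measurableType d} {R : realType}.
Local Open Scope ereal_scope.

Definition is_ge0_cexp (Q : probability U R) (G : set (set U))
    (f g : U -> \bar R) : Prop :=
  [/\ measurable_wrt G g, (forall x, 0 <= g x) &
      forall A, G A -> \int[Q]_(x in A) g x = \int[Q]_(x in A) f x].

Definition ge0_cexp (Q : probability U R) (G : set (set U))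
    (f : U -> \bar R) : U -> \bar R :=
  xget (cst 0) [set g | is_ge0_cexp Q G f g].

(* A version of the generalized conditional expectation E_Q(f | G), with values
   in the extended reals; f need not be Q-integrable. It is -oo where both
   E_Q(f^+ | G) and E_Q(f^- | G) are infinite; this convention does not affect
   the penalties below, because there the term given by -|X| is +oo. *)
Definition cexp (Q : probability U R) (G : set (set U))
    (f : U -> \bar R) : U -> \bar R :=
  fun x => ge0_cexp Q G f^\+ x - ge0_cexp Q G f^\- x.

Definition is_fam_ess_sup (P : probability U R) (G : set (set U))
    (S : set (U -> \bar R)) (g : U -> \bar R) : Prop :=
  [/\ measurable_wrt G g,
      (forall f, S f -> \forall x \ae P, f x <= g x) &
      forall h, measurable_wrt G h ->
        (forall f, S f -> \forall x \ae P, f x <= h x) ->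
        \forall x \ae P, g x <= h x].

(* Essential supremum of a family of G-measurable random variables. The
   library's [ess_sup] is the essential supremum of a single function. *)
Definition fam_ess_sup (P : probability U R) (G : set (set U))
    (S : set (U -> \bar R)) : U -> \bar R :=
  xget (cst 0) [set g | is_fam_ess_sup P G S g].

End conditional_expectation.

Section risk_measures.
Context {d} {Omega : measurableType d} {R : realType}.
Variables (P : probability Omega R) (T : R) (F : R -> set (set Omega)).
Implicit Types (X Y f h : Omega -> R) (s t : R) (p : \bar R).

Record complete_filtration : Prop := {
  filtration_sigma_algebra :
    forall t, 0 <= t <= T -> sigma_algebra setT (F t);
  filtration_sub : forall t, 0 <= t <= T -> F t `<=` measurable;
  filtration_mono :
    forall s t, 0 <= s -> s <= t -> t <= T -> F s `<=` F t;
  filtration_complete : P.-negligible `<=` F 0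
}.

Definition trivial_sigma_algebra (G : set (set Omega)) : Prop :=
  forall A, G A -> P A = 0%E \/ P A = 1%E.

Definition Lp p t : set (Omega -> R) :=
  [set X | measurable_wrt (F t) X /\ X \in Lfun P p].

(* probability measures on (Omega, F t), and not on the whole of Omega's
   sigma-algebra *)
Definition prob_at t := probability (g_sigma_algebraType (F t)) R.

Definition equiv_P t (Q : prob_at t) : Prop :=
  forall A, F t A -> (Q A = 0%E <-> P A = 0%E).

Record fully_dynamic_convex_risk_measure p
    (rho : R -> R -> (Omega -> R) -> (Omega -> R)) : Prop := {
  risk_Lp : forall s t X, 0 <= s -> s <= t -> t <= T ->
    Lp p t X -> Lp p s (rho s t X);
  risk_monotone : forall s t X Y, 0 <= s -> s <= t -> t <= T ->
    Lp p t X -> Lp p t Y -> (\forall x \ae P, Y x <= X x) ->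
    \forall x \ae P, rho s t X x <= rho s t Y x;
  risk_convex : forall s t X Y (l : R), 0 <= s -> s <= t -> t <= T ->
    Lp p t X -> Lp p t Y -> 0 <= l <= 1 ->
    \forall x \ae P, rho s t (fun w => l * X w + (1 - l) * Y w) x
                     <= l * rho s t X x + (1 - l) * rho s t Y x;
  risk_translation : forall s t X f, 0 <= s -> s <= t -> t <= T ->
    Lp p t X -> Lp p s f ->
    \forall x \ae P, rho s t (fun w => X w + f w) x = rho s t X x - f x
}.

Definition strong_time_consistent p
    (rho : R -> R -> (Omega -> R) -> (Omega -> R)) : Prop :=
  forall r s t X, 0 <= r -> r <= s -> s <= t -> t <= T -> Lp p t X ->
    \forall x \ae P, rho r t X x = rho r s (fun w => - rho s t X w) x.

Definition min_penalty p (rho : R -> R -> (Omega -> R) -> (Omega -> R))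
    s t (Q : prob_at t) : Omega -> \bar R :=
  fam_ess_sup P (F s)
    [set (fun x => cexp Q (F s) (fun w => (- X w)%:E) x - (rho s t X x)%:E)%E
       | X in Lp p t].

Record coherent_risk_measure p t (rho : (Omega -> R) -> R) : Prop := {
  coherent_monotone : forall X Y, Lp p t X -> Lp p t Y ->
    (\forall x \ae P, Y x <= X x) -> rho X <= rho Y;
  coherent_translation : forall X (c : R), Lp p t X ->
    rho (fun w => X w + c) = rho X - c;
  coherent_subadditive : forall X Y, Lp p t X -> Lp p t Y ->
    rho (fun w => X w + Y w) <= rho X + rho Y;
  coherent_homogeneous : forall X (l : R), Lp p t X -> 0 <= l ->
    rho (fun w => l * X w) = l * rho X
}.

(* When F 0 is trivial, the elements of L_p(F 0) are a.s. constant; a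
   real-valued risk measure is therefore a rho with values in L_p(F 0), and
   inequalities between its values are stated P-a.s. *)
Definition dominated p t (rho : (Omega -> R) -> (Omega -> R)) : Prop :=
  exists2 rho', coherent_risk_measure p t rho' &
    forall X, Lp p t X ->
      \forall x \ae P, rho X x - rho (cst 0) x <= rho' X.

Definition domination_constant p t (rho : (Omega -> R) -> (Omega -> R))
    (K : R) : Prop :=
  0 < K /\ exists C : R, forall X, Lp p t X ->
    \forall x \ae P, ((rho X x)%:E <= K%:E * 'N[P]_p[EFin \o X] + C%:E)%E.

Definition finite_penalty p (rho : R -> R -> (Omega -> R) -> (Omega -> R))
    t (Q : prob_at t) : Prop :=
  equiv_P Q /\ \forall x \ae P, (min_penalty p rho 0 Q x < +oo)%E.

Definition sensitive p (rho : R -> R -> (Omega -> R) -> (Omega -> R)) t :=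
  exists Q : prob_at t, finite_penalty p rho Q.

Definition calQ p (rho : R -> R -> (Omega -> R) -> (Omega -> R)) :
    set (prob_at T) :=
  [set Q | finite_penalty p rho Q].

Definition restricts_to_P s t (Q : prob_at t) : Prop :=
  forall A, F s A -> Q A = P A.

Definition calP p (rho : R -> R -> (Omega -> R) -> (Omega -> R)) s t :
    set (prob_at t) :=
  [set Q | [/\ equiv_P Q, restricts_to_P s Q &
     exists2 f, Lp p s f &
       \forall x \ae P, min_penalty p rho s Q x = (f x)%:E]].

Definition calPtilde p (rho : R -> R -> (Omega -> R) -> (Omega -> R)) s t :
    set (prob_at t) :=
  [set Q' | [/\ equiv_P Q', restricts_to_P s Q' &
     (ereal_sup [set \int[Q]_x min_penalty p rho s Q' x | Q in calQ p rho]
        < +oo)%E]].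

End risk_measures.

Arguments min_penalty {d Omega R} P F p rho s {t} Q.
Arguments calP {d Omega R} P F p rho s t.
Arguments calPtilde {d Omega R} P T F p rho s t.
Arguments calQ {d Omega R} P T F p rho.

(* Main.v *)
Require Import Defs.
From HB Require Import structures.
From mathcomp Require Import all_boot all_order all_algebra.
From mathcomp Require Import all_classical all_reals all_analysis.
From mathcomp Require Import measurable_realfun.
From mathcomp Require Import ring lra.
Import Order.TTheory GRing.Theory Num.Theory.
Import numFieldNormedType.Exports.

Set Implicit Arguments.
Unset Strict Implicit.
Unset Printing Implicit Defensive.

Local Open Scope classical_set_scope.
Local Open Scope ring_scope.

(* Fix a probability equivalent to P with finite penalty and let zt be its
   density. For X in L_p(F_t), a Hahn-Banach subgradient at X of the finite convex
   functional Y |-> E[zt * rho_st(Y)] is, by domination and the Riesz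
   representation of L_p, given by a density w. Since rho_st is local, optimality
   of the integral at X is optimality pointwise, so that w, normalized
   conditionally on F_s, attains the supremum in the dual formula for rho_st(X).
   Locality is not assumed: it follows by truncation from the one-sided L_p
   continuity of rho_0t, time consistency and sensitivity. Mixing the optimal
   density with a fixed positive one, with F_s-measurable weights, makes it
   positive and its penalty p-integrable, at an arbitrarily small cost.

   For Q in calQ and Q' in calPtilde, and f >= 0, the inequality
   l E_Q'(f | F_s) <= alpha_st(Q') + rho_st(- l f), integrated against Q, shows
   l E_Q[E_Q'(f | F_s)] <= K l |f|_p + constant for every l > 0, hence the bound K
   on the functional X |-> E_Q[E_Q'(X | F_s)]. *)

(** * Conditional expectation given a sub-sigma-algebra *)

(** Domination is assumed at time T only. Translation invariance gives rho_st(f + rho_st(0)) = -f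
    for f in L_p(F_s), hence rho_0s(f) = rho_0t(f + rho_st(0)): linear growth passes to earlier
    times with the same slope K, and only additive constants change. These disappear when bounds are
    tested on l X with l large. A subgradient yields only an inequality between expectations.
    Locality allows positions to be pasted along F_s-events; this localizes the inequality, and also
    shows that running maxima of scores are attained, so that the fixed positive density has an a.s.
    finite penalty a. The density optimal at the position 0 has penalty -rho_st(0), which lies in
    L_p; mixing the two with weight 1/(1+|a|) on the first gives a positive density with
    p-integrable penalty. Integrability under a candidate density z comes from its penalty: a finite
    penalty, tested on -|Y|, forces E(z|Y| | F_s) to be finite. A penalty f in L_p(F_s) satisfies
    E_Q(f) <= K |f|_p for every Q in [calQ], so [calP] lies in [calPtilde] and one lemma gives both
    representations. *)

Section sub_sigma_algebra.
Local Open Scope ereal_scope.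
Context {d} {U : measurableType d} {R : realType}.
Variables (G : set (set U)) (sG : sigma_algebra setT G) (GM : G `<=` measurable).

Lemma measurable_gE (A : set U) :
  measurable (A : set (g_sigma_algebraType G)) = G A.
Proof. by rewrite (measurable_g_measurableTypeE sG). Qed.

Lemma measurable_wrt_fun d' (V : sigmaRingType d') (f : U -> V) :
  measurable_wrt G f -> measurable_fun setT f.
Proof.
move=> mf _ B mB; apply: GM; rewrite -measurable_gE.
exact: mf.
Qed.

Section measure_of_set_function.
Variables (m : set U -> \bar R).
Hypotheses (m0 : m set0 = 0) (mge0 : forall A, 0 <= m A).
Hypothesis msig : forall F : (set U)^nat, (forall i, G (F i)) ->
  trivIset setT F ->
  (fun n => \sum_(0 <= i < n) m (F i)) @ \oo --> m (\bigcup_n F n).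

(** A copy of [m] typed on [g_sigma_algebraType G], so that the measure structure belongs to G and
    not to the ambient sigma-algebra. *)
Definition set_measure (A : set (g_sigma_algebraType G)) : \bar R := m A.

Let sm0 : set_measure set0 = 0. Proof. exact: m0. Qed.
Let smge0 A : 0 <= set_measure A. Proof. exact: mge0. Qed.
Let smsig : semi_sigma_additive set_measure.
Proof.
move=> F mF tF _; apply: msig => // i.
by rewrite -measurable_gE; exact: mF.
Qed.

HB.instance Definition _ := isMeasure.Build _ _ _ set_measure sm0 smge0 smsig.

Lemma exists_measure :
  exists nu : {measure set (g_sigma_algebraType G) -> \bar R},
    forall A, nu A = m A.
Proof. by exists set_measure. Qed.

End measure_of_set_function.

Lemma exists_density_measure (P : {measure set U -> \bar R}) (u : U -> \bar R) :
  measurable_fun setT u -> (forall x, 0 <= u x) ->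
  exists nu : {measure set (g_sigma_algebraType G) -> \bar R},
    forall A, nu A = \int[P]_(x in A) u x.
Proof.
move=> mu u0; apply: exists_measure.
- exact: integral_set0.
- by move=> A; apply: integral_ge0.
- move=> F GF tF.
  rewrite ge0_integral_bigcup//; last 2 first.
  + by move=> i; apply: GM.
  + exact: measurable_funTS.
  by apply: is_cvg_ereal_nneg_natsum => n _; apply: integral_ge0.
Qed.

Section probability_of_measure.
Variables (nu : {measure set (g_sigma_algebraType G) -> \bar R}).
Hypothesis nuT : nu setT = 1.

Definition unit_measure (A : set (g_sigma_algebraType G)) : \bar R := nu A.

HB.instance Definition _ := Measure.on unit_measure.
HB.instance Definition _ := Measure_isProbability.Build _ _ _ unit_measure nuT.

Lemma exists_probability :
  exists Q : probability (g_sigma_algebraType G) R, forall A, Q A = nu A.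
Proof. by exists unit_measure. Qed.

End probability_of_measure.

Section finite_measure_of_measure.
Variables (nu : {measure set (g_sigma_algebraType G) -> \bar R}).
Hypothesis nuT : nu setT < +oo.

Definition fin_measure (A : set (g_sigma_algebraType G)) : \bar R := nu A.

HB.instance Definition _ := Measure.on fin_measure.

Let fin_measureP : fin_num_fun fin_measure.
Proof. exact: lty_fin_num_fun. Qed.

HB.instance Definition _ := Measure_isFinite.Build _ _ _ fin_measure fin_measureP.

Lemma exists_finite_measure :
  exists Q : {finite_measure set (g_sigma_algebraType G) -> \bar R},
    forall A, Q A = nu A.
Proof. by exists fin_measure. Qed.

End finite_measure_of_measure.

Import HBNNSimple.

(** The level sets of the simple functions approximating [phi] lie in G, where [nu] is known;
    monotone convergence is applied on both sides. The density [u] is measurable for the ambient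
    sigma-algebra only. *)
Lemma integral_density (P : {measure set U -> \bar R}) (u phi : U -> \bar R)
    (nu : {measure set (g_sigma_algebraType G) -> \bar R}) :
  measurable_fun setT u -> (forall x, 0 <= u x) ->
  (forall A, G A -> nu A = \int[P]_(x in A) u x) ->
  measurable_wrt G phi -> (forall x, 0 <= phi x) ->
  \int[nu]_x phi x = \int[P]_x (phi x * u x).
Proof.
move=> mu u0 nuE mphi phi0.
have mT : measurable (setT : set (g_sigma_algebraType G)) by exact: measurableT.
pose h := nnsfun_approx mT mphi.
have nd x a b : (a <= b)%N -> (h a x <= h b x)%R.
  move=> ab; have /lefP := nd_nnsfun_approx mT mphi ab; exact.
have h_ge0 n x : (0 <= h n x)%R by exact: fun_ge0.
have mh n : measurable_fun [set: U] (h n).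
  by apply: measurable_wrt_fun; exact/measurable_funP.
have -> : \int[nu]_x phi x = lim (\int[nu]_x (EFin \o h n) x @[n --> \oo]).
  have fE x : phi x = lim ((EFin \o h n) x @[n --> \oo]).
    by apply/esym/cvg_lim => //; exact: cvg_nnsfun_approx.
  under eq_integral => x _ do rewrite fE.
  apply: monotone_convergence => //.
  - by move=> n; apply/measurable_EFinP; exact/measurable_funP.
  - by move=> n x Ex //=; rewrite lee_fin.
  - by move=> x Ex a b ab; rewrite lee_fin; exact: nd.
have -> : \int[P]_x (phi \* u) x =
    lim (\int[P]_x ((EFin \o h n) \* u) x @[n --> \oo]).
  have hphi x : (h n x)%:E @[n --> \oo] --> phi x by exact: cvg_nnsfun_approx.
  have fg x : (h n x)%:E * u x @[n --> \oo] --> phi x * u x.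
    (* A product 0 times oo is a point of discontinuity of the multiplication; where a factor
       vanishes the sequence is shown to be constant instead. *)
    have [phi0x|phi_neq0] := eqVneq (phi x) 0.
      have h0 n : (h n x)%:E = 0.
        apply/eqP; rewrite eq_le -phi0x; apply/andP; split; last first.
          by rewrite phi0x lee_fin.
        have /ereal_nondecreasing_cvgn c : nondecreasing_seq (fun n => (h n x)%:E).
          by move=> a b ab; rewrite lee_fin; exact: nd.
        rewrite (cvg_unique _ (hphi x) c)//.
        by apply: ereal_sup_ubound; exists n.
      rewrite phi0x mul0e; under eq_fun do rewrite h0 mul0e.
      exact: cvg_cst.
    have [->|ux_neq0] := eqVneq (u x) 0.
      by rewrite mule0; under eq_fun do rewrite mule0; exact: cvg_cst.
    apply: cvgeM => //; last exact: cvg_cst.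
    by rewrite mule_defE (negbTE phi_neq0) (negbTE ux_neq0).
  rewrite -monotone_convergence//.
  - by apply: eq_integral => x _; apply/esym/cvg_lim => //; exact: fg.
  - by move=> n; apply: emeasurable_funM => //; exact/measurable_EFinP.
  - by move=> n x Ex /=; rewrite mule_ge0 ?lee_fin.
  - by move=> x Ex a b ab/=; rewrite lee_wpmul2r ?lee_fin//; exact: nd.
suff suf n : \int[P]_x ((EFin \o h n) x * u x) = \int[nu]_x (EFin \o h n) x.
  by congr (lim (_ @ \oo)); apply/funext => n; rewrite suf.
transitivity (\int[nu]_x
   (\sum_(y \in range (h n)) (y * \1_(h n @^-1` [set y]) x)%:E)); last first.
  by apply: eq_integral => t tE; rewrite /= fimfunE -fsumEFin.
have Gh r : G (h n @^-1` [set r]).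
  rewrite -measurable_gE.
  by rewrite -[X in measurable X]setTI; exact: measurable_funP.
have mHr r : measurable (h n @^-1` [set r] : set U) by apply: GM.
have mindic r : measurable_fun setT (fun x : U => (r * \1_(h n @^-1` [set r]) x)%:E).
  by apply/measurable_EFinP; apply: measurable_funM => //; exact: measurable_indic.
rewrite ge0_integral_fsum//; last 2 first.
  - by move=> y; apply/measurable_EFinP; apply: measurable_funM => //.
  - by move=> y x _; exact: nnfun_muleindic_ge0.
transitivity (\int[P]_x (\sum_(y \in range (h n))
    (y * \1_(h n @^-1` [set y]) x)%:E * u x)).
  apply: eq_integral => x _.
  rewrite -ge0_mule_fsuml => [|y]; last exact: nnfun_muleindic_ge0.
  by rewrite fsumEFin//= [in LHS](fimfunE (h n) x).
rewrite ge0_integral_fsum//; last 2 first.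
  - by move=> y; apply: emeasurable_funM => //.
  - by move=> y x _; rewrite mule_ge0// nnfun_muleindic_ge0.
apply: eq_fsbigr => r rhn.
have r0 : (0 <= r)%R by move: rhn; rewrite inE => -[t _ <-].
under [RHS]eq_integral do rewrite EFinM.
have mHr' : measurable (h n @^-1` [set r] : set (g_sigma_algebraType G)).
  by rewrite measurable_gE.
rewrite ge0_integralZl//; last exact/measurable_EFinP/measurable_indic.
have -> : \int[nu]_x (\1_(h n @^-1` [set r]) x)%:E = nu (h n @^-1` [set r]).
  by rewrite integral_indic//; congr (nu _); exact: setIT.
rewrite nuE//.
under eq_integral do rewrite EFinM -muleA.
rewrite ge0_integralZl//; last 2 first.
- by apply: emeasurable_funM => //; exact/measurable_EFinP/measurable_indic.
- by move=> t Et; rewrite mule_ge0 ?lee_fin.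
congr (_ * _).
rewrite [RHS]integral_mkcond.
by apply: eq_integral => x _; rewrite epatch_indic muleC.
Qed.

End sub_sigma_algebra.

Section cexp_theory.
Local Open Scope ereal_scope.
Context {d} {U : measurableType d} {R : realType}.
Variables (P : probability U R).
Variables (G : set (set U)) (sG : sigma_algebra setT G) (GM : G `<=` measurable).

Lemma measurable_wrt_indic (A : set U) :
  G A -> measurable_wrt G (\1_A : U -> R).
Proof.
by move=> GA; apply: (@measurable_indic _ (g_sigma_algebraType G));
   rewrite (measurable_gE sG).
Qed.

Lemma measurable_wrt_patch (A : set U) (phi : U -> \bar R) :
  G A -> measurable_wrt G phi -> measurable_wrt G (phi \_ A).
Proof.
move=> GA mphi.
have mA : measurable (A : set (g_sigma_algebraType G)) by rewrite (measurable_gE sG).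
apply: (measurable_restrictT _ mA).1.
exact: (@measurable_funTS _ _ (g_sigma_algebraType G)).
Qed.

Lemma integral_density_in (u phi : U -> \bar R)
    (nu : {measure set (g_sigma_algebraType G) -> \bar R}) A :
  measurable_fun setT u -> (forall x, 0 <= u x) ->
  (forall A, G A -> nu A = \int[P]_(x in A) u x) ->
  measurable_wrt G phi -> (forall x, 0 <= phi x) -> G A ->
  \int[nu]_(x in A) phi x = \int[P]_(x in A) (phi x * u x).
Proof.
move=> mu u0 nuE mphi phi0 GA.
rewrite integral_mkcond (integral_density sG GM mu u0 nuE); last 2 first.
- exact: measurable_wrt_patch.
- by move=> x; rewrite /patch; case: ifP.
rewrite [RHS]integral_mkcond; apply: eq_integral => x _.
by rewrite /patch; case: ifP => //; rewrite mul0e.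
Qed.

(** [u] and [v] define the same measure on G, and each side is the integral of [phi] against it. *)
Lemma integralM_eq (u v phi : U -> \bar R) :
  measurable_fun setT u -> (forall x, 0 <= u x) ->
  measurable_fun setT v -> (forall x, 0 <= v x) ->
  (forall A, G A -> \int[P]_(x in A) u x = \int[P]_(x in A) v x) ->
  measurable_wrt G phi -> (forall x, 0 <= phi x) ->
  \int[P]_x (phi x * u x) = \int[P]_x (phi x * v x).
Proof.
move=> mu u0 mv v0 uv mphi phi0.
have [nu nuE] := exists_density_measure sG GM P mu u0.
rewrite -(integral_density sG GM mu u0 (fun A _ => nuE A) mphi phi0).
by apply: (integral_density sG GM mv v0) => // A GA; rewrite -uv.
Qed.

(** Radon-Nikodym on G, for [nu] and the restriction of P to G. The restriction is built as the
    measure with density 1, so that [integral_density_in] brings the integrals back to P. *)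
Lemma exists_density (nu : {measure set (g_sigma_algebraType G) -> \bar R}) :
  nu setT < +oo ->
  (forall A, G A -> P A = 0 -> nu A = 0) ->
  exists z : U -> R, [/\ measurable_wrt G z, (forall x, 0 <= z x)%R &
    forall A, G A -> nu A = \int[P]_(x in A) (z x)%:E].
Proof.
move=> nufin nuP.
have [Q QE] := exists_finite_measure nufin.
have m1 : measurable_fun setT (cst 1 : U -> \bar R) by exact: measurable_cst.
have [P0 P0E] := exists_density_measure sG GM P m1 (fun=> lee01).
have P0P A : G A -> P0 A = P A.
  by move=> GA; rewrite P0E integral_cst ?mul1e//; exact: GM.
have P0fin : P0 setT < +oo.
  rewrite P0P; first by rewrite (le_lt_trans (probability_le1 _ _))// ltry.
  by rewrite -(measurable_gE sG)//; exact: measurableT.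
have [P1 P1E] := exists_finite_measure P0fin.
have QP : Q `<< P1.
  apply/null_content_dominatesP => A mA.
  have GA : G A by rewrite -(measurable_gE sG).
  move=> P10; have : P1 A = 0 by exact: P10.
  by rewrite P1E P0P// => /(nuP _ GA) nuA0; exact: etrans (QE A) nuA0.
pose f := Radon_Nikodym_SigmaFinite.f Q P1.
have fint := Radon_Nikodym_SigmaFinite.f_integrable QP.
have f0 := Radon_Nikodym_SigmaFinite.f_ge0 QP.
have ffin := Radon_Nikodym_SigmaFinite.f_fin_num QP.
have mf : measurable_wrt G f by exact: (measurable_int _ fint).
exists (fine \o f); split.
- exact: (measurableT_comp (@fine_measurable _ _ _)).
- by move=> x; rewrite fine_ge0//; exact: f0.
- move=> A GA.
  rewrite -QE (Radon_Nikodym_SigmaFinite.f_integral QP); last first.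
    by rewrite (measurable_gE sG).
  rewrite (integral_density_in m1 (fun=> lee01) _ mf f0 GA); last first.
    by move=> B GB; exact: etrans (P1E B) (P0E B).
  by apply: eq_integral => x _; rewrite mule1 fineK//; exact: ffin.
Qed.

Lemma ge0_ae_le (g h : U -> \bar R) :
  measurable_wrt G g -> (forall x, 0 <= g x) ->
  measurable_wrt G h -> (forall x, 0 <= h x) ->
  (forall A, G A -> \int[P]_(x in A) g x <= \int[P]_(x in A) h x) ->
  \forall x \ae P, g x <= h x.
Proof.
move=> mg g0 mh h0 gh.
have mg' := measurable_wrt_fun sG GM mg.
have mh' := measurable_wrt_fun sG GM mh.
(* The bound n makes [h], and then [g] by hypothesis, integrable on [A n], so that the integrals may
   be subtracted. The sets [A n] exhaust the event h < g. *)
pose A n := [set x | h x < g x] `&` [set x | h x <= n%:R%:E].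
have GA n : G (A n).
  rewrite -(measurable_gE sG)//; apply: measurableI.
    rewrite -[X in measurable X]setTI.
    exact: (@measurable_lte _ (g_sigma_algebraType G)).
  rewrite -[X in measurable X]setTI.
  exact: (@emeasurable_fun_infty_c _ (g_sigma_algebraType G)).
suff A0 n : P (A n) = 0.
  exists (\bigcup_n A n); split.
  - by apply: bigcupT_measurable => n; exact: GM.
  - apply/measure_negligible; first by apply: bigcupT_measurable => n; exact: GM.
    apply: negligible_bigcup => n; apply/negligibleP; first exact: GM.
    exact: A0.
  - move=> x /= /negP; rewrite -ltNge => hgx.
    have hfin : h x \is a fin_num by rewrite ge0_fin_numE// (lt_le_trans hgx)// leey.
    exists (Num.truncn (fine (h x))).+1 => //; split => //=.
    rewrite -(fineK hfin) lee_fin.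
    by rewrite ltW// truncnS_gt.
have mA n := GM (GA n).
have hint : P.-integrable (A n) h.
  apply/integrableP; split; first exact: measurable_funTS.
  under eq_integral do rewrite gee0_abs//.
  apply: (@le_lt_trans _ _ (\int[P]_(x in A n) n%:R%:E)).
    by apply: ge0_le_integral => //; [exact: measurable_funTS|move=> x []].
  by rewrite integral_cst// ltey_eq fin_numM// fin_num_measure.
have gint : P.-integrable (A n) g.
  apply/integrableP; split; first exact: measurable_funTS.
  under eq_integral do rewrite gee0_abs//.
  apply: le_lt_trans (gh _ (GA n)) _.
  by case/integrableP : hint => _; under eq_integral do rewrite gee0_abs//.
have : \int[P]_(x in A n) `|(g \- h) x| = 0.
  rewrite (eq_integral (g \- h)); last first.
    move=> x; rewrite inE => -[/= hg hn]; rewrite gee0_abs//.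
    by rewrite suber_ge0 ?ltW// ge0_fin_numE// (le_lt_trans hn)// ltry.
  rewrite integralB//; apply/le_anti/andP; split; last first.
    rewrite sube_ge0 ?integrable_fin_num// ?orbT//.
    by apply: ge0_le_integral => //; [exact: measurable_funTS|exact: measurable_funTS
      |move=> x [/= /ltW]].
  by rewrite sube_le0; exact: gh.
move/(ae_eq_integral_abs _ (mA n)) => H.
apply/negligibleP => //.
have := H (measurable_funTS (emeasurable_funB mg' mh')).
apply: negligibleS => x Ax /= /(_ Ax) gh0.
move: Ax => [/= + hn].
have hfin : h x \is a fin_num.
  by rewrite ge0_fin_numE// (le_lt_trans hn)// ltry.
by rewrite -sube_gt0 gh0 ltxx.
Qed.

Definition cexp_ge0 := ge0_cexp P G.

Lemma exists_cexp_ge0_integrable (u : U -> \bar R) :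
  measurable_fun setT u -> (forall x, 0 <= u x) -> \int[P]_x u x < +oo ->
  exists g, is_ge0_cexp P G u g.
Proof.
move=> mu u0 uoo.
have [nu nuE] := exists_density_measure sG GM P mu u0.
have nuT : nu setT < +oo by rewrite nuE.
have nuP A : G A -> P A = 0 -> nu A = 0.
  move=> GA PA0; rewrite nuE null_set_integral//; first exact: GM.
    exact: measurable_funTS.
have [z [mz z0 zE]] := exists_density nuT nuP.
exists (EFin \o z); split.
- exact/(@measurable_EFinP _ (g_sigma_algebraType G)).
- by move=> x; rewrite lee_fin.
- by move=> A GA; rewrite -zE// nuE.
Qed.

Lemma cvg_mine_natr (a : \bar R) : 0 <= a -> mine a n%:R%:E @[n --> \oo] --> a.
Proof.
case: a => [r| |]//; last first.
  move=> _; under eq_fun do rewrite min_r ?leey//.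
  by apply/cvgeyPge => M; near=> n; rewrite lee_fin; near: n; exact: nbhs_infty_ger.
rewrite lee_fin => r0; apply: cvg_near_cst.
near=> n; rewrite min_l// lee_fin.
by near: n; exact: nbhs_infty_ger.
Unshelve. all: by end_near. Qed.

(** A function that is not integrable is cut into the layers min(u, n+1) - min(u, n), which are
    bounded; the conditional expectations of the layers are summed. *)
Lemma exists_cexp_ge0 (u : U -> \bar R) :
  measurable_fun setT u -> (forall x, 0 <= u x) ->
  exists g, is_ge0_cexp P G u g.
Proof.
move=> mu u0.
pose v n x := mine (u x) n%:R%:E.
have v0 n x : 0 <= v n x by rewrite /v le_min u0 lee_fin ler0n.
have vn n x : v n x <= n%:R%:E by rewrite /v ge_min lexx orbT.
have vfin n x : v n x \is a fin_num.
  by rewrite ge0_fin_numE// (le_lt_trans (vn n x))// ltry.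
have mv n : measurable_fun setT (v n).
  by apply: measurable_mine => //; exact: measurable_cst.
pose w n x := v n.+1 x - v n x.
have vS n x : v n x <= v n.+1 x.
  by rewrite /v le_min !ge_min lexx/= lee_fin ler_nat leqnSn orbT.
have w0 n x : 0 <= w n x by rewrite /w suber_ge0.
have mw n : measurable_fun setT (w n) by exact: emeasurable_funB.
have wint n : \int[P]_x w n x < +oo.
  apply: (@le_lt_trans _ _ (\int[P]_x n.+1%:R%:E)).
    apply: ge0_le_integral => // x _.
    by rewrite (le_trans _ (vn n.+1 x))// /w leeBlDr// leeDl.
  by rewrite integral_cst// ltey_eq fin_numM// fin_num_measure.
have /choice[g gP] n : exists g, is_ge0_cexp P G (w n) g.
  exact: exists_cexp_ge0_integrable.
exists (fun x => \sum_(n <oo) g n x); split.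
- apply: (@ge0_emeasurable_sum _ (g_sigma_algebraType G)) => //.
    by move=> n x _ _; have [_ + _] := gP n; exact.
  by move=> n _; have [+ _ _] := gP n.
- by move=> x; apply: nneseries_ge0 => n _ _; have [_ + _] := gP n; exact.
- move=> A GA; have mA := GM GA.
  rewrite integral_nneseries//; last 2 first.
  + move=> n; apply: measurable_funTS; apply: (measurable_wrt_fun sG GM).
    by have [] := gP n.
  + by move=> n x _; have [_ + _] := gP n; exact.
  transitivity (\sum_(n <oo) \int[P]_(x in A) w n x).
    by apply: eq_eseriesr => n _; have [_ _ ->] := gP n.
  rewrite -integral_nneseries//; last by move=> n; exact: measurable_funTS.
  apply: eq_integral => x _.
  apply/cvg_lim => //; rewrite [X in X @ _ --> _](_ : _ = v ^~ x).
    exact: cvg_mine_natr.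
  apply/funext => n; elim: n => [|n IH].
    by rewrite big_geq// /v min_r.
  by rewrite big_nat_recr//= IH /w [LHS]addeC subeK.
Qed.

Lemma cexp_ge0P (u : U -> \bar R) :
  measurable_fun setT u -> (forall x, 0 <= u x) ->
  is_ge0_cexp P G u (cexp_ge0 u).
Proof. by move=> mu u0; apply: xgetPex; exact: exists_cexp_ge0. Qed.

(** If no version exists, [xget] returns its default, the zero function, which is measurable too. *)
Lemma measurable_cexp_ge0 (u : U -> \bar R) : measurable_wrt G (cexp_ge0 u).
Proof.
rewrite /cexp_ge0 /ge0_cexp; case: xgetP => [g _ []//|_].
exact: (@measurable_cst _ _ (g_sigma_algebraType G)).
Qed.

Lemma cexp_ge0_ge0 (u : U -> \bar R) x : 0 <= cexp_ge0 u x.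
Proof. by rewrite /cexp_ge0 /ge0_cexp; case: xgetP => [g _ []|_]. Qed.

Hint Resolve measurable_cexp_ge0 cexp_ge0_ge0 : core.

Lemma cexp_ge0_unique (u g h : U -> \bar R) :
  is_ge0_cexp P G u g -> is_ge0_cexp P G u h -> \forall x \ae P, g x = h x.
Proof.
move=> [mg g0 gE] [mh h0 hE].
have gh : \forall x \ae P, g x <= h x.
  by apply: ge0_ae_le => // A GA; rewrite gE// hE.
have hg : \forall x \ae P, h x <= g x.
  by apply: ge0_ae_le => // A GA; rewrite gE// hE.
by apply: filterS2 gh hg => x ? ?; apply/le_anti/andP; split.
Qed.

Lemma cexp_ge0_le (u v : U -> \bar R) :
  measurable_fun setT u -> (forall x, 0 <= u x) ->
  measurable_fun setT v -> (forall x, 0 <= v x) ->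
  (\forall x \ae P, u x <= v x) ->
  \forall x \ae P, cexp_ge0 u x <= cexp_ge0 v x.
Proof.
move=> mu u0 mv v0 uv; apply: ge0_ae_le => // A GA.
have [_ _ ->//] := cexp_ge0P mu u0; have [_ _ ->//] := cexp_ge0P mv v0.
apply: ae_ge0_le_integral => //; first exact: GM.
- exact: measurable_funTS.
- exact: measurable_funTS.
- by apply: filterS uv => x ? _.
Qed.

Lemma cexp_ge0_cst0 : \forall x \ae P, cexp_ge0 (cst 0) x = 0.
Proof.
apply: (@cexp_ge0_unique (cst 0)).
  by apply: cexp_ge0P => //; exact: measurable_cst.
by split => //; exact: (@measurable_cst _ _ (g_sigma_algebraType G)).
Qed.

Lemma integral_mul_cexp_ge0 (phi u : U -> \bar R) :
  measurable_fun setT u -> (forall x, 0 <= u x) ->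
  measurable_wrt G phi -> (forall x, 0 <= phi x) ->
  \int[P]_x (phi x * cexp_ge0 u x) = \int[P]_x (phi x * u x).
Proof.
move=> mu u0 mphi phi0; apply: integralM_eq => //.
- exact: (measurable_wrt_fun sG GM).
- by have [] := cexp_ge0P mu u0.
Qed.

Lemma cexp_ge0D (u v : U -> \bar R) :
  measurable_fun setT u -> (forall x, 0 <= u x) ->
  measurable_fun setT v -> (forall x, 0 <= v x) ->
  \forall x \ae P, cexp_ge0 (u \+ v) x = cexp_ge0 u x + cexp_ge0 v x.
Proof.
move=> mu u0 mv v0; apply: (@cexp_ge0_unique (u \+ v)).
  by apply: cexp_ge0P; [exact: emeasurable_funD|move=> x; exact: adde_ge0].
split.
- by apply: (@emeasurable_funD _ (g_sigma_algebraType G)); exact: measurable_cexp_ge0.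
- by move=> x; exact: adde_ge0.
- move=> A GA; have mA := GM GA.
  rewrite !ge0_integralD//; try exact: measurable_funTS;
    try by apply: measurable_funTS; exact: (measurable_wrt_fun sG GM).
  by have [_ _ ->//] := cexp_ge0P mu u0; have [_ _ ->//] := cexp_ge0P mv v0.
Qed.

Lemma cexp_ge0M (phi u : U -> \bar R) :
  measurable_fun setT u -> (forall x, 0 <= u x) ->
  measurable_wrt G phi -> (forall x, 0 <= phi x) ->
  \forall x \ae P, cexp_ge0 (phi \* u) x = phi x * cexp_ge0 u x.
Proof.
move=> mu u0 mphi phi0.
have mphi' := measurable_wrt_fun sG GM mphi.
apply: (@cexp_ge0_unique (phi \* u)).
  by apply: cexp_ge0P; [exact: emeasurable_funM|move=> x; exact: mule_ge0].
split.
- apply: (@emeasurable_funM _ (g_sigma_algebraType G)) => //; exact: measurable_cexp_ge0.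
- by move=> x; exact: mule_ge0.
- move=> A GA; have mA := GM GA.
  (* The restriction to A is absorbed into the G-measurable factor. *)
  have H w : \int[P]_(x in A) (phi x * w x) = \int[P]_x ((phi \_ A) x * w x).
    rewrite integral_mkcond; apply: eq_integral => x _.
    by rewrite /patch; case: ifP => //; rewrite mul0e.
  have phiA0 x : 0 <= (phi \_ A) x by rewrite /patch; case: ifP.
  rewrite H (H u) integral_mul_cexp_ge0//; exact: measurable_wrt_patch.
Qed.

(** * Essential suprema of families of G-measurable functions *)

Section essential_supremum.
Implicit Types (S : set (U -> \bar R)).

Definition seq_sup (f : nat -> U -> \bar R) (x : U) := ereal_sup (range (f ^~ x)).

Lemma measurable_seq_sup (f : nat -> U -> \bar R) :
  (forall n, measurable_wrt G (f n)) -> measurable_wrt G (seq_sup f).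
Proof.
move=> mf.
rewrite (_ : seq_sup f = fun x => esups (f ^~ x) 0%N).
  exact: (@measurable_fun_esups _ (g_sigma_algebraType G)).
apply/funext => x; rewrite /seq_sup /esups; congr ereal_sup.
by apply/seteqP; split => [_ [n _ <-]|_ [n _ <-]]; exists n.
Qed.

Lemma le_seq_sup (f : nat -> U -> \bar R) n x : f n x <= seq_sup f x.
Proof. by apply: ereal_sup_ubound; exists n. Qed.

(** The two infinite points are isolated; what remains is r / (1 + |r|), which is continuous. *)
Lemma measurable_contract : measurable_fun setT (@contract R).
Proof.
rewrite (_ : @contract R = fun x => if x == +oo then 1%R else
   if x == -oo then (-1)%R else (fine x * (1 + `|fine x|)^-1)%R); last first.
  by apply/funext => -[r| |].
apply: measurable_fun_ifT => //.
  by apply: measurable_fun_eqe => //.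
apply: measurable_fun_ifT => //.
  by apply: measurable_fun_eqe => //.
have mg : measurable_fun setT (fun r : R => r * (1 + `|r|)^-1)%R.
  apply: measurable_funM => //; apply: continuous_measurable_fun => r.
  apply: cvgV; first by rewrite lt0r_neq0// ltr_pwDl.
  by apply: cvgD; [exact: cvg_cst|exact: norm_continuous].
by apply: (measurableT_comp mg); exact: fine_measurable.
Qed.

(* The essential supremum is attained by a sequence maximizing the integral of
   a bounded increasing function of the supremum. *)
Lemma exists_fam_ess_sup S : S !=set0 -> (forall f, S f -> measurable_wrt G f) ->
  exists f : nat -> U -> \bar R,
    (forall n, S (f n)) /\ is_fam_ess_sup P G S (seq_sup f).
Proof.
move=> [f0 Sf0] mS.
(* [contract] maps the extended reals increasingly into [-1, 1]; adding 1 gives nonnegative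
   functions bounded by 2. *)
pose c (g : U -> \bar R) x := (contract (g x) + 1)%:E.
have c0 g x : 0 <= c g x.
  rewrite /c lee_fin -lerBlDr sub0r.
  by have := contract_le1 (g x); rewrite ler_norml => /andP[].
have c2 g x : c g x <= 2%:E.
  rewrite /c lee_fin.
  have : (contract (g x) <= 1)%R by have := contract_le1 (g x); rewrite ler_norml => /andP[].
  lra.
have mc g : measurable_fun setT g -> measurable_fun setT (c g).
  move=> mg; apply/measurable_EFinP; apply: measurable_funD => //.
  by apply: measurableT_comp => //; exact: measurable_contract.
have cle g h x : g x <= h x -> c g x <= c h x.
  by move=> gh; rewrite /c lee_fin lerD2r le_contract.
pose J f := \int[P]_x c (seq_sup f) x.
have msup f : (forall n, S (f n)) -> measurable_fun setT (seq_sup f).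
  move=> Sf; apply: (measurable_wrt_fun sG GM); apply: measurable_seq_sup => n.
  exact: mS.
have J2 f : (forall n, S (f n)) -> J f <= 2%:E.
  move=> Sf; apply: (@le_trans _ _ (\int[P]_x 2%:E)).
    by apply: ge0_le_integral => //; exact/mc/msup.
  by rewrite integral_cst// -[leRHS]mule1 lee_wpmul2l// probability_le1.
pose JS := [set J f | f in [set f | forall n, S (f n)]].
pose M := ereal_sup JS.
have Mfin : M \is a fin_num.
  rewrite ge0_fin_numE; last first.
    apply: le_trans (ereal_sup_ubound (_ : JS (J (fun=> f0)))) => //.
      by apply: integral_ge0.
    by exists (fun=> f0).
  apply: (@le_lt_trans _ _ 2%:E); last exact: ltry.
  by apply: ge_ereal_sup => _ [f Sf <-]; exact: J2.
have /choice[F FP] k : exists f : nat -> U -> \bar R,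
    (forall n, S (f n)) /\ M - (k.+1%:R^-1)%:E < J f.
  have : M - (k.+1%:R^-1)%:E < M by rewrite lteBlDr// lteDl// lte_fin.
  by move=> /ereal_sup_gt [_ [f Sf <-]] Jf; exists f.
(* One sequence that runs through the members of all the nearly optimal sequences [F k], so that its
   supremum dominates theirs. *)
pose f n := let: (k, m) := odflt (0%N, 0%N) (unpickle n) in F k m.
have Sf n : S (f n).
  by rewrite /f; case: (odflt _ _) => k m; have [+ _] := FP k; exact.
have Ff k x : seq_sup (F k) x <= seq_sup f x.
  apply: ge_ereal_sup => _ [m _ <-].
  by apply: ereal_sup_ubound; exists (pickle (k, m)) => //; rewrite /f pickleK.
have Jf : J f = M.
  apply/le_anti/andP; split; first by apply: ereal_sup_ubound; exists f.
  apply/lee_addgt0Pr => e e0.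
  have [k _ ke] : exists2 k, True & (k.+1%:R^-1 < e)%R.
    have [k ke] := ltr_add_invr (y := 0%R) e0.
    by exists k => //; rewrite add0r in ke.
  have [SF MF] := FP k.
  rewrite -leeBlDr//; apply: (@le_trans _ _ (M - (k.+1%:R^-1)%:E)).
    by apply: leeB => //; rewrite lee_fin ltW.
  rewrite (le_trans (ltW MF))//.
  by apply: ge0_le_integral => //; try exact/mc/msup; move=> x _; exact: cle.
exists f; split=> //; split.
- by apply: measurable_seq_sup => n; exact: mS.
- move=> g Sg.
  (* Adjoining [g] cannot raise an integral that is already maximal; as [contract] is injective, the
     two suprema agree a.e., and [g] lies below the old one. *)
  pose f' n := if n is m.+1 then f m else g.
  have Sf' n : S (f' n) by case: n.
  have ff' x : seq_sup f x <= seq_sup f' x.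
    by apply: ge_ereal_sup => _ [n _ <-]; exact: (le_seq_sup f' n.+1).
  have Jf' : J f' = M.
    apply/le_anti/andP; split; first by apply: ereal_sup_ubound; exists f'.
    rewrite -Jf.
    by apply: ge0_le_integral => //; try exact/mc/msup; move=> x _; exact: cle.
  have ci h : (forall n, S (h n)) -> P.-integrable setT (c (seq_sup h)).
    move=> Sh; apply/integrableP; split; first exact/mc/msup.
    under eq_integral do rewrite gee0_abs//.
    by rewrite (le_lt_trans (J2 _ Sh))// ltry.
  have : \int[P]_x `|(c (seq_sup f') \- c (seq_sup f)) x| = 0.
    under eq_integral => x _ do rewrite gee0_abs ?suber_ge0 ?cle//.
    rewrite integralB//; try exact: ci.
    by rewrite -/(J f) -/(J f') Jf Jf' subee.
  move/(ae_eq_integral_abs _ measurableT).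
  move=> /(_ (emeasurable_funB (mc _ (msup _ Sf')) (mc _ (msup _ Sf)))) H.
  apply: filterS H => x /(_ I) [] /eqP; rewrite subr_eq0 => /eqP.
  move=> /addIr /(can_inj (@contractK R)) E.
  by rewrite -E; exact: (le_seq_sup f' 0%N).
- move=> h mh hP.
  have : \forall x \ae P, forall n, f n x <= h x.
    by apply/ae_foralln => n; exact: hP.
  by apply: filterS => x H; apply: ge_ereal_sup => _ [n _ <-].
Qed.

Lemma fam_ess_supP S : S !=set0 -> (forall f, S f -> measurable_wrt G f) ->
  is_fam_ess_sup P G S (fam_ess_sup P G S).
Proof.
move=> S0 mS; apply: xgetPex.
by have [f [_ ?]] := exists_fam_ess_sup S0 mS; exists (seq_sup f).
Qed.

Lemma is_fam_ess_sup_unique S g h :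
  is_fam_ess_sup P G S g -> is_fam_ess_sup P G S h ->
  \forall x \ae P, g x = h x.
Proof.
move=> [mg g1 g2] [mh h1 h2].
by apply: filterS2 (g2 _ mh h1) (h2 _ mg g1) => x ? ?; apply/le_anti/andP; split.
Qed.

Lemma fam_ess_sup_eq S g : is_fam_ess_sup P G S g ->
  \forall x \ae P, g x = fam_ess_sup P G S x.
Proof.
move=> Sg; apply: (is_fam_ess_sup_unique Sg).
exact: (@xgetI _ _ [set g | is_fam_ess_sup P G S g] g Sg).
Qed.

(** Upper bounds are tested on one member at a time, so each member may be changed on a null set of
    its own even if the family is uncountable. *)
Lemma is_fam_ess_sup_ae_eq S S' g :
  (forall f, S f -> exists2 f', S' f' & \forall x \ae P, f x = f' x) ->
  (forall f', S' f' -> exists2 f, S f & \forall x \ae P, f x = f' x) ->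
  is_fam_ess_sup P G S g -> is_fam_ess_sup P G S' g.
Proof.
move=> SS' S'S [mg g1 g2]; split => //.
- move=> f' /S'S[f Sf ff']; apply: filterS2 ff' (g1 _ Sf) => x -> //.
- move=> h mh hP; apply: g2 => // f /SS'[f' S'f' ff'].
  by apply: filterS2 ff' (hP _ S'f') => x -> //.
Qed.

End essential_supremum.

End cexp_theory.

(** * Hahn-Banach and Riesz representation *)

Section hahn_banach.
Context {R : realType} {V : lmodType R}.
Variables (L : set V) (p : V -> R).
Hypothesis L0 : L 0.
Hypothesis LDZ : forall (a : R) v w, L v -> L w -> L (a *: v + w).
Hypothesis p0 : 0 <= p 0.
Hypothesis p_convex : forall v w (l : R), L v -> L w -> 0 <= l <= 1 ->
  p (l *: v + (1 - l) *: w) <= l * p v + (1 - l) * p w.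

(** Single-valuedness is a consequence of domination: two values over one vector would put the whole
    line over 0 in the graph, against the bound [p 0]. *)
Let dominated_graph : set (set (V * R)) := [set A |
  (forall v r w s a, A (v, r) -> A (w, s) -> A (a *: v + w, a * r + s)) /\
  (forall v r, A (v, r) -> L v /\ r <= p v)].

Let bigcup_dominated_graph (C : set (set (V * R))) :
  C `<=` dominated_graph -> total_on C subset ->
  dominated_graph (\bigcup_(X in C) X).
Proof.
move=> CD Ctot; split=> [v r w s a [X CX Xv] [Y CY Yw]|v r [X CX Xv]].
- have [XY|YX] := Ctot _ _ CX CY.
  + by exists Y => //; apply: (CD _ CY).1 => //; exact: XY.
  + by exists X => //; apply: (CD _ CX).1 => //; exact: YX.
- exact: (CD _ CX).2 Xv.
Qed.

Section one_step.
Variables (A : set (V * R)) (v0 : V).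
Hypotheses (DA : dominated_graph A) (A00 : A (0, 0)) (Lv0 : L v0).

Let graphZ v r a : A (v, r) -> A (a *: v, a * r).
Proof. by move=> Av; have := DA.1 _ _ _ _ a Av A00; rewrite !addr0. Qed.

(** The constraints from below on the value at [v0], coming from domination at the vectors v - s v0
    with s > 0. *)
Let lower_bounds : set R :=
  [set y | exists v r s, [/\ A (v, r), 0 < s & y = (r - p (v - s *: v0)) / s]].

(** The convex combination of v - s v0 and w + t v0 with weights t/(s+t) and s/(s+t) is free of
    [v0], so that the domination known on A applies to it. *)
Let slope_le v r s w q t : A (v, r) -> 0 < s -> A (w, q) -> 0 < t ->
  (r - p (v - s *: v0)) / s <= (p (w + t *: v0) - q) / t.
Proof.
move=> Av s0 Aw t0.
have st0 : 0 < s + t by exact: addr_gt0.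
have [Lv _] := DA.2 _ _ Av; have [Lw _] := DA.2 _ _ Aw.
pose l := t / (s + t).
have l1 : 1 - l = s / (s + t) by rewrite /l; field; exact: lt0r_neq0.
have l01 : 0 <= l <= 1.
  rewrite /l ler_pdivrMr// mul1r lerDr (ltW s0) andbT.
  by rewrite divr_ge0// ltW.
have Lvs : L (v - s *: v0) by rewrite addrC -scaleNr; exact: LDZ.
have Lwt : L (w + t *: v0) by rewrite addrC; exact: LDZ.
have := p_convex Lvs Lwt l01.
have -> : l *: (v - s *: v0) + (1 - l) *: (w + t *: v0) =
          l *: v + (1 - l) *: w.
  rewrite !scalerDr scalerN !scalerA addrACA.
  suff -> : (1 - l) * t = l * s by rewrite addNr addr0.
  by rewrite l1 /l; field; exact: lt0r_neq0.
have Avw : A (l *: v + (1 - l) *: w, l * r + (1 - l) * q).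
  by apply: DA.1 => //; exact: graphZ.
have [_ h1] := DA.2 _ _ Avw => h2.
have := le_trans h1 h2; rewrite l1 /l => h3.
rewrite ler_pdivrMr// mulrAC ler_pdivlMr//.
have e x y : t / (s + t) * x + s / (s + t) * y = (t * x + s * y) / (s + t).
  by field; exact: lt0r_neq0.
by move: h3; rewrite !e ler_pM2r ?invr_gt0// => h3; rewrite !mulrBl; lra.
Qed.

Let has_sup_lower_bounds : has_sup lower_bounds.
Proof.
split; first by exists ((0 - p (0 - 1 *: v0)) / 1), 0, 0, 1; split.
exists ((p (0 + 1 *: v0) - 0) / 1) => _ [v [r [s [Av s0 ->]]]].
exact: slope_le.
Qed.

Let c := sup lower_bounds.

Lemma extend_dominated_graph :
  exists B, [/\ dominated_graph B, A `<=` B & exists r, B (v0, r)].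
Proof.
exists [set x | exists v r t, A (v, r) /\ x = (v + t *: v0, r + t * c)].
split.
- split.
  + move=> _ _ _ _ a [v [r [t [Av [-> ->]]]]] [w [q [u [Aw [-> ->]]]]].
    exists (a *: v + w), (a * r + q), (a * t + u); split; first exact: DA.1.
    congr pair; last by ring.
    by rewrite !scalerDr scalerDl scalerA addrACA.
  + move=> _ _ [v [r [t [Av [-> ->]]]]].
    have [Lv rp] := DA.2 _ _ Av.
    split; first by rewrite addrC; exact: LDZ.
    have [t0|t0|->] := ltgtP t 0; last by rewrite scale0r mul0r !addr0.
    * have s0 : 0 < - t by rewrite oppr_gt0.
      have : (r - p (v - (- t) *: v0)) / (- t) <= c.
        apply: sup_upper_bound => //.
        by exists v, r, (- t); split.
      rewrite ler_pdivrMr// scaleNr opprK; lra.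
    * have : c <= (p (v + t *: v0) - r) / t.
        apply: ge_sup; first by case: has_sup_lower_bounds.
        by move=> _ [w [q [s [Aw s0 ->]]]]; exact: slope_le.
      by rewrite ler_pdivlMr//; lra.
- move=> [v r] Av; exists v, r, 0; split => //.
  by rewrite scale0r mul0r !addr0.
- exists (0 + 1 * c), 0, 0, 1; split => //.
  by rewrite scale1r !add0r.
Qed.

End one_step.

Theorem hahn_banach_convex : exists f : V -> R,
  (forall a v w, L v -> L w -> f (a *: v + w) = a * f v + f w) /\
  (forall v, L v -> f v <= p v).
Proof.
have [A [DA Amax]] := Zorn_bigcup bigcup_dominated_graph.
(* The empty graph is an admissible element, so the maximal one has to be shown nonempty; otherwise
   the graph {(0, 0)}, admissible because 0 <= p 0, would be larger. *)
have A00 : A (0, 0).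
  have [A0|/set0P[[v r] Avr]] := eqVneq A set0; last first.
    have := DA.1 _ _ _ _ (-1) Avr Avr.
    by rewrite scaleN1r mulN1r !addNr.
  exfalso; apply: (Amax [set (0, 0)]).
    by rewrite A0; split => [//|/(_ (0, 0) erefl)].
  split=> [v r w s a [-> ->] [-> ->]|v r [-> ->]].
    by rewrite scaler0 mulr0 !addr0.
  by split.
have Afun v r s : A (v, r) -> A (v, s) -> r = s.
  move=> Ar As.
  have Ars : A (0, r - s).
    have := DA.1 _ _ _ _ (-1) As Ar.
    by rewrite scaleN1r mulN1r addNr addrC.
  have H a : a * (r - s) <= p 0.
    have := DA.1 _ _ _ _ a Ars A00.
    by rewrite scaler0 !addr0 => /DA.2[].
  apply/eqP; rewrite -subr_eq0; apply/negPn/negP => rs.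
  (* The scalar produces the value p 0 + 1 over the vector 0. *)
  have := H ((p 0 + 1) / (r - s)); rewrite divfK//.
  by rewrite leNgt ltrDl ltr01.
have Atot v : L v -> exists r, A (v, r).
  move=> Lv; apply: contrapT => Av.
  have [B [DB AB [r Bvr]]] := extend_dominated_graph DA A00 Lv.
  apply: (Amax B) => //; split => // BA.
  by apply: Av; exists r; exact: BA.
have /choice[f fP] v : exists r, L v -> A (v, r).
  have [Lv|nLv] := pselect (L v); last by exists 0.
  by have [r Avr] := Atot _ Lv; exists r.
exists f; split=> [a v w Lv Lw|v Lv].
  by apply: (Afun (a *: v + w)); [apply/fP/LDZ|apply: DA.1; exact: fP].
by have [] := DA.2 _ _ (fP _ Lv).
Qed.

End hahn_banach.

(** * The spaces L_p over a probability space, with a real-valued norm *)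

Section Lp_facts.
Context {d} {U : measurableType d} {R : realType}.
Variables (P : probability U R) (p : R) (p1 : 1 <= p).
Implicit Types X Y : U -> R.

Local Notation Lfun := (Lfun P p%:E).
Definition nrm X : R := fine ('N[P]_p%:E[EFin \o X])%E.

Let pe1 : (1 <= p%:E)%E. Proof. by rewrite lee_fin. Qed.
Let p_gt0 : 0 < p. Proof. exact: lt_le_trans p1. Qed.
Let p_neq0 : p != 0. Proof. by rewrite gt_eqF. Qed.

Lemma Lfun_measurable X : X \in Lfun -> measurable_fun setT X.
Proof. by move=> /andP[/[!inE]]. Qed.

Lemma nrmE X : X \in Lfun -> (nrm X)%:E = ('N[P]_p%:E[EFin \o X])%E.
Proof. by move=> LX; rewrite -(finite_norm_fine (Lfun_Sub pe1 LX)). Qed.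

Lemma nrm_ge0 X : 0 <= nrm X.
Proof. by rewrite fine_ge0// Lnorm_ge0. Qed.

Lemma LfunD X Y : X \in Lfun -> Y \in Lfun -> (fun x => X x + Y x) \in Lfun.
Proof. by move=> LX LY; exact: ((Lfun_addr_closed P pe1).2 X Y LX LY). Qed.

Lemma LfunZ (a : R) X : X \in Lfun -> (fun x => a * X x) \in Lfun.
Proof.
move=> LX; have [L0 H] := Lfun_submod_closed P pe1.
rewrite (_ : (fun x => _) = a *: X + 0); first exact: H.
by apply/funext => x /=; rewrite addr0.
Qed.

Lemma LfunN X : X \in Lfun -> (fun x => - X x) \in Lfun.
Proof.
move=> /(LfunZ (-1)) LX; rewrite (_ : (fun x => _) = fun x => -1 * X x)//.
by apply/funext => x; rewrite mulN1r.
Qed.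

Lemma LfunB X Y : X \in Lfun -> Y \in Lfun -> (fun x => X x - Y x) \in Lfun.
Proof. by move=> LX LY; apply: LfunD => //; exact: LfunN. Qed.

Lemma nrmD X Y : X \in Lfun -> Y \in Lfun ->
  nrm (fun x => X x + Y x) <= nrm X + nrm Y.
Proof. by move=> LX LY; exact: (ler_LnormD (Lfun_Sub pe1 LX) (Lfun_Sub pe1 LY)). Qed.

Lemma nrmZ (a : R) X : X \in Lfun -> nrm (fun x => a * X x) = `|a| * nrm X.
Proof.
move=> LX; apply: EFin_inj; rewrite EFinM (nrmE LX).
by rewrite -(LnormZ (Lfun_Sub pe1 LX)) nrmE ?LfunZ.
Qed.

Lemma nrm_powR X : X \in Lfun -> ((nrm X) `^ p)%:E = (\int[P]_x (`|X x| `^ p)%:E)%E.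
Proof.
move=> LX; rewrite -poweR_EFin nrmE// poweR_Lnorm//.
Qed.

Lemma Lfun_le X Y : measurable_fun setT X -> Y \in Lfun ->
  (\forall x \ae P, `|X x| <= `|Y x|) -> X \in Lfun /\ nrm X <= nrm Y.
Proof.
move=> mX LY XY.
have mY := Lfun_measurable LY.
have mpow (Z : U -> R) : measurable_fun setT Z ->
    measurable_fun setT (fun x => (`|Z x| `^ p)%:E).
  move=> mZ; apply/measurable_EFinP.
  apply: (measurableT_comp (measurable_powR _)); exact: measurableT_comp.
have h : (\int[P]_x (`|X x| `^ p)%:E <= \int[P]_x (`|Y x| `^ p)%:E)%E.
  apply: ae_ge0_le_integral => //.
  - exact: mpow.
  - exact: mpow.
  - apply: filterS XY => x XYx _; rewrite lee_fin.
    by rewrite ge0_ler_powR// ?ltW// nnegrE.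
have LX : X \in Lfun.
  rewrite inE; apply/andP; split; rewrite inE//=.
  apply: (@lty_poweRy _ _ p) => //.
  by rewrite poweR_Lnorm//= (le_lt_trans h)// -nrm_powR// ltry.
split => //.
move: h; rewrite -!nrm_powR// lee_fin => h.
have := @ge0_ler_powR _ p^-1 _ _ _ _ _ h.
rewrite -!powRrM mulfV// !powRr1 ?nrm_ge0//; apply.
- by rewrite invr_ge0 ltW.
- by rewrite nnegrE powR_ge0.
- by rewrite nnegrE powR_ge0.
Qed.

Lemma Lfun_bounded X c : measurable_fun setT X -> (forall x, `|X x| <= c) ->
  X \in Lfun.
Proof.
move=> mX Xc; have [] := @Lfun_le X (cst c) mX (Lfun_cst P c p); last by [].
by apply: aeW => x; rewrite (le_trans (Xc x))//= ler_norm.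
Qed.

Lemma Lfun_abs X : X \in Lfun -> (fun x => `|X x|) \in Lfun.
Proof.
move=> LX; have [] // := @Lfun_le (fun x => `|X x|) X _ LX.
- by apply: measurableT_comp => //; exact: Lfun_measurable.
- by apply: aeW => x; rewrite normr_id.
Qed.

Lemma nrm_cst (c : R) : nrm (cst c) = `|c|.
Proof.
rewrite /nrm unlock /Lnorm /=.
have -> : (\int[P]_x (`|c| `^ p)%:E = (`|c| `^ p)%:E)%E.
  by rewrite -[RHS]mule1 -(@probability_setT _ _ _ P) integral_cst.
by rewrite poweR_EFin -powRrM mulfV// powRr1.
Qed.

Lemma Lfun_int X : X \in Lfun -> P.-integrable setT (EFin \o X).
Proof.
move=> LX; apply/Lfun1_integrable.
by apply: (Lfun_subset _ pe1 _ pe1 LX) => //; exact: fin_num_measure.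
Qed.

(** Dominated convergence for the p-th powers, with bound |Y|^p; monotonicity of the power gives
    back the norm. *)
Lemma nrm_dominated_cvg (X : nat -> U -> R) (Y : U -> R) :
  (forall n, measurable_fun setT (X n)) -> Y \in Lfun ->
  (forall n x, `|X n x| <= `|Y x|) ->
  (forall x, X n x @[n --> \oo] --> 0) ->
  forall e, 0 < e -> \forall n \near \oo, nrm (X n) < e.
Proof.
move=> mX LY XY X0 e e0.
have LX n : X n \in Lfun.
  by have [] // := Lfun_le (mX n) LY; exact: aeW.
have mpow (Z : U -> R) : measurable_fun setT Z ->
    measurable_fun setT (fun x => (`|Z x| `^ p)%:E).
  move=> mZ; apply/measurable_EFinP.
  apply: (measurableT_comp (measurable_powR _)); exact: measurableT_comp.
have [] := @dominated_convergence _ _ _ P setT measurableT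
  (fun n x => (`|X n x| `^ p)%:E) (cst 0%E) (fun x => (`|Y x| `^ p)%:E).
- by move=> n; exact: mpow.
- exact: measurable_cst.
- apply: aeW => x _; apply/fine_cvgP; split; first exact: nearW.
  apply/cvgrPdist_lt => /= a a0.
  have a1 : 0 < a `^ p^-1 by exact: powR_gt0.
  have /cvgrPdist_lt/(_ _ a1) := X0 x.
  apply: filterS => n /=; rewrite !sub0r !normrN => Xa.
  rewrite ger0_norm ?powR_ge0//.
  have -> : a = (a `^ p^-1) `^ p by rewrite -powRrM mulVf// powRr1// ltW.
  by rewrite gt0_ltr_powR// nnegrE// ltW.
- by apply: Lfun_integrable.
- apply: aeW => x n _; rewrite gee0_abs ?lee_fin ?powR_ge0//.
  by rewrite ge0_ler_powR// ?ltW// nnegrE.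
move=> _ _; rewrite integral0 => /fine_cvgP[_ /cvgrPdist_lt].
have ep : 0 < e `^ p by exact: powR_gt0.
move=> /(_ _ ep); apply: filterS => n /=.
rewrite sub0r normrN -nrm_powR//= ger0_norm ?powR_ge0// => h.
rewrite ltNge; apply/negP => en; move: h; rewrite ltNge => /negP; apply.
by rewrite ge0_ler_powR// ?nnegrE ?nrm_ge0// ltW.
Qed.

End Lp_facts.

Section measurable_wrt_closure.
Context {d} {U : measurableType d} {R : realType} (G : set (set U)).
Implicit Types f g : U -> R.

Lemma mw_cst (c : R) : measurable_wrt G (cst c : U -> R).
Proof. exact: (@measurable_cst _ _ (g_sigma_algebraType G)). Qed.

Lemma mwD f g : measurable_wrt G f -> measurable_wrt G g ->
  measurable_wrt G (fun x => f x + g x).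
Proof. exact: (@measurable_funD _ (g_sigma_algebraType G)). Qed.

Lemma mwN f : measurable_wrt G f -> measurable_wrt G (fun x => - f x).
Proof. exact: (@measurable_funN _ (g_sigma_algebraType G)). Qed.

Lemma mwB f g : measurable_wrt G f -> measurable_wrt G g ->
  measurable_wrt G (fun x => f x - g x).
Proof. exact: (@measurable_funB _ (g_sigma_algebraType G)). Qed.

Lemma mwM f g : measurable_wrt G f -> measurable_wrt G g ->
  measurable_wrt G (fun x => f x * g x).
Proof. exact: (@measurable_funM _ (g_sigma_algebraType G)). Qed.

Lemma mwZ (a : R) f : measurable_wrt G f -> measurable_wrt G (fun x => a * f x).
Proof. by move=> mf; apply: mwM => //; exact: mw_cst. Qed.

Lemma mw_max f g : measurable_wrt G f -> measurable_wrt G g ->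
  measurable_wrt G (fun x => Num.max (f x) (g x)).
Proof. exact: (@measurable_maxr _ (g_sigma_algebraType G)). Qed.

Lemma mw_min f g : measurable_wrt G f -> measurable_wrt G g ->
  measurable_wrt G (fun x => Num.min (f x) (g x)).
Proof. exact: (@measurable_minr _ (g_sigma_algebraType G)). Qed.

Lemma mw_abs f : measurable_wrt G f -> measurable_wrt G (fun x => `|f x|).
Proof.
by move=> mf; apply: (@measurableT_comp _ _ _ (g_sigma_algebraType G)).
Qed.

Lemma mw_comp (phi : R -> R) f : measurable_fun setT phi -> measurable_wrt G f ->
  measurable_wrt G (fun x => phi (f x)).
Proof. by move=> mphi mf; apply: (@measurableT_comp _ _ _ (g_sigma_algebraType G)). Qed.

(** With the convention 0^-1 = 0 the point 0 is split off; on its open complement the inverse is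
    continuous. *)
Lemma mw_inv f : measurable_wrt G f -> measurable_wrt G (fun x => (f x)^-1).
Proof.
apply: mw_comp.
rewrite (_ : @GRing.inv R = fun x => if x == 0 then 0 else x^-1); last first.
  by apply/funext => x; case: eqVneq => // ->; rewrite invr0.
rewrite -(setUv [set 0 : R]); apply/measurable_funU => //; first exact: measurableC.
split; first exact: measurable_fun_set1.
apply: (@eq_measurable_fun _ _ _ _ _ (@GRing.inv R)).
  by move=> x; rewrite inE /= => /eqP/negPf ->.
apply: open_continuous_measurable_fun; first exact/closed_openC/closed_eq.
by move=> x; rewrite inE => /eqP x0; exact: inv_continuous.
Qed.

Lemma mw_EFin f : measurable_wrt G f <-> measurable_wrt G (EFin \o f).
Proof.
by split => mf; apply/(@measurable_EFinP _ (g_sigma_algebraType G)).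
Qed.

Lemma mw_fine (f : U -> \bar R) : measurable_wrt G f -> measurable_wrt G (fine \o f).
Proof.
by move=> mf; apply: (measurableT_comp (@fine_measurable _ _ _)).
Qed.

Lemma mw_sub d' (V : sigmaRingType d') (H : set (set U)) (f : U -> V) :
  G `<=` H -> measurable_wrt G f -> measurable_wrt H f.
Proof.
move=> GH mf _ B mB; have := mf measurableT B mB.
exact: sub_sigma_algebra2.
Qed.

Lemma mw_ler f g : sigma_algebra setT G -> measurable_wrt G f -> measurable_wrt G g ->
  G [set x | f x <= g x].
Proof.
move=> sG mf mg; rewrite -(measurable_gE sG) -[X in measurable X]setTI.
have := @measurable_fun_ler _ (g_sigma_algebraType G) _ setT f g mf mg.
by move=> /(_ measurableT [set true]); apply.
Qed.

Lemma mw_ltr f g : sigma_algebra setT G -> measurable_wrt G f -> measurable_wrt G g ->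
  G [set x | f x < g x].
Proof.
move=> sG mf mg; rewrite -(measurable_gE sG) -[X in measurable X]setTI.
have := @measurable_fun_ltr _ (g_sigma_algebraType G) _ setT f g mf mg.
by move=> /(_ measurableT [set true]); apply.
Qed.

End measurable_wrt_closure.

Section LpG.
Context {d} {U : measurableType d} {R : realType}.
Variables (P : probability U R) (p : R) (p1 : 1 <= p).
Variables (G : set (set U)) (sG : sigma_algebra setT G) (GM : G `<=` measurable).
Implicit Types X Y : U -> R.

Definition LpG : set (U -> R) := [set X | measurable_wrt G X /\ X \in Lfun P p%:E].

Lemma LpG_cst (c : R) : LpG (cst c).
Proof. by split; [exact: mw_cst|exact: Lfun_cst]. Qed.

Lemma LpGD X Y : LpG X -> LpG Y -> LpG (fun x => X x + Y x).
Proof. by move=> [mX LX] [mY LY]; split; [exact: mwD|exact: LfunD]. Qed.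

Lemma LpGN X : LpG X -> LpG (fun x => - X x).
Proof. by move=> [mX LX]; split; [exact: mwN|exact: LfunN]. Qed.

Lemma LpGB X Y : LpG X -> LpG Y -> LpG (fun x => X x - Y x).
Proof. by move=> [mX LX] [mY LY]; split; [exact: mwB|exact: LfunB]. Qed.

Lemma LpGZ (a : R) X : LpG X -> LpG (fun x => a * X x).
Proof. by move=> [mX LX]; split; [exact: mwZ|exact: LfunZ]. Qed.

Lemma LpG_le X Y : measurable_wrt G X -> Y \in Lfun P p%:E ->
  (\forall x \ae P, `|X x| <= `|Y x|) -> LpG X /\ nrm P p X <= nrm P p Y.
Proof.
move=> mX LY XY; have [] := Lfun_le p1 (measurable_wrt_fun sG GM mX) LY XY.
by [].
Qed.

Lemma LpG_bounded X c : measurable_wrt G X -> (forall x, `|X x| <= c) -> LpG X.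
Proof.
by move=> mX Xc; split => //; exact: (@Lfun_bounded _ _ _ P p p1 X c (measurable_wrt_fun sG GM mX) Xc).
Qed.

Lemma LpG_abs X : LpG X -> LpG (fun x => `|X x|).
Proof. by move=> [mX LX]; split; [exact: mw_abs|exact: Lfun_abs]. Qed.

Lemma LpG_max X Y : LpG X -> LpG Y -> LpG (fun x => Num.max (X x) (Y x)).
Proof.
move=> [mX LX] [mY LY].
have [] // := @LpG_le (fun x => Num.max (X x) (Y x)) (fun x => `|X x| + `|Y x|).
- exact: mw_max.
- by apply: LfunD => //; exact: Lfun_abs.
- apply: aeW => x; rewrite [leRHS]ger0_norm ?addr_ge0//.
  by rewrite /Num.max; case: ifP => _; rewrite ?lerDl ?lerDr.
Qed.

Lemma LpG_min X Y : LpG X -> LpG Y -> LpG (fun x => Num.min (X x) (Y x)).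
Proof.
move=> LX LY; rewrite (_ : (fun x => _) = fun x => - Num.max (- X x) (- Y x)).
  by apply/LpGN/LpG_max; exact: LpGN.
by apply/funext => x; rewrite oppr_max !opprK.
Qed.

Lemma LpG_indicator A : G A -> LpG (\1_A).
Proof.
move=> GA; apply: (@LpG_bounded \1_A 1); first exact: measurable_wrt_indic.
by move=> x; rewrite indicE; case: (_ \in _); rewrite ?normr1 ?normr0.
Qed.

Lemma LpG_indic A X : G A -> LpG X -> LpG (fun x => \1_A x * X x).
Proof.
move=> GA [mX LX].
have [] // := @LpG_le (fun x => \1_A x * X x) X.
- by apply: mwM => //; exact: measurable_wrt_indic.
- apply: aeW => x; rewrite normrM ler_piMl// indicE.
  by case: (_ \in _); rewrite ?normr1 ?normr0.
Qed.

End LpG.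

(** * Riesz representation of positive bounded functionals on L_p *)

Section riesz.
Context {d} {U : measurableType d} {R : realType}.
Variables (P : probability U R) (p : R) (p1 : 1 <= p).
Variables (G : set (set U)) (sG : sigma_algebra setT G) (GM : G `<=` measurable).
Variables (f : (U -> R) -> R) (K : R).
Local Notation LG := (LpG P p G).
Hypothesis f_lin : forall a X Y, LG X -> LG Y -> f (fun x => a * X x + Y x) = a * f X + f Y.
Hypothesis f_ge0 : forall X, LG X -> (forall x, 0 <= X x) -> 0 <= f X.
Hypothesis f_le : forall X, LG X -> f X <= K * nrm P p X.

Let f0 : f (cst 0) = 0.
Proof.
have L0 := LpG_cst P p G 0.
have := f_lin (-1) L0 L0; rewrite (_ : (fun x => _) = cst 0); first lra.
by apply/funext => x /=; rewrite mulr0 addr0.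
Qed.

Let fB X Y : LG X -> LG Y -> f (fun x => X x - Y x) = f X - f Y.
Proof.
move=> LX LY; rewrite (_ : (fun x => _) = fun x => -1 * Y x + X x).
  by rewrite f_lin//; lra.
by apply/funext => x; rewrite mulN1r addrC.
Qed.

Let Lindic A : G A -> LG (\1_A).
Proof.
by move=> GA; exact: LpG_indicator.
Qed.

(** The maximum with 0 makes the set function nonnegative on every set, whereas [f] is known to be
    positive only on L_p(G). *)
Let m (A : set U) : \bar R := (Num.max (f \1_A) 0)%:E.

Let mE A : G A -> m A = (f \1_A)%:E.
Proof.
by move=> GA; rewrite /m max_l// f_ge0//; exact: Lindic.
Qed.

Let indic_sum (F : (set U)^nat) n : (forall i, G (F i)) ->
  LG (fun x => \sum_(0 <= i < n) \1_(F i) x) /\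
  f (fun x => \sum_(0 <= i < n) \1_(F i) x) = \sum_(0 <= i < n) f \1_(F i).
Proof.
move=> GF; elim: n => [|n [L IH]].
  rewrite (_ : (fun x => _) = cst 0) ?big_geq//.
    by split; [exact: LpG_cst|exact: f0].
  by apply/funext => x; rewrite big_geq.
rewrite (_ : (fun x => _) =
    fun x => 1 * \1_(F n) x + \sum_(0 <= i < n) \1_(F i) x); last first.
  by apply/funext => x; rewrite big_nat_recr//= mul1r addrC.
have LF := Lindic (GF n).
split; first by apply: LpGD => //; exact: LpGZ.
by rewrite (f_lin _ LF L) IH big_nat_recr//= mul1r addrC.
Qed.

Let m_sigma (F : (set U)^nat) : (forall i, G (F i)) -> trivIset setT F ->
  (fun n => \sum_(0 <= i < n) m (F i))%E @ \oo --> m (\bigcup_n F n).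
Proof.
move=> GF tF.
have GUF : G (\bigcup_n F n) by case: sG => _ _; exact.
rewrite (mE GUF).
have -> : (fun n => \sum_(0 <= i < n) m (F i))%E =
    (fun n => (\sum_(0 <= i < n) f \1_(F i))%:E).
  by apply/funext => n; rewrite -sumEFin; apply: eq_bigr => i _; rewrite mE.
apply/fine_cvgP; split; first exact: nearW.
apply/cvgrPdist_lt => e e0 /=.
(* The remainder of the series of indicators tends to 0 in L_p by dominated convergence; with [f_le]
   this is sigma-additivity. *)
pose X n x : R := \1_(\bigcup_n F n) x - \sum_(0 <= i < n) \1_(F i) x.
have LX n : LG (X n).
  by apply: LpGB => //; [exact: Lindic|have [] := indic_sum n GF].
have Xx x j n : F j x -> X n x = (n <= j)%N%:R.
  move=> Fjx; rewrite /X indicE mem_set; last by exists j.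
  have Fix i : \1_(F i) x = (i == j)%:R :> R.
    rewrite indicE; have [->|ij] := eqVneq i j; first by rewrite mem_set.
    rewrite memNset// => Fi.
    have := trivIsetP.1 tF i j I I ij.
    by move/seteqP => [/(_ x) + _]; apply.
  have -> : \sum_(0 <= i < n) \1_(F i) x = (j < n)%N%:R :> R.
    elim: n => [|n IH]; first by rewrite big_geq.
    rewrite big_nat_recr//= IH Fix ltnS.
    by case: (ltngtP j n) => //= _; rewrite ?addr0 ?add0r.
  by rewrite (leqNgt n j); case: (j < n)%N; rewrite /= ?subrr ?subr0.
have X0 x n : ~ (\bigcup_n F n) x -> X n x = 0.
  move=> nF; rewrite /X indicE memNset//= big1_seq ?subrr// => i _.
  by rewrite indicE memNset// => Fi; apply: nF; exists i.
have Xn : forall e, 0 < e -> \forall n \near \oo, nrm P p (X n) < e.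
  apply: (@nrm_dominated_cvg _ _ _ P p p1 X (cst 1)).
  - by move=> n; apply: (measurable_wrt_fun sG GM); have [] := LX n.
  - exact: Lfun_cst.
  - move=> n x; rewrite normr1.
    have [[j _ Fjx]|nF] := pselect ((\bigcup_n F n) x).
      by rewrite (Xx _ _ _ Fjx); case: (n <= j)%N; rewrite ?normr1 ?normr0.
    by rewrite X0// normr0.
  - move=> x; apply: cvg_near_cst.
    have [[j _ Fjx]|nF] := pselect ((\bigcup_n F n) x).
      by exists j.+1 => // n /= jn; rewrite (Xx _ _ _ Fjx) (leqNgt n j) jn.
    by apply: nearW => n; rewrite X0.
have K0 : 0 < `|K| + 1 by rewrite ltr_wpDl.
apply: filterS (Xn _ (divr_gt0 e0 K0)) => n.
rewrite ltr_pdivlMr// => Xne.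
have [L S] := indic_sum n GF.
rewrite -S -fB//; last exact: Lindic.
rewrite ger0_norm; last first.
  apply: f_ge0; [exact: LX|move=> x].
  have [[j _ Fjx]|nF] := pselect ((\bigcup_n F n) x).
    by rewrite -/(X n x) (Xx _ _ _ Fjx).
  by rewrite -/(X n x) X0.
apply: le_lt_trans (f_le (LX n)) _; apply: le_lt_trans Xne.
rewrite mulrC ler_wpM2l ?nrm_ge0// (le_trans (ler_norm _))//.
by rewrite lerDl.
Qed.

(** Integrability is carried along with the formula, so that the class is stable under linear
    combinations. *)
Let good Y zeta := [/\ LG Y, P.-integrable setT (fun x => (zeta x * Y x)%:E) &
  (f Y)%:E = (\int[P]_x (zeta x * Y x)%:E)%E].

Import HBNNSimple.

(** [zeta] is the density of the measure A -> f(1_A). The bound by the norm gives absolute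
    continuity, and carries the formula from simple functions to their increasing limits; the
    argument is the same for p = 1. *)
Theorem riesz_representation : exists zeta : U -> R,
  [/\ measurable_wrt G zeta, (forall x, 0 <= zeta x) &
   forall Y, LG Y -> P.-integrable setT (fun x => (zeta x * Y x)%:E) /\
     (f Y)%:E = (\int[P]_x (zeta x * Y x)%:E)%E].
Proof.
have [nu nuE] : exists nu : {measure set (g_sigma_algebraType G) -> \bar R},
    forall A, nu A = m A.
  apply: (exists_measure sG) => //.
  - rewrite /m (_ : \1_set0 = cst 0) ?f0 ?maxxx//.
    by apply/funext => x; rewrite indicE in_set0.
  - by move=> A; rewrite lee_fin le_max lexx orbT.
have GT : G setT by rewrite -(measurable_gE sG); exact: measurableT.
have nuT : (nu setT < +oo)%E by rewrite nuE ltry.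
have nuP A : G A -> P A = 0%E -> nu A = 0%E.
  move=> GA PA; rewrite nuE mE//; congr EFin; apply/le_anti/andP; split; last first.
    by apply: f_ge0 => //; exact: Lindic.
  apply: le_trans (f_le (Lindic GA)) _.
  have [] := @LpG_le _ _ _ P p p1 G sG GM (\1_A) (cst 0).
  - by have [] := Lindic GA.
  - exact: Lfun_cst.
  - exists A; split => //; first exact: GM.
    move=> x /= H; apply: contrapT => nAx; apply: H.
    by rewrite indicE memNset// !normr0.
  move=> _; rewrite nrm_cst// normr0 => n0.
  have -> : nrm P p \1_A = 0 by apply/le_anti; rewrite n0 nrm_ge0.
  by rewrite mulr0.
have [zeta [mzeta zeta0 zetaE]] := exists_density sG GM nuT nuP.
exists zeta; split => //.
have mzeta' := measurable_wrt_fun sG GM mzeta.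
have mLG Y : LG Y -> measurable_fun setT Y.
  by move=> [_ LY]; exact: Lfun_measurable LY.
have goodP a X Y : good X zeta -> good Y zeta -> good (fun x => a * X x + Y x) zeta.
  move=> [LX iX fX] [LY iY fY].
  have E : (fun x => (zeta x * (a * X x + Y x))%:E) =
     (fun x => a%:E * (zeta x * X x)%:E + (zeta x * Y x)%:E)%E.
    by apply/funext => x; rewrite -EFinM -EFinD; congr EFin; ring.
  split.
  - by apply: LpGD => //; exact: LpGZ.
  - by rewrite E; apply: integrableD => //; exact: integrableZl.
  - rewrite f_lin// EFinD EFinM fX fY E integralD//; last exact: integrableZl.
    by rewrite integralZl.
have good0 : good (cst 0) zeta.
  split; first exact: LpG_cst.
  - by under eq_fun do rewrite mulr0; exact: integrable0.
  - by under eq_integral do rewrite mulr0; rewrite integral0 f0.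
have good_indic A : G A -> good \1_A zeta.
  move=> GA.
  have E : (\int[P]_x (zeta x * \1_A x)%:E)%E = (f \1_A)%:E.
    rewrite -mE// -nuE zetaE// [RHS]integral_mkcond; apply: eq_integral => x _.
    by rewrite epatch_indic EFinM.
  split; first exact: Lindic.
  - apply/integrableP; split.
      apply/measurable_EFinP; apply: measurable_funM => //.
      by apply: mLG; exact: Lindic.
    under eq_integral do rewrite gee0_abs ?lee_fin ?mulr_ge0//.
    by rewrite E ltry.
  - by rewrite E.
have good_sum (s : seq R) (h : U -> R) : (forall r, G (h @^-1` [set r])) ->
    good (fun x => \sum_(r <- s) r * \1_(h @^-1` [set r]) x) zeta.
  move=> Gh; elim: s => [|r s IH].
    by under eq_fun do rewrite big_nil; exact: good0.
  under eq_fun do rewrite big_cons.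
  by apply: goodP => //; exact: good_indic.
have good_ge0 Y : LG Y -> (forall x, 0 <= Y x) -> good Y zeta.
  move=> LY Y0.
  have mT : measurable (setT : set (g_sigma_algebraType G)) by exact: measurableT.
  have mY : measurable_wrt G (EFin \o Y) by apply/mw_EFin; have [] := LY.
  have Y0' x : (0 <= (EFin \o Y) x)%E by rewrite lee_fin.
  pose h := nnsfun_approx mT mY.
  have nd x a b : (a <= b)%N -> h a x <= h b x.
    by move=> ab; have /lefP := nd_nnsfun_approx mT mY ab; exact.
  have h_ge0 n x : 0 <= h n x by exact: fun_ge0.
  have hY x : (h n x)%:E @[n --> \oo] --> (Y x)%:E by exact: cvg_nnsfun_approx.
  have h_le n x : h n x <= Y x.
    have /ereal_nondecreasing_cvgn c : nondecreasing_seq (fun n => (h n x)%:E).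
      by move=> a b ab; rewrite lee_fin; exact: nd.
    rewrite -lee_fin (cvg_unique _ (hY x) c)//.
    by apply: ereal_sup_ubound; exists n.
  have Gh n r : G (h n @^-1` [set r]).
    rewrite -(measurable_gE sG) -[X in measurable X]setTI.
    exact: measurable_funP.
  have goodh n : good (h n) zeta.
    rewrite (_ : (h n : U -> R) = fun x =>
        \sum_(r <- finmap.enum_fset (fset_set (range (h n)))) r * \1_(h n @^-1` [set r]) x).
      exact: good_sum.
    apply/funext => x; rewrite [LHS](fimfunE (h n) x).
    by rewrite fsbig_finite.
  have fcvg : (f (h n))%:E @[n --> \oo] --> (f Y)%:E.
    apply/fine_cvgP; split; first exact: nearW.
    apply/cvgrPdist_lt => e e0 /=.
    have K0 : 0 < `|K| + 1 by rewrite ltr_wpDl.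
    have Lh n : LG (h n) by have [] := goodh n.
    have Yh n : LG (fun x => Y x - h n x) by exact: LpGB.
    have := @nrm_dominated_cvg _ _ _ P p p1 (fun n x => Y x - h n x) Y.
    move=> /(_ (fun n => mLG _ (Yh n)) LY.2).
    have Hle n x : `|Y x - h n x| <= `|Y x|.
      rewrite ger0_norm ?subr_ge0// ger0_norm//.
      by rewrite lerBlDr lerDl.
    have Hcvg x : Y x - h n x @[n --> \oo] --> 0.
      rewrite -(subrr (Y x)); apply: cvgB; first exact: cvg_cst.
      by have /fine_cvgP[_] := hY x.
    move=> /(_ Hle Hcvg _ (divr_gt0 e0 K0)); apply: filterS => n.
    rewrite ltr_pdivlMr// => Xne.
    rewrite -fB// ger0_norm; last first.
      by apply: f_ge0 => // x; rewrite subr_ge0.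
    apply: le_lt_trans (f_le (Yh n)) _; apply: le_lt_trans Xne.
    rewrite mulrC ler_wpM2l ?nrm_ge0// (le_trans (ler_norm _))//.
    by rewrite lerDl.
  have icvg : (\int[P]_x (zeta x * h n x)%:E)%E @[n --> \oo] -->
      (\int[P]_x (zeta x * Y x)%:E)%E.
    have <- : (\int[P]_x limn (fun n => (zeta x * h n x)%:E) =
        \int[P]_x (zeta x * Y x)%:E)%E.
      apply: eq_integral => x _; apply/cvg_lim => //.
      under eq_fun do rewrite EFinM.
      by rewrite EFinM; apply: cvgeZl.
    apply: cvg_monotone_convergence => //.
    - move=> n; apply/measurable_EFinP; apply: measurable_funM => //.
      by apply: mLG; have [] := goodh n.
    - by move=> n x _; rewrite lee_fin mulr_ge0.
    - by move=> x _ a b ab; rewrite lee_fin ler_wpM2l// nd.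
  have E : (\int[P]_x (zeta x * Y x)%:E)%E = (f Y)%:E.
    have hE : (fun n => \int[P]_x (zeta x * h n x)%:E)%E = (fun n => (f (h n))%:E).
      by apply/funext => n; have [_ _ ->] := goodh n.
    by rewrite hE in icvg; exact: cvg_unique icvg fcvg.
  split => //.
  apply/integrableP; split.
    by apply/measurable_EFinP; apply: measurable_funM => //; exact: mLG.
  under eq_integral do rewrite gee0_abs ?lee_fin ?mulr_ge0//.
  by rewrite E ltry.
move=> Y LY.
suff [] : good Y zeta by [].
rewrite (_ : Y = fun x => -1 * Num.max (- Y x) 0 + Num.max (Y x) 0); last first.
  by apply/funext => x; rewrite mulN1r addrC /Num.max; case: ltP => h1; case: ltP => h2; lra.
have L0 := LpG_cst P p G 0.
apply: goodP; apply: good_ge0.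
- by apply: LpG_max => //; exact: LpGN.
- by move=> x; rewrite le_max lexx orbT.
- exact: LpG_max.
- by move=> x; rewrite le_max lexx orbT.
Qed.

End riesz.

(** * Conditional densities and their penalties *)

Section real_cexp.
Context {d} {U : measurableType d} {R : realType}.
Variables (P : probability U R).
Variables (G : set (set U)) (sG : sigma_algebra setT G) (GM : G `<=` measurable).
Implicit Types u v w : U -> R.

Local Notation N := (cexp_ge0 P G).
Local Notation integrableR v := (P.-integrable setT (EFin \o v)).

Definition pos_part v : U -> \bar R := fun x => (Num.max (v x) 0)%:E.
Definition neg_part v : U -> \bar R := fun x => (Num.max (- v x) 0)%:E.

Lemma pos_part_ge0 v x : (0 <= pos_part v x)%E.
Proof. by rewrite lee_fin le_max lexx orbT. Qed.

Lemma neg_part_ge0 v x : (0 <= neg_part v x)%E.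
Proof. by rewrite lee_fin le_max lexx orbT. Qed.

Lemma measurable_pos_part v : measurable_fun setT v -> measurable_fun setT (pos_part v).
Proof.
by move=> mv; apply/measurable_EFinP; apply: measurable_maxr => //; exact: measurable_cst.
Qed.

Lemma measurable_neg_part v : measurable_fun setT v -> measurable_fun setT (neg_part v).
Proof.
move=> mv; apply/measurable_EFinP; apply: measurable_maxr; last exact: measurable_cst.
exact: measurable_funN.
Qed.

Hint Resolve pos_part_ge0 neg_part_ge0 : core.

(** A real-valued version, for arguments that are integrable: the two parts are then finite a.e. and
    [fine] changes nothing. *)
Definition rcexp v : U -> R := fun x => fine (N (pos_part v) x) - fine (N (neg_part v) x).

Lemma pos_neg_partE v x : v x = fine (pos_part v x) - fine (neg_part v x).
Proof. by rewrite /= /Num.max; case: ltP => h1; case: ltP => h2; lra. Qed.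

Lemma integrable_measurable v : integrableR v -> measurable_fun setT v.
Proof. by move=> /measurable_int /measurable_EFinP. Qed.

Lemma integrable_pos_part v : integrableR v -> P.-integrable setT (pos_part v).
Proof.
move=> iv; apply: (le_integrable measurableT _ _ iv).
  exact/measurable_pos_part/integrable_measurable.
move=> x _; rewrite gee0_abs//= lee_fin /Num.max; case: ltP => // _.
exact: ler_norm.
Qed.

Lemma integrable_neg_part v : integrableR v -> P.-integrable setT (neg_part v).
Proof.
move=> iv; apply: (le_integrable measurableT _ _ iv).
  exact/measurable_neg_part/integrable_measurable.
move=> x _; rewrite gee0_abs//= lee_fin /Num.max; case: ltP => // _.
by rewrite -normrN ler_norm.
Qed.

Lemma integral_lty_integrable (f : U -> \bar R) : P.-integrable setT f ->
  (forall x, 0 <= f x)%E -> (\int[P]_x f x < +oo)%E.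
Proof.
move=> /integrableP[_ h] f0.
by under eq_integral do rewrite -(gee0_abs (f0 _)).
Qed.

Lemma integrable_cexp_ge0 (u : U -> \bar R) : P.-integrable setT u ->
  (forall x, 0 <= u x)%E -> P.-integrable setT (N u).
Proof.
move=> iu u0; have mu := measurable_int _ iu.
apply/integrableP; split.
  by apply: (measurable_wrt_fun sG GM); exact: measurable_cexp_ge0.
under eq_integral do rewrite gee0_abs ?cexp_ge0_ge0//.
have GT : G setT by rewrite -(measurable_gE sG); exact: measurableT.
have [_ _ E] := cexp_ge0P P sG GM mu u0.
by rewrite (E _ GT); exact: integral_lty_integrable.
Qed.

Lemma cexp_ge0_fin_num (u : U -> \bar R) : P.-integrable setT u ->
  (forall x, 0 <= u x)%E -> \forall x \ae P, N u x \is a fin_num.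
Proof.
move=> iu u0; have := integrable_ae measurableT (integrable_cexp_ge0 iu u0).
by apply: filterS => x; exact.
Qed.

Lemma measurable_rcexp v : measurable_wrt G (rcexp v).
Proof. by apply: mwB; apply: mw_fine; exact: measurable_cexp_ge0. Qed.

Lemma rcexpE v : integrableR v ->
  \forall x \ae P, (rcexp v x)%:E = (N (pos_part v) x - N (neg_part v) x)%E.
Proof.
move=> iv.
have h1 := cexp_ge0_fin_num (integrable_pos_part iv) (pos_part_ge0 v).
have h2 := cexp_ge0_fin_num (integrable_neg_part iv) (neg_part_ge0 v).
by apply: filterS2 h1 h2 => x f1 f2; rewrite /rcexp EFinB !fineK.
Qed.

Lemma integrable_ae_eq (f g : U -> \bar R) : P.-integrable setT f ->
  measurable_fun setT g -> (\forall x \ae P, f x = g x) -> P.-integrable setT g.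
Proof.
move=> intf mg fg; apply/integrableP; split => //.
rewrite -(@ae_eq_integral _ _ _ P setT (fun x => `|g x|)%E (fun x => `|f x|)%E)//.
- by case/integrableP : intf.
- by apply: measurableT_comp => //; exact: measurable_int intf.
- exact: measurableT_comp.
- by apply: filterS fg => x -> _.
Qed.

Lemma integrable_rcexp v : integrableR v -> integrableR (rcexp v).
Proof.
move=> iv.
apply: (@integrable_ae_eq (fun x => N (pos_part v) x - N (neg_part v) x)%E).
- by apply: integrableB => //; apply: integrable_cexp_ge0 => //;
    [exact: integrable_pos_part|exact: integrable_neg_part].
- by apply/measurable_EFinP; apply: (measurable_wrt_fun sG GM); exact: measurable_rcexp.
- by apply: filterS (rcexpE iv) => x /= ->.
Qed.

Lemma integral_rcexp v A : integrableR v -> G A ->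
  (\int[P]_(x in A) (rcexp v x)%:E = \int[P]_(x in A) (v x)%:E)%E.
Proof.
move=> iv GA; have mA := GM GA.
have mv := integrable_measurable iv.
have ip := integrable_pos_part iv; have ineg := integrable_neg_part iv.
rewrite (@ae_eq_integral _ _ _ P A
    (fun x => N (pos_part v) x - N (neg_part v) x)%E)//; first last.
- by apply: filterS (rcexpE iv) => x -> _.
- by apply: measurable_funTS; apply: emeasurable_funB;
   apply: (measurable_wrt_fun sG GM); exact: measurable_cexp_ge0.
- by apply/measurable_EFinP; apply: measurable_funTS; apply: (measurable_wrt_fun sG GM);
    exact: measurable_rcexp.
rewrite integralB//; last 2 first.
- by apply: integrableS (integrable_cexp_ge0 ip (pos_part_ge0 v)).
- by apply: integrableS (integrable_cexp_ge0 ineg (neg_part_ge0 v)).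
have [_ _ ->//] := cexp_ge0P P sG GM (measurable_pos_part mv) (pos_part_ge0 v).
have [_ _ ->//] := cexp_ge0P P sG GM (measurable_neg_part mv) (neg_part_ge0 v).
rewrite -integralB//; [|exact: integrableS ip|exact: integrableS ineg].
by apply: eq_integral => x _; rewrite [in RHS](pos_neg_partE v x).
Qed.

(** The event v < u lies in G, and the positive function u - v has integral at most 0 over it. *)
Lemma mw_ae_le u v : measurable_wrt G u -> measurable_wrt G v ->
  integrableR u -> integrableR v ->
  (forall A, G A -> (\int[P]_(x in A) (u x)%:E <= \int[P]_(x in A) (v x)%:E)%E) ->
  \forall x \ae P, u x <= v x.
Proof.
move=> mu mv iu iv uv.
pose A := [set x | v x < u x].
have GA : G A by exact: mw_ltr.
have mA := GM GA.
have iuA : P.-integrable A (EFin \o u) by exact: integrableS iu.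
have ivA : P.-integrable A (EFin \o v) by exact: integrableS iv.
have : (\int[P]_(x in A) `|((EFin \o u) \- (EFin \o v)) x| = 0)%E.
  rewrite (eq_integral ((EFin \o u) \- (EFin \o v))%E); last first.
    by move=> x; rewrite inE => Ax; rewrite gee0_abs// lee_fin subr_ge0 ltW.
  rewrite integralB//; apply/le_anti/andP; split.
    by rewrite sube_le0; exact: uv.
  rewrite suber_ge0; last exact: integrable_fin_num.
  by apply: le_integral => // x; rewrite inE lee_fin => /ltW.
move/(ae_eq_integral_abs _ mA) => H.
have := H (measurable_int _ (integrableB mA iuA ivA)).
apply: filterS => x /= h; rewrite leNgt; apply/negP => Ax.
by have [/eqP] := h Ax; rewrite subr_eq0 => /eqP E; move: Ax; rewrite E ltxx.
Qed.

Lemma mw_ae_eq u v : measurable_wrt G u -> measurable_wrt G v ->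
  integrableR u -> integrableR v ->
  (forall A, G A -> (\int[P]_(x in A) (u x)%:E = \int[P]_(x in A) (v x)%:E)%E) ->
  \forall x \ae P, u x = v x.
Proof.
move=> mu mv iu iv uv.
have h1 : \forall x \ae P, u x <= v x by apply: mw_ae_le => // A GA; rewrite uv.
have h2 : \forall x \ae P, v x <= u x by apply: mw_ae_le => // A GA; rewrite uv.
by apply: filterS2 h1 h2 => x ? ?; apply/le_anti/andP.
Qed.

Lemma integrableRD u v : integrableR u -> integrableR v ->
  integrableR (fun x => u x + v x).
Proof. by move=> iu iv; exact: (integrableD measurableT iu iv). Qed.

Lemma rcexpD u v : integrableR u -> integrableR v ->
  \forall x \ae P, rcexp (fun x => u x + v x) x = rcexp u x + rcexp v x.
Proof.
move=> iu iv; have iuv := integrableRD iu iv.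
apply: mw_ae_eq.
- exact: measurable_rcexp.
- by apply: mwD; exact: measurable_rcexp.
- exact: integrable_rcexp.
- by apply: integrableRD; exact: integrable_rcexp.
- move=> A GA; have mA := GM GA; rewrite integral_rcexp//.
  under eq_integral do rewrite EFinD.
  under [RHS]eq_integral do rewrite EFinD.
  have iS w : integrableR w -> P.-integrable A (EFin \o w) by exact: integrableS.
  rewrite !integralD ?integral_rcexp//; apply: iS => //; exact: integrable_rcexp.
Qed.

(* The part w of an integrable product is pulled out of the generalized
   conditional expectation, which needs no integrability of w itself. *)
Lemma rcexpM u (w : U -> R) : measurable_fun setT u -> (forall x, 0 <= u x) ->
  measurable_wrt G w -> integrableR u ->
  \forall x \ae P, rcexp (fun x => u x * w x) x = fine (N (EFin \o u) x) * w x.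
Proof.
move=> mu u0 mw iu.
have mu' : measurable_fun setT (EFin \o u) by exact/measurable_EFinP.
have u0' x : (0 <= (EFin \o u) x)%E by rewrite lee_fin.
have mwp : measurable_wrt G (pos_part w).
  by apply/(@mw_EFin _ _ _ _ (fun x => Num.max (w x) 0)); apply: mw_max => //; exact: mw_cst.
have mwn : measurable_wrt G (neg_part w).
  apply/(@mw_EFin _ _ _ _ (fun x => Num.max (- w x) 0)).
  by apply: mw_max; [exact: mwN|exact: mw_cst].
have hp : pos_part (fun x => u x * w x) = (pos_part w \* (EFin \o u))%E.
  apply/funext => x; rewrite /pos_part /= -EFinM; congr EFin.
  by rewrite mulrC maxr_pMl// mul0r.
have hn : neg_part (fun x => u x * w x) = (neg_part w \* (EFin \o u))%E.
  apply/funext => x; rewrite /neg_part /= -EFinM; congr EFin.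
  by rewrite -mulrN mulrC maxr_pMl// mul0r.
have h1 := cexp_ge0M P sG GM mu' u0' mwp (pos_part_ge0 w).
have h2 := cexp_ge0M P sG GM mu' u0' mwn (neg_part_ge0 w).
have h3 := cexp_ge0_fin_num iu u0'.
apply: filterS3 h1 h2 h3 => x e1 e2 e3.
rewrite /rcexp hp hn e1 e2.
rewrite !fineM// [in RHS](pos_neg_partE w x) mulrBr; congr (_ - _); exact: mulrC.
Qed.

(** After multiplication by the indicator of A, only integrals over the sets B [&] A with B in G are
    compared. *)
Lemma rcexp_local u v A : integrableR u -> integrableR v -> G A ->
  (\forall x \ae P, A x -> u x = v x) ->
  \forall x \ae P, A x -> rcexp u x = rcexp v x.
Proof.
move=> iu iv GA uv; have mA := GM GA.
have mi w : integrableR w -> measurable_wrt G (fun x => \1_A x * rcexp w x).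
  by move=> iw; apply: mwM; [exact: measurable_wrt_indic|exact: measurable_rcexp].
have ii w : integrableR w -> integrableR (fun x => \1_A x * rcexp w x).
  move=> iw; apply: (le_integrable measurableT _ _ (integrable_rcexp iw)).
    by apply/measurable_EFinP/(measurable_wrt_fun sG GM); exact: mi.
  move=> x _ /=; rewrite lee_fin normrM ler_piMl// indicE.
  by case: (_ \in _); rewrite ?normr1 ?normr0.
have hE w B : integrableR w -> G B ->
    (\int[P]_(x in B) (\1_A x * rcexp w x)%:E = \int[P]_(x in B `&` A) (w x)%:E)%E.
  move=> iw GB.
  have GBA : G (B `&` A).
    rewrite -(measurable_gE sG); apply: measurableI; by rewrite (measurable_gE sG).
  rewrite -integral_rcexp// integral_mkcondr; apply: eq_integral => x _.
  by rewrite /patch indicE; case: (x \in A); rewrite ?mul1r ?mul0r.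
have : \forall x \ae P, \1_A x * rcexp u x = \1_A x * rcexp v x.
  apply: mw_ae_eq; [exact: mi|exact: mi|exact: ii|exact: ii|].
  move=> B GB; rewrite !hE//; apply: ae_eq_integral.
  - by apply: measurableI => //; exact: GM.
  - by apply: measurable_funTS; exact: measurable_int iu.
  - by apply: measurable_funTS; exact: measurable_int iv.
  - by apply: filterS uv => x h [_ Ax]; rewrite h.
by apply: filterS => x + Ax; rewrite indicE mem_set// !mul1r.
Qed.

End real_cexp.

(** * Conditional densities, bounds on their penalties, and G-measurable mixtures *)

Section density_mixing.
Context {d} {U : measurableType d} {R : realType}.
Variables (P : probability U R) (p : R) (p1 : 1 <= p).
Variables (G H : set (set U)).
Variables (sG : sigma_algebra setT G) (GM : G `<=` measurable).
Variables (sH : sigma_algebra setT H) (HM : H `<=` measurable) (GH : G `<=` H).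
Variable rho : (U -> R) -> (U -> R).
Local Notation LG := (LpG P p G).
Local Notation LH := (LpG P p H).
Local Notation N := (cexp_ge0 P G).
Implicit Types (z a X Y : U -> R).

(** These are the densities of the probabilities on H whose restriction to G is P. *)
Definition cond_density z : Prop := [/\ measurable_wrt H z, (forall x, 0 <= z x) &
  forall A, G A -> (\int[P]_(x in A) (z x)%:E = P A)%E].

Definition wpos z Y x : \bar R := ((z x)%:E * pos_part Y x)%E.
Definition wneg z Y x : \bar R := ((z x)%:E * neg_part Y x)%E.

(** For Q with density z, this is E_Q(Y | G) written under P. The two parts stay separate because z
    Y need not be integrable. *)
Definition wcexp z Y x : \bar R := (N (wpos z Y) x - N (wneg z Y) x)%E.

(** For Q with density z, this bounds the minimal penalty of Q by a, with reference neither to Q nor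
    to a version of an essential supremum. *)
Definition penalty_le z a : Prop := forall Y, LH Y ->
  \forall x \ae P, (wcexp z (fun w => - Y w)%R x - (rho Y x)%:E <= (a x)%:E)%E.

Lemma wnegE z Y : wneg z Y = wpos z (fun x => - Y x).
Proof. by []. Qed.

Lemma wpos_ge0 z Y x : 0 <= z x -> (0 <= wpos z Y x)%E.
Proof. by move=> z0; rewrite mule_ge0// ?lee_fin// le_max lexx orbT. Qed.

Lemma measurable_wpos z Y : measurable_fun setT z -> measurable_fun setT Y ->
  measurable_fun setT (wpos z Y).
Proof.
move=> mz mY; apply: emeasurable_funM; first exact/measurable_EFinP.
exact: measurable_pos_part.
Qed.

Let mLH X : LH X -> measurable_fun setT X.
Proof. by move=> [_ LX]; exact: Lfun_measurable LX. Qed.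

Let mdens z : cond_density z -> measurable_fun setT z.
Proof. by move=> [mz _ _]; exact: measurable_wrt_fun mz. Qed.

Lemma wpos_lty z Y Y' : cond_density z -> LH Y -> LH Y' -> (forall x, Y x <= `|Y' x|) ->
  (\forall x \ae P, N (wpos z (fun w => `|Y' w|)%R) x < +oo)%E ->
  (\forall x \ae P, N (wpos z Y) x < +oo)%E.
Proof.
move=> dz LY LY' YY'; have mz := mdens dz; have [_ z0 _] := dz.
have LaY' : LH (fun w => `|Y' w|) by exact: LpG_abs.
have h : \forall x \ae P, (N (wpos z Y) x <= N (wpos z (fun w => `|Y' w|)%R) x)%E.
  apply: cexp_ge0_le => //.
  - by apply: measurable_wpos => //; exact: mLH.
  - by move=> x; exact: wpos_ge0.
  - by apply: measurable_wpos => //; exact: mLH.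
  - by move=> x; exact: wpos_ge0.
  - apply: aeW => x; rewrite lee_wpmul2l// ?lee_fin//.
    by rewrite [leRHS]max_l// ge_max YY' normr_ge0.
by apply: filterS2 h => x h1 h2; exact: le_lt_trans h1 h2.
Qed.

(** Tested on -|Y|, the penalty bound reads E(z|Y| | G) <= a + rho(-|Y|), whose right-hand side is
    finite. *)
Lemma penalty_le_lty z a Y : cond_density z -> penalty_le z a -> LH Y ->
  \forall x \ae P, (N (wpos z Y) x < +oo)%E.
Proof.
move=> dz pz LY; have mz := mdens dz; have [_ z0 _] := dz.
have LaY : LH (fun w => - `|Y w|) by apply: LpGN => //; exact: LpG_abs.
apply: (wpos_lty dz LY LY) => [x|]; first exact: ler_norm.
have N0 : \forall x \ae P, N (wneg z (fun w => - - `|Y w|)) x = 0%E.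
  have GT : G setT by rewrite -(measurable_gE sG); exact: measurableT.
  have -> : wneg z (fun w => - - `|Y w|) = cst 0%E.
    apply/funext => x; by rewrite /wneg /neg_part opprK max_r ?mule0//.
  exact: cexp_ge0_cst0.
apply: filterS2 N0 (pz _ LaY) => x; rewrite /wcexp => ->.
rewrite sube0 leeBlDr// => h.
rewrite (_ : (fun w => `|Y w|) = fun w => - - `|Y w|).
  by rewrite (le_lt_trans h)// -EFinD ltry.
by apply/funext => w; rewrite opprK.
Qed.

Section mix.
Variable L : U -> R.
Hypotheses (mL : measurable_wrt G L) (L0 : forall x, 0 <= L x) (L1 : forall x, L x <= 1).

Definition mix z1 z2 x := L x * z1 x + (1 - L x) * z2 x.

Let oneL0 x : 0 <= 1 - L x. Proof. by rewrite subr_ge0. Qed.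

Let moneL : measurable_wrt G (fun x => 1 - L x).
Proof. by apply: mwB => //; exact: mw_cst. Qed.

(** As E(z | G) = 1, the factor z drops out against G-measurable functions. *)
Let cond_density_weight z (M : U -> R) A : cond_density z -> measurable_wrt G M -> (forall x, 0 <= M x) ->
  G A -> (\int[P]_(x in A) (M x * z x)%:E = \int[P]_(x in A) (M x)%:E)%E.
Proof.
move=> dz mM M0 GA; have mz := mdens dz; have [_ z0 zE] := dz.
have mA : measurable_wrt G (fun x => \1_A x * M x).
  by apply: mwM => //; exact: measurable_wrt_indic.
have A0 x : 0 <= \1_A x * M x by rewrite mulr_ge0.
rewrite [LHS]integral_mkcond [RHS]integral_mkcond.
transitivity (\int[P]_x ((EFin \o (fun x => \1_A x * M x)%R) x * (z x)%:E))%E.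
  apply: eq_integral => x _; rewrite /patch /= indicE -EFinM.
  by case: (x \in A); rewrite ?mul1r ?mul0r.
rewrite (@integralM_eq _ _ _ P G sG GM _ (cst 1%E)).
- apply: eq_integral => x _; rewrite /patch /= indicE mule1.
  by case: (x \in A); rewrite ?mul1r ?mul0r.
- exact/measurable_EFinP.
- by move=> x; rewrite lee_fin.
- exact: measurable_cst.
- by [].
- by move=> B GB; rewrite zE// integral_cst ?mul1e//; exact: GM.
- exact/mw_EFin.
- by move=> x; rewrite lee_fin.
Qed.

Lemma cond_density_mix z1 z2 : cond_density z1 -> cond_density z2 -> cond_density (mix z1 z2).
Proof.
move=> d1 d2; have [mz1 z10 _] := d1; have [mz2 z20 _] := d2.
have mz1' := mdens d1; have mz2' := mdens d2.
have mL' := measurable_wrt_fun sG GM mL.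
have moneL' := measurable_wrt_fun sG GM moneL.
split.
- by apply: mwD; apply: mwM => //; exact: (mw_sub GH).
- by move=> x; rewrite addr_ge0// mulr_ge0.
- move=> A GA; have mA := GM GA.
  under eq_integral do rewrite EFinD.
  rewrite ge0_integralD//.
  + rewrite !cond_density_weight// -ge0_integralD//.
    * transitivity (\int[P]_(x in A) cst 1 x)%E.
        by apply: eq_integral => x _; rewrite -EFinD addrC subrK.
      by rewrite integral_cst// mul1e.
    * by move=> x _; rewrite lee_fin.
    * by apply/measurable_EFinP; exact: measurable_funTS.
    * by move=> x _; rewrite lee_fin.
    * by apply/measurable_EFinP; exact: measurable_funTS.
  + by move=> x _; rewrite lee_fin mulr_ge0.
  + by apply/measurable_EFinP; apply: measurable_funTS; exact: measurable_funM.
  + by move=> x _; rewrite lee_fin mulr_ge0.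
  + by apply/measurable_EFinP; apply: measurable_funTS; exact: measurable_funM.
Qed.

Let N_mix z1 z2 Y : cond_density z1 -> cond_density z2 -> measurable_fun setT Y ->
  \forall x \ae P, (N (wpos (mix z1 z2) Y) x =
    (L x)%:E * N (wpos z1 Y) x + (1 - L x)%R%:E * N (wpos z2 Y) x)%E.
Proof.
move=> d1 d2 mY; have [_ z10 _] := d1; have [_ z20 _] := d2.
have m1 := measurable_wpos (mdens d1) mY; have m2 := measurable_wpos (mdens d2) mY.
have w1 x := wpos_ge0 Y (z10 x); have w2 x := wpos_ge0 Y (z20 x).
have mL' : measurable_fun setT (EFin \o L).
  by apply/measurable_EFinP; exact: measurable_wrt_fun mL.
have moneL' : measurable_fun setT (EFin \o (fun x => 1 - L x)%R).
  by apply/measurable_EFinP; exact: measurable_wrt_fun moneL.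
have -> : wpos (mix z1 z2) Y = (((EFin \o L) \* wpos z1 Y) \+
    ((EFin \o (fun x => 1 - L x)%R) \* wpos z2 Y))%E.
  apply/funext => x; rewrite /wpos /mix /pos_part /= -!EFinM -EFinD; congr EFin.
  by ring.
have w1' x : (0 <= ((EFin \o L) \* wpos z1 Y) x)%E by rewrite mule_ge0// lee_fin.
have w2' x : (0 <= ((EFin \o (fun x => 1 - L x)%R) \* wpos z2 Y) x)%E.
  by rewrite mule_ge0// lee_fin.
have h1 := cexp_ge0D P sG GM (emeasurable_funM mL' m1) w1' (emeasurable_funM moneL' m2) w2'.
have h2 : \forall x \ae P, (N ((EFin \o L) \* wpos z1 Y) x = (L x)%:E * N (wpos z1 Y) x)%E.
  apply: (@cexp_ge0M _ _ _ P G sG GM (EFin \o L)) => //; exact/mw_EFin.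
have h3 : \forall x \ae P, (N ((EFin \o (fun x => 1 - L x)%R) \* wpos z2 Y) x =
    (1 - L x)%R%:E * N (wpos z2 Y) x)%E.
  apply: (@cexp_ge0M _ _ _ P G sG GM (EFin \o (fun x => 1 - L x)%R)) => //.
  exact/mw_EFin.
apply: filterS3 h1 h2 h3 => x e1 e2 e3.
by rewrite -e2 -e3; exact: e1.
Qed.

(** The penalty bounds make all the conditional expectations finite, so the affine identity holds in
    the reals and never meets oo - oo. *)
Lemma wcexp_mix z1 z2 a1 a2 Y : cond_density z1 -> cond_density z2 -> penalty_le z1 a1 -> penalty_le z2 a2 ->
  LH Y -> \forall x \ae P, exists e1 e2 : R,
    [/\ wcexp z1 Y x = e1%:E, wcexp z2 Y x = e2%:E &
     wcexp (mix z1 z2) Y x = (L x * e1 + (1 - L x) * e2)%:E].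
Proof.
move=> d1 d2 pz1 pz2 LY.
have LNY : LH (fun w => - Y w) by exact: LpGN.
have fin z a V : cond_density z -> penalty_le z a -> LH V ->
    \forall x \ae P, N (wpos z V) x \is a fin_num.
  move=> dz pz LV; apply: filterS (penalty_le_lty dz pz LV) => x.
  by rewrite ge0_fin_numE// cexp_ge0_ge0.
have fin2 z a : cond_density z -> penalty_le z a -> \forall x \ae P,
    N (wpos z Y) x \is a fin_num /\ N (wpos z (fun w => - Y w)) x \is a fin_num.
  by move=> dz pz; apply: filterI; exact: fin dz pz _.
have h3 : \forall x \ae P,
    (N (wpos (mix z1 z2) Y) x =
      (L x)%:E * N (wpos z1 Y) x + (1 - L x)%R%:E * N (wpos z2 Y) x)%E /\
    (N (wpos (mix z1 z2) (fun w => - Y w)%R) x =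
      (L x)%:E * N (wpos z1 (fun w => - Y w)%R) x +
      (1 - L x)%R%:E * N (wpos z2 (fun w => - Y w)%R) x)%E.
  by apply: filterI; apply: N_mix => //; exact: mLH.
have h1 := fin2 _ _ d1 pz1; have h2 := fin2 _ _ d2 pz2.
apply: filterS3 h1 h2 h3 => x [f1 f1'] [f2 f2'] [E E'].
exists (fine (N (wpos z1 Y) x) - fine (N (wneg z1 Y) x)).
exists (fine (N (wpos z2 Y) x) - fine (N (wneg z2 Y) x)).
rewrite /wcexp !wnegE E E' -(fineK f1) -(fineK f1') -(fineK f2) -(fineK f2') /=.
split => //.
by rewrite -!EFinM -!EFinD; congr EFin; ring.
Qed.

Lemma penalty_le_mix z1 z2 a1 a2 : cond_density z1 -> cond_density z2 -> penalty_le z1 a1 -> penalty_le z2 a2 ->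
  penalty_le (mix z1 z2) (fun x => L x * a1 x + (1 - L x) * a2 x).
Proof.
move=> d1 d2 pz1 pz2 Y LY.
have LNY : LH (fun w => - Y w) by exact: LpGN.
apply: filterS3 (wcexp_mix d1 d2 pz1 pz2 LNY) (pz1 _ LY) (pz2 _ LY).
move=> x [e1 [e2 [-> -> ->]]]; rewrite -!EFinB !lee_fin => h1 h2.
have := ler_wpM2l (L0 x) h1; have := ler_wpM2l (oneL0 x) h2; lra.
Qed.

End mix.

End density_mixing.

(** * Locality and optimal densities *)

Section Rintegral_facts.
Context {d} {U : measurableType d} {R : realType}.
Variables (P : probability U R).
Implicit Types u v : U -> R.
Local Notation integrableR v := (P.-integrable setT (EFin \o v)).

Lemma integrableRZ (a : R) u : integrableR u -> integrableR (fun x => a * u x).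
Proof. by move=> iu; exact: (integrableZl measurableT a iu). Qed.

Lemma integrableRB u v : integrableR u -> integrableR v ->
  integrableR (fun x => u x - v x).
Proof. by move=> iu iv; exact: (integrableB measurableT iu iv). Qed.

Lemma integrable_ae_le u (v : U -> \bar R) :
  measurable_fun setT u -> P.-integrable setT v ->
  (\forall x \ae P, (`|(u x)%:E| <= `|v x|)%E) -> integrableR u.
Proof.
move=> mu /integrableP[mv voo] uv; apply/integrableP; split.
  exact/measurable_EFinP.
apply: le_lt_trans voo; apply: ae_ge0_le_integral => //.
- by apply: measurableT_comp => //; exact/measurable_EFinP.
- exact: measurableT_comp.
- by apply: filterS uv => x h _.
Qed.

Lemma EFin_Rintegral u : integrableR u ->
  ((\int[P]_x u x)%:E = (\int[P]_x (u x)%:E))%E.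
Proof. by move=> iu; rewrite /Rintegral fineK//; exact: integrable_fin_num. Qed.

Lemma Rintegral_ae_ge0 u : integrableR u -> (\forall x \ae P, 0 <= u x) ->
  0 <= \int[P]_x u x.
Proof.
move=> iu u0; rewrite -lee_fin EFin_Rintegral//.
rewrite (@ae_eq_integral _ _ _ P setT (fun x => `|(u x)%:E|)%E)//.
- by apply: integral_ge0 => x _; exact: abse_ge0.
- exact: measurable_int iu.
- by apply: measurableT_comp => //; exact: measurable_int iu.
- by apply: filterS u0 => x ux _; rewrite gee0_abs ?lee_fin.
Qed.

Lemma Rintegral_ae_le u v : integrableR u -> integrableR v ->
  (\forall x \ae P, u x <= v x) -> (\int[P]_x u x) <= \int[P]_x v x.
Proof.
move=> iu iv uv; rewrite -subr_ge0 -RintegralB//.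
apply: Rintegral_ae_ge0; first exact: integrableRB.
by apply: filterS uv => x; rewrite subr_ge0.
Qed.

Lemma Rintegral_ae_eq u v : integrableR u -> integrableR v ->
  (\forall x \ae P, u x = v x) -> (\int[P]_x u x) = \int[P]_x v x.
Proof.
move=> iu iv uv; apply/le_anti/andP; split; apply: Rintegral_ae_le => //;
  by apply: filterS uv => x ->.
Qed.

Lemma RintegralMN z v : integrableR (fun x => z x * v x) ->
  (\int[P]_x (z x * - v x)) = - \int[P]_x (z x * v x).
Proof.
move=> izv; rewrite -mulN1r -RintegralZl//.
by apply: eq_Rintegral => x _; ring.
Qed.

Lemma Rintegral_le0_ae_eq0 u : integrableR u -> (\forall x \ae P, 0 <= u x) ->
  (\int[P]_x u x) <= 0 -> \forall x \ae P, u x = 0.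
Proof.
move=> iu u0 Iu.
have : (\int[P]_x `|(EFin \o u) x| = 0)%E.
  rewrite (@ae_eq_integral _ _ _ P setT (fun x => (u x)%:E))//.
  - rewrite -EFin_Rintegral//; congr EFin; apply/le_anti; rewrite Iu/=.
    exact: Rintegral_ae_ge0.
  - by apply: measurableT_comp => //; exact: measurable_int iu.
  - exact: measurable_int iu.
  - by apply: filterS u0 => x ux _; rewrite gee0_abs ?lee_fin.
move/(ae_eq_integral_abs _ measurableT) => /(_ (measurable_int _ iu)).
by apply: filterS => x /(_ I) [].
Qed.

End Rintegral_facts.

(** Extracts the slope from estimates for risk measures, which are tested on l X and carry additive
    constants. *)
Lemma ler_of_scaled {R : realType} (a b c : R) :
  (forall l, 0 < l -> l * a <= l * b + c) -> a <= b.
Proof.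
move=> h; rewrite leNgt; apply/negP => ba.
have d0 : 0 < a - b by rewrite subr_gt0.
(* For this l the excess l (a - b) equals |c| + 1, which is larger than c. *)
have l0 : 0 < (`|c| + 1) / (a - b) by rewrite divr_gt0// ltr_wpDl.
have := h _ l0; rewrite -lerBlDl -mulrBr divfK ?lt0r_neq0//.
have := ler_norm c; lra.
Qed.

Section core.
Context {d} {U : measurableType d} {R : realType}.
Variables (P : probability U R) (p : R) (p1 : 1 <= p).
Variables (G H : set (set U)).
Variables (sG : sigma_algebra setT G) (GM : G `<=` measurable).
Variables (sH : sigma_algebra setT H) (HM : H `<=` measurable) (GH : G `<=` H).
Variable rho : (U -> R) -> (U -> R).
Local Notation LG := (LpG P p G).
Local Notation LH := (LpG P p H).
Local Notation integrableR v := (P.-integrable setT (EFin \o v)).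
Local Notation nrm := (nrm P p).
Hypothesis rho_LG : forall X, LH X -> LG (rho X).
Hypothesis rho_mono : forall X Y, LH X -> LH Y ->
  (\forall x \ae P, Y x <= X x) -> \forall x \ae P, rho X x <= rho Y x.
Hypothesis rho_convex : forall X Y (l : R), LH X -> LH Y -> 0 <= l <= 1 ->
  \forall x \ae P, rho (fun w => l * X w + (1 - l) * Y w) x
                     <= l * rho X x + (1 - l) * rho Y x.
Hypothesis rho_trans : forall X f, LH X -> LG f ->
  \forall x \ae P, rho (fun w => X w + f w) x = rho X x - f x.
(** A single time step: [rs] and [rt] stand for the real values of rho_0s and rho_0t, and [zt] for
    the density on H of a fixed probability whose penalty is at most [c]. *)
Variables (rs rt : (U -> R) -> R) (K C c : R).
Hypothesis rs_mono : forall X Y, LG X -> LG Y ->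
  (\forall x \ae P, Y x <= X x) -> rs X <= rs Y.
Hypothesis rt_rs : forall X, LH X -> rt X = rs (fun x => - rho X x).
Hypothesis rt_convex : forall X Y (l : R), LH X -> LH Y -> 0 <= l <= 1 ->
  rt (fun w => l * X w + (1 - l) * Y w) <= l * rt X + (1 - l) * rt Y.
Hypothesis K_ge0 : 0 <= K.
Hypothesis rt_le : forall X, LH X -> rt X <= K * nrm X + C.
Variable zt : U -> R.
Hypothesis mzt : measurable_wrt H zt.
Hypothesis zt0 : forall x, 0 <= zt x.
Hypothesis zt_gt0 : \forall x \ae P, 0 < zt x.
Hypothesis zt_int : forall X, LH X -> integrableR (fun x => zt x * X x).
Hypothesis zt_leG : forall f, LG f -> - (\int[P]_x (zt x * f x)) <= rs f + c.
Hypothesis zt_leH : forall X, LH X -> - (\int[P]_x (zt x * X x)) <= rt X + c.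

Let LGH X : LG X -> LH X.
Proof. by move=> [mX LX]; split => //; exact: mw_sub GH mX. Qed.

Let mLH X : LH X -> measurable_fun setT X.
Proof. by move=> [_ LX]; exact: Lfun_measurable LX. Qed.

(** A convex function bounded above near a point is upper semicontinuous there: X n is a convex
    combination of X0 and of a point W far out in the direction X n - X0, at which only the growth
    bound is used. *)
Lemma rt_usc (X : nat -> U -> R) X0 : (forall n, LH (X n)) -> LH X0 ->
  (forall e, 0 < e -> \forall n \near \oo, nrm (fun x => X n x - X0 x) < e) ->
  forall e, 0 < e -> exists n, rt (X n) <= rt X0 + e.
Proof.
move=> LX LX0 Xcvg e e0.
pose B := K * nrm X0 + C - rt X0.
have B0 : 0 <= B by rewrite subr_ge0; exact: rt_le.
(* W receives the weight l. The choice gives l B <= e/2, and the other half of e pays for K times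
   the norm of X n - X0. *)
pose l := e / (e + 2 * B).
have eB : 0 < e + 2 * B by rewrite ltr_pwDl// mulr_ge0.
have l0 : 0 < l by exact: divr_gt0.
have l1 : l <= 1 by rewrite ler_pdivrMr// mul1r lerDl mulr_ge0.
have lB : l * B <= e / 2.
  rewrite /l mulrAC ler_pdivrMr//.
  have -> : e / 2 * (e + 2 * B) = e * e / 2 + e * B by field.
  by rewrite lerDr divr_ge0// mulr_ge0// ltW.
have K1 : 0 < 2 * (K + 1) by rewrite mulr_gt0// ltr_wpDl.
have [n _ /(_ n (leqnn n))/=] := Xcvg _ (divr_gt0 e0 K1).
rewrite ltr_pdivlMr// => Xn.
exists n.
have LB : LH (fun x => X n x - X0 x) by exact: LpGB.
have LW : LH (fun x => X0 x + l^-1 * (X n x - X0 x)).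
  by apply: LpGD => //; exact: LpGZ.
have -> : X n = fun x => l * (X0 x + l^-1 * (X n x - X0 x)) + (1 - l) * X0 x.
  by apply/funext => x; field; exact: lt0r_neq0.
have l01 : 0 <= l <= 1 by rewrite l1 ltW.
apply: le_trans (rt_convex LW LX0 l01) _.
have := rt_le LW.
have := @nrmD _ _ _ P p p1 X0 (fun x => l^-1 * (X n x - X0 x)) LX0.2 (LpGZ p1 l^-1 LB).2.
rewrite (@nrmZ _ _ _ P p p1 l^-1 _ LB.2) ger0_norm; last first.
  by rewrite invr_ge0 ltW.
set a := nrm (fun x => X0 x + l^-1 * (X n x - X0 x)).
set b := nrm (fun x => X n x - X0 x) in Xn *.
have b0 : 0 <= b by exact: nrm_ge0.
move=> h1 h2.
have h3 : l * a <= l * nrm X0 + b.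
  have := ler_wpM2l (ltW l0) h1.
  by rewrite mulrDr mulrA mulfV ?mul1r// lt0r_neq0.
have h4 : l * rt (fun x => X0 x + l^-1 * (X n x - X0 x)) <= l * (K * a + C).
  by rewrite ler_wpM2l// ltW.
have h5 : K * (l * a) <= K * (l * nrm X0 + b) by rewrite ler_wpM2l.
have h6 : b * K <= e / 2 by nra.
move: lB; rewrite /B => lB; nra.
Qed.

(* Iterating the hypothesis gives rs (- n D) <= rs 0 for all n, whereas the lower
   bound given by zt grows linearly in n unless D = 0. *)
Lemma zt_strict D : LG D -> (forall x, 0 <= D x) ->
  (forall f, LG f -> rs (fun x => f x - D x) <= rs f) ->
  \forall x \ae P, D x = 0.
Proof.
move=> LD D0 DP.
have LnD n : LG (fun x => n%:R * D x) by exact: LpGZ.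
have H1 n : rs (fun x => - (n%:R * D x)) <= rs (cst 0).
  elim: n => [|n IH].
    by rewrite (_ : (fun x => _) = cst 0)//; apply/funext => x; rewrite mul0r oppr0.
  apply: le_trans IH.
  rewrite (_ : (fun x => _) = fun x => - (n%:R * D x) - D x).
    by apply: DP; exact: LpGN.
  by apply/funext => x; rewrite -natr1; ring.
have H2 n : n%:R * (\int[P]_x (zt x * D x)) <= rs (cst 0) + c.
  have LN : LG (fun x => - (n%:R * D x)) by exact: LpGN.
  have E : (\int[P]_x (zt x * - (n%:R * D x))) = - (n%:R * \int[P]_x (zt x * D x)).
    rewrite -mulNr -RintegralZl//; last exact/zt_int/LGH.
    by apply: eq_Rintegral => x _; ring.
  have := zt_leG LN; rewrite E opprK => h; apply: le_trans h _.
  by rewrite lerD2r.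
have izD : integrableR (fun x => zt x * D x) by exact/zt_int/LGH.
have zD0 : \forall x \ae P, 0 <= zt x * D x by apply: aeW => x; exact: mulr_ge0.
have : (\int[P]_x (zt x * D x)) <= 0.
  rewrite leNgt; apply/negP => I0.
  have := H2 (Num.truncn ((rs (cst 0) + c) / \int[P]_x (zt x * D x))).+1.
  by apply/negP; rewrite -ltNge -ltr_pdivrMr// truncnS_gt.
move=> /(Rintegral_le0_ae_eq0 izD zD0).
move=> zD; apply: filterS2 zD zt_gt0 => x /eqP.
by rewrite mulf_eq0 => /orP[/eqP ->|/eqP//]; rewrite ltxx.
Qed.

(* Truncation reduces locality to differences bounded by constants, where it
   follows from monotonicity and translation invariance. *)
Let rho_local_le A X Y : G A -> LH X -> LH Y -> (forall x, Y x <= X x) ->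
  (forall x, A x -> X x = Y x) ->
  \forall x \ae P, A x -> rho X x = rho Y x.
Proof.
move=> GA LX LY YX XYA.
have GCA : G (~` A) by have [_ sC _] := sG; rewrite -setTD; exact: sC.
pose X_ n x := Num.min (X x) (Y x + n%:R).
have LX_ n : LH (X_ n).
  by apply: LpG_min => //; apply: LpGD => //; exact: LpG_cst.
have LnA n : LG (fun x => n%:R * \1_(~` A) x).
  by apply: LpGZ => //; exact: LpG_indicator.
have YX_ n x : Y x <= X_ n x.
  by rewrite /X_ le_min YX lerDl ler0n.
have X_X n x : X_ n x <= X x by rewrite /X_ ge_min lexx.
have X_A n : \forall x \ae P, A x -> rho (X_ n) x = rho Y x.
  have h1 := rho_mono (LX_ n) LY (aeW _ (YX_ n)).
  have LYn : LH (fun x => Y x + n%:R * \1_(~` A) x) by apply: LpGD => //; exact: LGH.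
  have h2 : \forall x \ae P, rho (fun x => Y x + n%:R * \1_(~` A) x) x <= rho (X_ n) x.
    apply: rho_mono => //; apply: aeW => x.
    have [Ax|nAx] := pselect (A x).
      by rewrite /X_ XYA// indicE memNset// mulr0 addr0 ge_min lexx.
    by rewrite indicE mem_set// mulr1 /X_ ge_min lexx orbT.
  have h3 := rho_trans LY (LnA n).
  apply: filterS3 h1 h2 h3 => x h1 h2 h3 Ax.
  apply/le_anti; rewrite h1/=; move: h2; rewrite h3 indicE memNset//.
  by rewrite mulr0 subr0.
(* The defect of locality. Every truncation exhibits it in full, since rho (X_ n) = rho Y on A,
   while the truncations converge to X. *)
pose D x := \1_A x * Num.max (rho Y x - rho X x) 0.
have LD : LG D.
  apply: (LpG_indic p1 sG GM) => //; apply: LpG_max => //; last exact: LpG_cst.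
  by apply: LpGB => //; exact: rho_LG.
have D0 x : 0 <= D x by rewrite mulr_ge0// le_max lexx orbT.
have rXY : \forall x \ae P, rho X x <= rho Y x by apply: rho_mono => //; exact: aeW.
have DX n : \forall x \ae P, rho X x + D x <= rho (X_ n) x.
  have h1 := rho_mono LX (LX_ n) (aeW _ (X_X n)).
  apply: filterS3 rXY h1 (X_A n) => x h1 h2 h3.
  rewrite /D indicE; have [Ax|nAx] := pselect (A x).
    rewrite mem_set// mul1r h3// max_l ?subr_ge0//; lra.
  by rewrite memNset// mul0r addr0.
have Dstrict f : LG f -> rs (fun x => f x - D x) <= rs f.
  move=> Lf.
  (* After translation by f + rho X, the value of [rt] at X becomes [rs f], and its value at X_ n is
     at least rs (f - D); upper semicontinuity compares the two. *)
  have Lg : LG (fun x => f x + rho X x) by apply: LpGD => //; exact: rho_LG.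
  have Lh : LG (fun x => - (f x + rho X x)) by exact: LpGN.
  have Lg' : LH (fun x => f x + rho X x) by exact: LGH.
  pose Xg x := X x + (f x + rho X x).
  have LXg : LH Xg by exact: LpGD.
  have LX_g n : LH (fun x => X_ n x + (f x + rho X x)) by exact: LpGD.
  have E1 : rt Xg = rs f.
    have Lr : LG (fun x => - rho Xg x) by exact/LpGN/rho_LG.
    rewrite (rt_rs LXg); apply/le_anti/andP; split.
      apply: (rs_mono Lr Lf).
      by apply: filterS (rho_trans LX Lg) => x; rewrite /Xg => ->; lra.
    apply: (rs_mono Lf Lr).
    by apply: filterS (rho_trans LX Lg) => x; rewrite /Xg => ->; lra.
  have E2 n : rs (fun x => f x - D x) <= rt (fun x => X_ n x + (f x + rho X x)).
    rewrite (rt_rs (LX_g n)).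
    have LD' : LG (fun x => f x - D x) by exact: LpGB.
    have Lr : LG (fun x => - rho (fun y => X_ n y + (f y + rho X y)) x).
      exact/LpGN/rho_LG.
    apply: (rs_mono LD' Lr).
    apply: filterS2 (DX n) (rho_trans (LX_ n) Lg) => x h1 ->; lra.
  apply/ler_addgt0Pr => e e0; rewrite -E1.
  have cv e' : 0 < e' ->
      \forall n \near \oo, nrm (fun x => X_ n x + (f x + rho X x) - Xg x) < e'.
    move=> e'0.
    have E n : (fun x => X_ n x + (f x + rho X x) - Xg x) = (fun x => X_ n x - X x).
      by apply/funext => x; rewrite /Xg; lra.
    under eq_near do rewrite E.
    have LXY : LH (fun x => X x - Y x) by exact: LpGB.
    apply: (@nrm_dominated_cvg _ _ _ P p p1 (fun n x => X_ n x - X x) _ _ LXY.2) => //.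
    - by move=> n; apply: mLH; exact: LpGB.
    - move=> n x; rewrite ler0_norm ?subr_le0// ger0_norm ?subr_ge0//.
      by have := YX_ n x; lra.
    - move=> x; apply: cvg_near_cst; near=> n.
      rewrite /X_ min_l ?subrr// -lerBlDl.
      by near: n; exact: nbhs_infty_ger.
  have [n hn] := rt_usc LX_g LXg cv e0.
  exact: le_trans (E2 n) hn.
have h := zt_strict LD D0 Dstrict.
apply: filterS2 h rXY => x; rewrite /D indicE => h1 h2 Ax.
move: h1; rewrite mem_set// mul1r max_l ?subr_ge0//; lra.
Unshelve. all: by end_near. Qed.

(** Both positions are compared with their maximum, which agrees with each of them on A; this is the
    ordered case twice. *)
Lemma rho_local A X Y : G A -> LH X -> LH Y -> (forall x, A x -> X x = Y x) ->
  \forall x \ae P, A x -> rho X x = rho Y x.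
Proof.
move=> GA LX LY XYA.
have LM : LH (fun x => Num.max (X x) (Y x)) by exact: LpG_max.
have h1 : \forall x \ae P, A x -> rho (fun x => Num.max (X x) (Y x)) x = rho X x.
  apply: rho_local_le => //; first by move=> x; rewrite le_max lexx.
  by move=> x Ax; rewrite XYA// maxxx.
have h2 : \forall x \ae P, A x -> rho (fun x => Num.max (X x) (Y x)) x = rho Y x.
  apply: rho_local_le => //; first by move=> x; rewrite le_max lexx orbT.
  by move=> x Ax; rewrite XYA// maxxx.
by apply: filterS2 h1 h2 => x e1 e2 Ax; rewrite -e1// e2.
Qed.

(** Conditional densities before normalization: w has the same conditional expectation given G as
    [zt], and w / E(zt | G) is the density sought. *)
Definition weight (w : U -> R) : Prop :=
  [/\ measurable_wrt H w, (forall x, 0 <= w x),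
      (forall Y, LH Y -> integrableR (fun x => w x * Y x)) &
      forall A, G A -> (\int[P]_(x in A) (w x)%:E = \int[P]_(x in A) (zt x)%:E)%E].

Lemma zt_weight : weight zt. Proof. by split. Qed.

Definition loss w Y : U -> R := fun x => w x * - Y x + zt x * - rho Y x.

(** Up to the factor E(zt | G), this is E_Q(-Y | G) - rho(Y) for Q with density w / E(zt | G), the
    expression whose supremum over Y is the penalty of Q. *)
Definition score w Y := rcexp P G (loss w Y).

Lemma integrable_loss w Y : weight w -> LH Y -> integrableR (loss w Y).
Proof.
move=> [_ _ wi _] LY; apply: integrableRD.
  exact/wi/LpGN.
exact/zt_int/LGH/LpGN/rho_LG.
Qed.

Let integrable_score w Y : weight w -> LH Y -> integrableR (score w Y).
Proof. by move=> ww LY; apply: integrable_rcexp => //; exact: integrable_loss. Qed.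

Let GT : G setT.
Proof. by rewrite -(measurable_gE sG); exact: measurableT. Qed.

Lemma Rintegral_score w Y : weight w -> LH Y ->
  (\int[P]_x score w Y x) = \int[P]_x loss w Y x.
Proof.
move=> ww LY; apply: EFin_inj.
rewrite !EFin_Rintegral; [|exact: integrable_loss|exact: integrable_score].
by rewrite integral_rcexp//; exact: integrable_loss.
Qed.

(** The positions are pasted along the G-event where the first score is the larger one; locality of
    [rho] makes the score follow the pasting. *)
Lemma score_max w Y Y' : weight w -> LH Y -> LH Y' ->
  exists2 Y'', LH Y'' &
    \forall x \ae P, score w Y'' x = Num.max (score w Y x) (score w Y' x).
Proof.
move=> ww LY LY'.
pose A := [set x | score w Y' x <= score w Y x].
have GA : G A by apply: mw_ler => //; exact: measurable_rcexp.
have GCA : G (~` A) by have [_ sC _] := sG; rewrite -setTD; exact: sC.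
pose Y'' x := \1_A x * Y x + \1_(~` A) x * Y' x.
have LY'' : LH Y''.
  by apply: LpGD => //; apply: (LpG_indic p1 sH HM) => //; exact: GH.
have Y1 x : A x -> Y'' x = Y x.
  by move=> Ax; rewrite /Y'' !indicE mem_set// memNset//= ?mul1r ?mul0r ?addr0//; apply.
have Y2 x : (~` A) x -> Y'' x = Y' x.
  by move=> Ax; rewrite /Y'' !indicE memNset// mem_set// mul1r mul0r add0r.
exists Y'' => //.
have iY := integrable_loss ww LY; have iY' := integrable_loss ww LY'.
have iY'' := integrable_loss ww LY''.
have h1 : \forall x \ae P, A x -> score w Y'' x = score w Y x.
  apply: rcexp_local => //.
  apply: filterS (rho_local GA LY'' LY Y1) => x h Ax.
  by rewrite /loss Y1// h.
have h2 : \forall x \ae P, (~` A) x -> score w Y'' x = score w Y' x.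
  apply: rcexp_local => //.
  apply: filterS (rho_local GCA LY'' LY' Y2) => x h Ax.
  by rewrite /loss Y2// h.
apply: filterS2 h1 h2 => x h1 h2.
have [Ax|nAx] := pselect (A x); first by rewrite h1// max_l.
by rewrite h2// max_r//; move/negP: nAx; rewrite -ltNge => /ltW.
Qed.

Let mean_rho Y := \int[P]_x (zt x * rho Y x).

Let izrho Y : LH Y -> integrableR (fun x => zt x * rho Y x).
Proof. by move=> LY; exact/zt_int/LGH/rho_LG. Qed.

Let mean_rho_mono X Y : LH X -> LH Y -> (\forall x \ae P, Y x <= X x) -> mean_rho X <= mean_rho Y.
Proof.
move=> LX LY XY; apply: Rintegral_ae_le; [exact: izrho|exact: izrho|].
by apply: filterS (rho_mono LX LY XY) => x h; rewrite ler_wpM2l.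
Qed.

Let mean_rho_trans X f : LH X -> LG f ->
  mean_rho (fun x => X x + f x) = mean_rho X - \int[P]_x (zt x * f x).
Proof.
move=> LX Lf; rewrite -RintegralB//; [|exact: izrho|exact/zt_int/LGH].
have LXf : LH (fun x => X x + f x) by apply: LpGD => //; exact: LGH.
apply: Rintegral_ae_eq; first exact: izrho.
  by apply: integrableRB; [exact: izrho|exact/zt_int/LGH].
by apply: filterS (rho_trans LX Lf) => x ->; ring.
Qed.

Let mean_rho_convex X Y (l : R) : LH X -> LH Y -> 0 <= l <= 1 ->
  mean_rho (fun x => l * X x + (1 - l) * Y x) <= l * mean_rho X + (1 - l) * mean_rho Y.
Proof.
move=> LX LY l01; rewrite -!RintegralZl//; [|exact: izrho|exact: izrho].
have i1 : integrableR (fun x => l * (zt x * rho X x)).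
  exact/integrableRZ/izrho.
have i2 : integrableR (fun x => (1 - l) * (zt x * rho Y x)).
  exact/integrableRZ/izrho.
rewrite -RintegralD//.
have LXY : LH (fun x => l * X x + (1 - l) * Y x).
  by apply: LpGD => //; exact: LpGZ.
apply: Rintegral_ae_le; [exact: izrho|exact: integrableRD|].
apply: filterS (rho_convex LX LY l01) => x h.
have := ler_wpM2l (zt0 x) h.
by rewrite mulrDr !mulrA !(mulrC (zt x)).
Qed.

Let mean_rho_le X : LH X -> mean_rho X <= K * nrm X + (C + c).
Proof.
move=> LX; have Lr : LG (fun x => - rho X x) by exact/LpGN/rho_LG.
have := zt_leG Lr; rewrite -rt_rs//.
rewrite RintegralMN ?opprK; last exact/zt_int/LGH/rho_LG.
by move=> h; apply: le_trans h _; rewrite addrA lerD2r; exact: rt_le.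
Qed.

(* w represents a Hahn-Banach subgradient at X of Y |-> E[zt * rho Y]; locality
   turns optimality of the expected score into pointwise optimality. *)
Theorem exists_optimal_weight X : LH X -> exists w, weight w /\
  forall Y, LH Y -> \forall x \ae P, score w Y x <= score w X x.
Proof.
move=> LX.
have L0 : LH (0 : U -> R^o) by exact: LpG_cst.
have LDZ (a : R) (v w : U -> R^o) : LH v -> LH w -> LH (a *: v + w).
  by move=> Lv Lw; apply: LpGD => //; exact: LpGZ.
(* The increment at X: a linear functional below q is a subgradient of [mean_rho] at X. *)
pose q (Y : U -> R^o) := mean_rho (fun x => X x + Y x) - mean_rho X.
have q0 : 0 <= q 0.
  rewrite /q (_ : (fun x => _) = X) ?subrr//.
  by apply/funext => x /=; rewrite addr0.
have LXD Y : LH Y -> LH (fun x => X x + Y x) by exact: LpGD.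
have q_convex (v w : U -> R^o) (l : R) : LH v -> LH w -> 0 <= l <= 1 ->
    q (l *: v + (1 - l) *: w) <= l * q v + (1 - l) * q w.
  move=> Lv Lw l01; rewrite /q.
  rewrite (_ : (fun x => _) = fun x => l * (X x + v x) + (1 - l) * (X x + w x)); last first.
    by apply/funext => x /=; rewrite -[(_ + _) x]/(l * v x + (1 - l) * w x); ring.
  have := mean_rho_convex (LXD _ Lv) (LXD _ Lw) l01; lra.
have [f [f_lin f_q]] := @hahn_banach_convex R (U -> R^o) LH q L0 LDZ q0 q_convex.
have f0 : f 0 = 0 by have := f_lin (-1) 0 0 L0 L0; rewrite scaler0 addr0; lra.
have fN Y : LH Y -> f (fun x => - Y x) = - f Y.
  move=> LY; have := f_lin (-1) Y 0 LY L0; rewrite f0.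
  rewrite (_ : _ + 0 = fun x => - Y x); first lra.
  by apply/funext => x /=; rewrite addr0 scaleN1r.
(* As [rho] is decreasing, so is the subgradient; the sign is reversed to get a positive
   functional. *)
pose phi (Y : U -> R) := f (fun x => - Y x).
have phi_lin a Y Z : LH Y -> LH Z ->
    phi (fun x => a * Y x + Z x) = a * phi Y + phi Z.
  move=> LY LZ; rewrite /phi -f_lin; [|exact: LpGN|exact: LpGN].
  by congr f; apply/funext => x; rewrite -[RHS]/(a * - Y x + - Z x); ring.
have phi_ge0 Y : LH Y -> (forall x, 0 <= Y x) -> 0 <= phi Y.
  move=> LY Y0; rewrite /phi fN// oppr_ge0.
  apply: le_trans (f_q _ LY) _; rewrite /q subr_le0.
  by apply: mean_rho_mono => //; [exact: LXD|apply: aeW => x; rewrite lerDl].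
have phi_q Y : LH Y -> phi Y <= mean_rho (fun x => X x - Y x) - mean_rho X.
  by move=> LY; apply: (f_q (fun x => - Y x)); exact: LpGN.
(* On l Y the growth bound leaves the slope K and constants depending on X, which large l
   removes. *)
have phi_le Y : LH Y -> phi Y <= K * nrm Y.
  move=> LY; apply: (ler_of_scaled (c := K * nrm X + (C + c) - mean_rho X)) => l l0.
  have LlY : LH (fun x => l * Y x) by exact: LpGZ.
  have -> : l * phi Y = phi (fun x => l * Y x).
    have := f_lin l (fun x => - Y x) 0 (LpGN p1 LY) L0; rewrite f0 => E.
    rewrite /phi -[LHS]addr0 -E; congr f; apply/funext => x.
    by rewrite -[LHS]/(l * - Y x + 0); ring.
  have h1 := phi_q _ LlY.
  have LXl : LH (fun x => X x - l * Y x) by exact: LpGB.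
  have h2 := mean_rho_le LXl.
  have LN : LH (fun x => (- l) * Y x) by exact: LpGZ.
  have := @nrmD _ _ _ P p p1 X (fun x => (- l) * Y x) LX.2 LN.2.
  rewrite (@nrmZ _ _ _ P p p1 _ _ LY.2) normrN (gtr0_norm l0).
  rewrite (_ : (fun x => X x + _) = fun x => X x - l * Y x); last first.
    by apply/funext => x; rewrite mulNr.
  move=> h3.
  have := ler_wpM2l K_ge0 h3; rewrite mulrDr; lra.
have [w [mw w0 wP]] := riesz_representation p1 sH HM phi_lin phi_ge0 phi_le.
have wI Y : LH Y -> phi Y = \int[P]_x (w x * Y x).
  by move=> LY; have [iY E] := wP _ LY; apply: EFin_inj; rewrite EFin_Rintegral// E.
have wi Y : LH Y -> integrableR (fun x => w x * Y x) by move=> /wP[].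
(* By translation invariance q is linear on G-measurable positions, so the subgradient is determined
   there; this gives w the conditional expectation of [zt]. *)
have phi_f g : LG g -> phi g = \int[P]_x (zt x * g x).
  move=> Lg; have Lg' := LGH Lg.
  have h1 := phi_q _ Lg'.
  have h2 := f_q _ Lg'.
  have LNg : LG (fun x => - g x) by exact: LpGN.
  rewrite /q mean_rho_trans// in h2.
  rewrite (mean_rho_trans LX LNg) in h1.
  rewrite RintegralMN in h1; last exact: zt_int.
  move: h1 h2; rewrite /phi fN// => h1 h2; lra.
have ww : weight w.
  split => // A GA.
  have LA : LG (\1_A) by exact: LpG_indicator.
  have := phi_f _ LA; rewrite wI; last exact: LGH.
  move=> E1; have := congr1 EFin E1; rewrite !EFin_Rintegral; [|exact/zt_int/LGH|exact/wi/LGH].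
  have e u : (\int[P]_x (u x * \1_A x)%:E = \int[P]_(x in A) (u x)%:E)%E.
    rewrite [RHS]integral_mkcond; apply: eq_integral => x _.
    by rewrite epatch_indic EFinM.
  by rewrite !e.
exists w; split => // Y LY.
(* Y'' attains the larger of the scores at Y and X, but its mean score cannot exceed that of X;
   hence the larger score is a.e. the one at X. *)
have [Y'' LY'' Y''E] := score_max ww LY LX.
have iX := integrable_score ww LX.
have iY := integrable_score ww LY.
have iY'' := integrable_score ww LY''.
have opt : (\int[P]_x loss w Y'' x) <= \int[P]_x loss w X x.
  have LYX : LH (fun x => Y'' x - X x) by exact: LpGB.
  have := f_q _ LYX; rewrite /q.
  rewrite (_ : (fun x => X x + _) = Y''); last by apply/funext => x; rewrite addrC subrK.
  have -> : f (fun x => Y'' x - X x) = - phi Y'' + phi X.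
    have := phi_lin (-1) _ _ LY'' LX; rewrite mulN1r => <-.
    by rewrite /phi; congr f; apply/funext => x; ring.
  have E Z : LH Z -> (\int[P]_x loss w Z x) = - phi Z - mean_rho Z.
    move=> LZ; rewrite wI// /mean_rho -opprD -RintegralD//; [|exact: wi|exact: izrho].
    rewrite -mulN1r -RintegralZl//; last by apply: integrableRD; [exact: wi|exact: izrho].
    by apply: eq_Rintegral => x _; rewrite /loss; ring.
  rewrite !E//; lra.
have ge0 : \forall x \ae P, 0 <= score w Y'' x - score w X x.
  by apply: filterS Y''E => x ->; rewrite subr_ge0 le_max lexx orbT.
have le0 : (\int[P]_x (score w Y'' x - score w X x)) <= 0.
  by rewrite RintegralB// subr_le0 !Rintegral_score.
have := Rintegral_le0_ae_eq0 (integrableRB iY'' iX) ge0 le0.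
apply: filterS2 Y''E => x -> /eqP; rewrite subr_eq0 => /eqP <-.
by rewrite le_max lexx.
Qed.

Local Notation N := (cexp_ge0 P G).
Local Notation cond_density := (cond_density P G H).
Local Notation penalty_le := (penalty_le P p G H rho).
Local Notation wcexp := (wcexp P G).

Let ztE : U -> \bar R := EFin \o zt.
Let mf x := fine (N ztE x).

Let zt_i : integrableR zt.
Proof.
have := zt_int (LpG_cst P p H 1).
by rewrite (_ : (fun x => _) = zt)//; apply/funext => x; rewrite mulr1.
Qed.

Let mztE : measurable_fun setT ztE.
Proof. exact: measurable_int zt_i. Qed.

Let ztE0 x : (0 <= ztE x)%E. Proof. by rewrite lee_fin. Qed.

Let N_fin : \forall x \ae P, N ztE x \is a fin_num.
Proof. exact: cexp_ge0_fin_num. Qed.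

Let mf_ge0 x : 0 <= mf x.
Proof. by rewrite fine_ge0// cexp_ge0_ge0. Qed.

Let mmf : measurable_wrt G mf.
Proof. by apply: mw_fine; exact: measurable_cexp_ge0. Qed.

(** On the G-event where E(zt | G) vanishes, [zt] has integral 0; as [zt] is positive a.e., the
    event is null. *)
Let mf_gt0 : \forall x \ae P, 0 < mf x.
Proof.
pose A := [set x | N ztE x = 0%E].
have GA : G A.
  have mN := @measurable_cexp_ge0 _ _ _ P G ztE.
  rewrite -(measurable_gE sG) -[X in measurable X]setTI.
  exact: (mN measurableT [set 0%E] (emeasurable_set1 _)).
have mA := GM GA.
have : (\int[P]_(x in A) `|ztE x| = 0)%E.
  under eq_integral do rewrite gee0_abs//.
  have [_ _ E] := cexp_ge0P P sG GM mztE ztE0.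
  by rewrite -E//; apply: integral0_eq => x; exact.
move/(ae_eq_integral_abs _ mA) => /(_ (measurable_funTS mztE)) h.
apply: filterS3 h zt_gt0 N_fin => x h z0 fN.
rewrite lt_def mf_ge0 andbT; apply/eqP => m0.
have [] : ztE x = 0%E by apply: h; rewrite /A /= -(fineK fN) -/(mf x) m0.
by move=> zx; move: z0; rewrite zx ltxx.
Qed.

Definition normalize w : U -> R := fun x => w x * (mf x)^-1.

Let mimf : measurable_wrt G (fun x => (mf x)^-1).
Proof. exact: mw_inv. Qed.

Lemma cond_density_normalize w : weight w -> cond_density (normalize w).
Proof.
move=> [mw w0 wi wE].
have mw' := measurable_wrt_fun sH HM mw.
have iw : integrableR w.
  have := wi _ (LpG_cst P p H 1).
  by rewrite (_ : (fun x => _) = w)//; apply/funext => x; rewrite mulr1.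
split.
- by apply: mwM => //; exact: mw_sub GH mimf.
- by move=> x; rewrite mulr_ge0// invr_ge0.
- move=> A GA; have mA := GM GA.
  pose phi : U -> \bar R := EFin \o (fun x => \1_A x * (mf x)^-1).
  have mphi : measurable_wrt G phi.
    by apply/mw_EFin; apply: mwM => //; exact: measurable_wrt_indic.
  have phi0 x : (0 <= phi x)%E by rewrite lee_fin mulr_ge0// invr_ge0.
  transitivity (\int[P]_x (phi x * (EFin \o w) x))%E.
    rewrite integral_mkcond; apply: eq_integral => x _.
    rewrite /patch /phi /= indicE -EFinM /normalize.
    by case: (x \in A); rewrite ?mul1r ?mul0r// mulrC.
  rewrite (@integralM_eq _ _ _ P G sG GM _ ztE)//.
  + rewrite -(integral_mul_cexp_ge0 P sG GM mztE ztE0 mphi phi0).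
    rewrite (@ae_eq_integral _ _ _ P setT (fun x => (\1_A x)%:E))//.
    * by rewrite integral_indic// setIT.
    * apply: emeasurable_funM; first exact: measurable_wrt_fun mphi.
      by apply: (measurable_wrt_fun sG GM); exact: measurable_cexp_ge0.
    * by apply/measurable_EFinP; exact: measurable_indic.
    * apply: filterS2 mf_gt0 N_fin => x m0 fN _.
      rewrite -(fineK fN) -/(mf x) /phi /= -EFinM; congr EFin.
      by rewrite mulfVK// lt0r_neq0.
  exact/measurable_EFinP.
Qed.

Let imf : U -> R := fun x => (mf x)^-1.

(** [rho Y] is G-measurable, so E(zt rho(Y) | G) = E(zt | G) rho(Y), and division by E(zt | G) turns
    the score into the penalty expression. *)
Lemma wcexp_normalize w Y : weight w -> LH Y ->
  \forall x \ae P, (wcexp (normalize w) (fun v => - Y v)%R x - (rho Y x)%:E =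
    (score w Y x * (mf x)^-1)%R%:E)%E.
Proof.
move=> ww LY; have [mw w0 wi _] := ww.
have LNY : LH (fun x => - Y x) by exact: LpGN.
have LNr : LH (fun x => - rho Y x) by exact/LGH/LpGN/rho_LG.
have iwY := wi _ LNY.
have mwY := integrable_measurable iwY.
have hp : wpos (normalize w) (fun x => - Y x) =
    ((EFin \o imf) \* pos_part (fun x => (w x * - Y x)%R))%E.
  apply/funext => x; rewrite /wpos /pos_part /normalize /imf /= -!EFinM; congr EFin.
  have -> : Num.max (w x * - Y x) 0 = w x * Num.max (- Y x) 0.
    by rewrite maxr_pMr// mulr0.
  by ring.
have hn : wneg (normalize w) (fun x => - Y x) =
    ((EFin \o imf) \* neg_part (fun x => (w x * - Y x)%R))%E.
  apply/funext => x; rewrite /wneg /neg_part /normalize /imf /= -!EFinM; congr EFin.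
  have -> : Num.max (- (w x * - Y x)) 0 = w x * Num.max (- - Y x) 0.
    by rewrite maxr_pMr// mulr0 -mulrN.
  by ring.
have mi : measurable_wrt G (EFin \o imf) by exact/mw_EFin.
have i0 x : (0 <= (EFin \o imf) x)%E by rewrite lee_fin invr_ge0.
have h1 := cexp_ge0M P sG GM (measurable_pos_part mwY) (pos_part_ge0 _) mi i0.
have h2 := cexp_ge0M P sG GM (measurable_neg_part mwY) (neg_part_ge0 _) mi i0.
have h12 : \forall x \ae P, (wcexp (normalize w) (fun v => - Y v)%R x =
    ((mf x)^-1 * rcexp P G (fun x => w x * - Y x)%R x)%R%:E)%E.
  have f1 := cexp_ge0_fin_num sG GM (integrable_pos_part iwY) (pos_part_ge0 _).
  have f2 := cexp_ge0_fin_num sG GM (integrable_neg_part iwY) (neg_part_ge0 _).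
  have f12 : \forall x \ae P, N (pos_part (fun x => w x * - Y x)) x \is a fin_num /\
      N (neg_part (fun x => w x * - Y x)) x \is a fin_num by exact: filterI.
  apply: filterS3 h1 h2 f12 => x e1 e2 [e3 e4].
  rewrite /wcexp hp hn e1 e2 /rcexp /imf -(fineK e3) -(fineK e4) /= -!EFinM -EFinB.
  by rewrite mulrBr.
have iwr : integrableR (fun x => zt x * - rho Y x) by exact: zt_int.
have h3 := rcexpD sG GM iwY iwr.
have mr : measurable_wrt G (fun x => - rho Y x) by apply: mwN; have [] := rho_LG LY.
have mzt' := measurable_wrt_fun sH HM mzt.
have h4 := rcexpM sG GM mzt' zt0 mr zt_i.
have h34 : \forall x \ae P, score w Y x = rcexp P G (fun x => w x * - Y x) x
    - mf x * rho Y x.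
  by apply: filterS2 h3 h4 => x e3 e4; rewrite /score /loss e3 e4 mulrN.
apply: filterS3 h12 h34 mf_gt0 => x -> -> m0.
rewrite -EFinB; congr EFin; field; exact: lt0r_neq0.
Qed.

Lemma penalty_le_normalize w X : weight w -> LH X ->
  (forall Y, LH Y -> \forall x \ae P, score w Y x <= score w X x) ->
  penalty_le (normalize w) (fun x => score w X x * (mf x)^-1).
Proof.
move=> ww LX opt Y LY.
apply: filterS2 (wcexp_normalize ww LY) (opt _ LY) => x -> h.
by rewrite lee_fin ler_wpM2r// invr_ge0.
Qed.

(** The position Y + rho(Y) has risk 0 given G, so [rt] takes the value rs 0 at it; the penalty
    bound for [zt] at this position is uniform in Y. *)
Let rs_le0 Y : LH Y -> (\int[P]_x score zt Y x) <= rs (cst 0) + c.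
Proof.
move=> LY; rewrite (Rintegral_score zt_weight LY).
have Lr := rho_LG LY.
have LYr : LH (fun x => Y x + rho Y x) by apply: LpGD => //; exact: LGH.
rewrite (_ : (\int[P]_x loss zt Y x) = - \int[P]_x (zt x * (Y x + rho Y x))); last first.
  rewrite -mulN1r -RintegralZl//; last exact: zt_int.
  by apply: eq_Rintegral => x _; rewrite /loss; ring.
apply: le_trans (zt_leH LYr) _; rewrite lerD2r rt_rs//.
apply: rs_mono; [exact/LpGN/rho_LG|exact: LpG_cst|].
by apply: filterS (rho_trans LY Lr) => x ->; rewrite subrr oppr0.
Qed.

(** By pasting, running maxima of scores are scores, so their means have a common bound; by monotone
    convergence the limit is integrable once the first score is subtracted. *)
Let score_seq_bounded (Y_ : nat -> U -> R) : (forall n, LH (Y_ n)) ->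
  \forall x \ae P, exists B, forall n, score zt (Y_ n) x <= B.
Proof.
move=> LY.
pose M := fix M n : U -> R := fun x => if n is k.+1 then
  Num.max (M k x) (score zt (Y_ n) x) else score zt (Y_ 0%N) x.
have MW n : exists2 W, LH W & \forall x \ae P, score zt W x = M n x.
  elim: n => [|n [W LW WE]]; first by exists (Y_ 0%N) => //; exact: aeW.
  have [W' LW' W'E] := score_max zt_weight LW (LY n.+1).
  by exists W' => //; apply: filterS2 WE W'E => x /= <-.
have mM n : measurable_wrt G (M n).
  elim: n => [|n IH]; first exact: measurable_rcexp.
  by apply: mw_max => //; exact: measurable_rcexp.
have M_nd x a b : (a <= b)%N -> M a x <= M b x.
  apply: (@homo_leq _ (fun n => M n x) <=%R) => //.
    by move=> ? ? ?; exact: le_trans.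
  by move=> n /=; rewrite le_max lexx.
have M_ge n x : score zt (Y_ n) x <= M n x.
  by case: n => [|n] //=; rewrite le_max lexx orbT.
pose D n x := (M n x - M 0%N x)%:E.
have i0 := integrable_score zt_weight (LY 0%N).
have mD n : measurable_fun setT (D n).
  by apply/measurable_EFinP; apply: (measurable_wrt_fun sG GM); exact: mwB.
have D0 n x : (0 <= D n x)%E by rewrite lee_fin subr_ge0 M_nd.
pose B := rs (cst 0) + c - \int[P]_x score zt (Y_ 0%N) x.
have ID n : (\int[P]_x D n x <= B%:E)%E.
  have [W LW WE] := MW n.
  have iW := integrable_score zt_weight LW.
  rewrite (@ae_eq_integral _ _ _ P setT
      (fun x => (score zt W x - score zt (Y_ 0%N) x)%:E))//.
  - rewrite -EFin_Rintegral; last exact: integrableRB.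
    by rewrite RintegralB// lee_fin lerD2r rs_le0.
  - exact: measurable_int (integrableRB iW i0).
  - by apply: filterS WE => x ->.
have nd x a b : (a <= b)%N -> (D a x <= D b x)%E.
  by move=> ab; rewrite lee_fin lerD2r M_nd.
have lim_le : (\int[P]_x limn (D ^~ x) <= B%:E)%E.
  rewrite monotone_convergence//.
    apply: lime_le; last by apply: nearW => n; exact: ID.
    apply: ereal_nondecreasing_is_cvgn => a b ab; apply: ge0_le_integral => //.
    by move=> x _; exact: nd.
  by move=> x _ a b; exact: nd.
have cD x : cvgn (D ^~ x).
  apply: ereal_nondecreasing_is_cvgn => a b ab.
  by rewrite lee_fin lerD2r M_nd.
have lim_ge n x : (D n x <= limn (D ^~ x))%E.
  apply: lime_ge => //; exists n => // k /= nk.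
  by rewrite lee_fin lerD2r M_nd.
have il : P.-integrable setT (fun x => limn (D ^~ x)).
  apply/integrableP; split.
    by apply: (@emeasurable_fun_cvg _ _ _ setT D) => // x _; exact: cD.
  under eq_integral do rewrite gee0_abs ?(le_trans (D0 0%N _) (lim_ge 0%N _))//.
  by rewrite (le_lt_trans lim_le)// ltry.
apply: filterS (integrable_ae measurableT il) => x /(_ I) fl.
exists (fine (limn (D ^~ x)) + M 0%N x) => n.
apply: le_trans (M_ge n x) _; rewrite -lerBlDr -lee_fin fineK//.
exact: lim_ge.
Qed.

(** The essential supremum is attained along a sequence, whose scores are a.e. bounded; only
    finiteness of the penalty is obtained, no integrability. *)
Lemma penalty_le_zt : exists2 a, measurable_wrt G a & penalty_le (normalize zt) a.
Proof.
pose f Y x := (wcexp (normalize zt) (fun v => - Y v)%R x - (rho Y x)%:E)%E.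
pose S := [set f Y | Y in LH].
have S0 : S !=set0 by exists (f (cst 0)), (cst 0) => //; exact: LpG_cst.
have mf_ Y : LH Y -> measurable_wrt G (f Y).
  move=> LY; apply: (@emeasurable_funB _ (g_sigma_algebraType G)).
    by apply: (@emeasurable_funB _ (g_sigma_algebraType G)); exact: measurable_cexp_ge0.
  by apply/mw_EFin; have [] := rho_LG LY.
have mS g : S g -> measurable_wrt G g by move=> [Y LY <-]; exact: mf_.
have [g [Sg [mg gub _]]] := exists_fam_ess_sup P sG GM S0 mS.
have /choice[Y_ YP] n : exists Y, LH Y /\ f Y = g n.
  by have [Y LY E] := Sg n; exists Y.
have LY n : LH (Y_ n) by have [] := YP n.
exists (fine \o seq_sup g); first exact: mw_fine.
have h1 : \forall x \ae P, forall n, g n x = (score zt (Y_ n) x * (mf x)^-1)%:E.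
  apply/ae_foralln => n; have [_ <-] := YP n.
  exact: (wcexp_normalize zt_weight (LY n)).
have h2 : \forall x \ae P, seq_sup g x \is a fin_num.
  apply: filterS2 h1 (score_seq_bounded LY) => x h1 [B hB].
  rewrite fin_numElt; apply/andP; split.
    by rewrite (lt_le_trans _ (le_seq_sup g 0%N x))// h1 ltNyr.
  apply: (@le_lt_trans _ _ (B * (mf x)^-1)%:E); last exact: ltry.
  apply: ge_ereal_sup => _ [n _ <-]; rewrite h1 lee_fin.
  by rewrite ler_wpM2r// invr_ge0.
move=> Y LHY; have Sf : S (f Y) by exists Y.
by apply: filterS2 h2 (gub _ Sf) => x h2; rewrite /= fineK.
Qed.

Let measurable_score w Y : measurable_wrt G (fun x => score w Y x * (mf x)^-1).
Proof. by apply: mwM => //; exact: measurable_rcexp. Qed.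

(** The density optimal at 0 has the penalty bound -rho(0), in L_p, but may vanish; the one from
    [zt] is positive with a merely finite penalty. A mixture has both qualities. *)
Let exists_base_density : exists z a,
  [/\ cond_density z, (\forall x \ae P, 0 < z x), LG a & penalty_le z a].
Proof.
have L0 : LH (cst 0) by exact: LpG_cst.
have [a ma pa] := penalty_le_zt.
have [w [ww wopt]] := exists_optimal_weight L0.
have dt := cond_density_normalize zt_weight.
have dw := cond_density_normalize ww.
have pw := penalty_le_normalize ww L0 wopt.
have awE : \forall x \ae P, score w (cst 0) x * (mf x)^-1 = - rho (cst 0) x.
  have N0 : \forall x \ae P, N (cst 0%E) x = 0%E.
    apply: (@cexp_ge0_unique _ _ _ P G sG GM (cst 0%E)).
      by apply: cexp_ge0P => //; exact: measurable_cst.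
    by split => //; apply/(@mw_EFin _ _ _ _ (cst 0)); exact: mw_cst.
  apply: filterS2 N0 (wcexp_normalize ww L0) => x e1.
  have hp : wpos (normalize w) (fun x => - (cst 0 : U -> R) x) = cst 0%E.
    by apply/funext => y; rewrite /wpos /pos_part /= oppr0 maxxx mule0.
  have hn : wneg (normalize w) (fun x => - (cst 0 : U -> R) x) = cst 0%E.
    by apply/funext => y; rewrite /wneg /neg_part /= !oppr0 maxxx mule0.
  rewrite /wcexp hp hn e1 sube0 add0e => -[] <-.
  by [].
(* This weight gives |L a| <= 1, so the mixed penalty is at most 1 + |rho(0)| in absolute value; L >
   0 keeps the mixture positive. *)
pose L x := (1 + `|a x|)^-1.
have mL : measurable_wrt G L.
  by apply: mw_inv; apply: mwD; [exact: mw_cst|exact: mw_abs].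
have La x : 0 < 1 + `|a x| by rewrite ltr_pwDl.
have L0' x : 0 <= L x by rewrite invr_ge0 ltW.
have L1 x : L x <= 1 by rewrite invf_le1// lerDl.
exists (mix L (normalize zt) (normalize w)).
exists (fun x => L x * a x + (1 - L x) * (score w (cst 0) x * (mf x)^-1)).
split.
- exact: cond_density_mix.
- apply: filterS2 zt_gt0 mf_gt0 => x zx mx.
  rewrite /mix ltr_pwDl//.
    by rewrite !mulr_gt0// invr_gt0.
  have [_ w0 _] := dw.
  by rewrite mulr_ge0// subr_ge0.
- have Lr : LG (fun x => 1 + `|rho (cst 0) x|).
    by apply: LpGD => //; [exact: LpG_cst|apply: LpG_abs => //; exact: rho_LG].
  have [] // := LpG_le p1 sG GM (_ : measurable_wrt G (fun x => L x * a x + (1 - L x) * (score w (cst 0) x * (mf x)^-1))) Lr.2 _.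
  + apply: mwD; apply: mwM => //.
    by apply: mwB => //; exact: mw_cst.
  + apply: filterS awE => x ->.
    rewrite [leRHS]ger0_norm ?addr_ge0//.
    apply: le_trans (ler_normD _ _) _; rewrite lerD//.
      rewrite normrM (ger0_norm (L0' x)) /L mulrC ler_pdivrMr// mul1r.
      by rewrite lerDr.
    by rewrite normrM normrN ler_piMl// ger0_norm ?subr_ge0// gerBl.
- exact: penalty_le_mix.
Qed.

Let absurd_bound (n e u r B : R) : B < n * u - n * r -> - (e - u) <= B ->
  e + (n - 1) * u <= n * r -> False.
Proof. by lra. Qed.

(** The last clause is the least-upper-bound half of an essential supremum. It is stated with the
    bounds [a n], which can only overestimate the penalties. *)
Theorem approximate_dual_representation X : LH X -> exists z a : nat -> U -> R,
  (forall n, [/\ cond_density (z n), (\forall x \ae P, 0 < z n x), LG (a n) & penalty_le (z n) (a n)]) /\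
  forall h : U -> \bar R,
   (forall n, \forall x \ae P,
     (wcexp (z n) (fun v => - X v)%R x - (a n x)%:E <= h x)%E) ->
   \forall x \ae P, ((rho X x)%:E <= h x)%E.
Proof.
move=> LX.
have LNX : LH (fun v => - X v) by exact: LpGN.
have [z0 [a0 [d0 z00 La0 pa0]]] := exists_base_density.
have [w [ww wopt]] := exists_optimal_weight LX.
have dw := cond_density_normalize ww.
have pw := penalty_le_normalize ww LX wopt.
have wE := wcexp_normalize ww LX.
pose aX x := score w X x * (mf x)^-1.
have maX : measurable_wrt G aX by exact: measurable_score.
pose A n := [set x | `|aX x| <= n%:R].
have GA n : G (A n) by apply: mw_ler => //; [exact: mw_abs|exact: mw_cst].
(* The penalty aX of the optimal density need not be in L_p, and that density may
   vanish: mix it with a fixed positive density, with weight 1/(n+1) for the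
   latter where |aX| <= n and weight 1 elsewhere. *)
pose L n x : R := 1 - \1_(A n) x * (1 - n.+1%:R^-1).
have n1 n : 0 < (n.+1%:R : R)^-1 <= 1.
  by rewrite invr_gt0 ltr0n/= invf_le1// ler1n.
have LA n x : A n x -> L n x = n.+1%:R^-1.
  by move=> Ax; rewrite /L indicE mem_set// mul1r; ring.
have LNA n x : ~ A n x -> L n x = 1.
  by move=> Ax; rewrite /L indicE memNset// mul0r subr0.
have mL n : measurable_wrt G (L n).
  apply: mwB; first exact: mw_cst.
  by apply: mwM; [exact: measurable_wrt_indic|exact: mw_cst].
have L_gt0 n x : 0 < L n x.
  have [Ax|Ax] := pselect (A n x); last by rewrite LNA.
  by rewrite LA//; case/andP: (n1 n).
have L_le1 n x : L n x <= 1.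
  have [Ax|Ax] := pselect (A n x); last by rewrite LNA.
  by rewrite LA//; case/andP: (n1 n).
have L_ge0 n x : 0 <= L n x by exact: ltW.
exists (fun n => mix (L n) z0 (normalize w)).
exists (fun n x => L n x * a0 x + (1 - L n x) * aX x).
split=> [n|h hP].
- split.
  + exact: cond_density_mix.
  + apply: filterS z00 => x zx.
    rewrite /mix ltr_pwDl//; first exact: mulr_gt0.
    have [_ w0 _] := dw.
    by rewrite mulr_ge0// subr_ge0.
  + have Lr : LG (fun x => `|a0 x| + n%:R).
      by apply: LpGD => //; [exact: LpG_abs|exact: LpG_cst].
    have mm : measurable_wrt G (fun x => L n x * a0 x + (1 - L n x) * aX x).
      apply: mwD; apply: mwM => //; first by case: La0.
      by apply: mwB => //; exact: mw_cst.
    have [] // := LpG_le p1 sG GM mm Lr.2 _.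
    apply: aeW => x.
    rewrite [leRHS]ger0_norm ?addr_ge0//.
    apply: le_trans (ler_normD _ _) _; rewrite lerD//.
      by rewrite normrM ler_piMl// ger0_norm.
    have [Ax|Ax] := pselect (A n x); last by rewrite LNA// subrr mul0r normr0.
    rewrite normrM (le_trans _ Ax)// ler_piMl//.
    by rewrite ger0_norm ?subr_ge0// gerBl.
  + exact: penalty_le_mix.
- have /ae_foralln hall := hP.
  have mixE : \forall x \ae P, forall n, exists e1 e2 : R,
      [/\ wcexp z0 (fun v => - X v)%R x = e1%:E,
        wcexp (normalize w) (fun v => - X v)%R x = e2%:E &
        wcexp (mix (L n) z0 (normalize w)) (fun v => - X v)%R x =
          (L n x * e1 + (1 - L n x) * e2)%:E].
    by apply/ae_foralln => n; apply: wcexp_mix pa0 pw LNX => //.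
  apply: filterS3 hall mixE wE => x hx mx; rewrite -/(aX x) => ex.
  have [e1 [e2 [E1 E2 _]]] := mx 0%N.
  have aXE : aX x = e2 - rho X x by move: ex; rewrite E2 -EFinB => -[].
  (* On [A n] the mixed value is an average of e1 - a0, from the fixed density, and of e2 - aX = rho
     X, from the optimal one. *)
  have key n : (((n.+1%:R)^-1 * (e1 - a0 x) + (1 - (n.+1%:R)^-1) * rho X x)%R%:E
      <= h x)%E \/ ~ A n x.
    have [Ax|Ax] := pselect (A n x); [left|by right].
    apply: le_trans (hx n).
    have [f1 [f2 [F1 F2 ->]]] := mx n.
    have -> : f1 = e1 by move: F1; rewrite E1 => -[].
    have -> : f2 = e2 by move: F2; rewrite E2 => -[].
    rewrite -EFinB lee_fin (LA n x Ax) aXE le_eqVlt; apply/orP; left.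
    by apply/eqP; ring.
  case: (h x) key => [r| |] key; last 2 first.
  + by rewrite leey.
  + exfalso.
    have Ax : A (Num.truncn `|aX x|).+1 x by apply/ltW/truncnS_gt.
    by have [] := key (Num.truncn `|aX x|).+1.
  rewrite lee_fin leNgt; apply/negP => rr.
  pose B := `|e1 - a0 x - rho X x|.
  (* n exceeds |aX x|, which puts x in [A n], and it exceeds B divided by the gap, which makes the
     cost B/(n+1) of mixing smaller than the gap. *)
  pose n := (Num.truncn (`|aX x| + B / (rho X x - r))).+1.
  have dr : 0 < rho X x - r by rewrite subr_gt0.
  have nB : `|aX x| + B / (rho X x - r) < n%:R by exact: truncnS_gt.
  have B0 : 0 <= B / (rho X x - r) by apply: divr_ge0; [exact: normr_ge0|exact: ltW].
  have Ax : A n x.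
    by rewrite /A /= ltW// (le_lt_trans _ nB)// lerDl.
  have [|//] := key n; rewrite lee_fin => k.
  have n0 : (0 : R) < n.+1%:R by rewrite ltr0n.
  have Bn : B < n.+1%:R * (rho X x - r).
    rewrite -ltr_pdivrMr//; apply: (@lt_trans _ _ n%:R); last by rewrite ltr_nat.
    by rewrite (le_lt_trans _ nB)// lerDr.
  have := ler_wpM2l (ltW n0) k.
  rewrite mulrDr mulrA mulfV ?lt0r_neq0// mul1r mulrA mulrBr mulr1 mulfV ?lt0r_neq0//.
  have := ler_norm (- (e1 - a0 x - rho X x)); rewrite normrN -/B.
  by move=> h1 h2; move: Bn; rewrite mulrBr => h3; exact: absurd_bound h3 h1 h2.
Qed.

End core.

(** * Duality of the L_p norms *)

Section norm_duality.
Context {d} {U : measurableType d} {R : realType}.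
Variables (P : probability U R) (G : set (set U)).
Variables (sG : sigma_algebra setT G) (GM : G `<=` measurable).
Variables (p : R) (p1 : 1 <= p) (h : U -> R) (K : R).
Hypotheses (mh : measurable_wrt G h) (h0 : forall x, 0 <= h x) (K0 : 0 <= K).
Hypothesis hK : forall f, LpG P p G f -> (forall x, 0 <= f x) ->
  (\int[P]_x (h x * f x)%:E <= (K * nrm P p f)%:E)%E.

Let mh' : measurable_fun setT h := measurable_wrt_fun sG GM mh.

Let nrm1 f : p = 1 -> LpG P p G f -> (forall x, 0 <= f x) ->
  (nrm P p f)%:E = (\int[P]_x (f x)%:E)%E.
Proof.
move=> pE [_ Lf] f0.
have powE (x : R) : 0 <= x -> x `^ p = x by rewrite pE; exact: powRr1.
rewrite -[X in X%:E]powE ?nrm_ge0// (nrm_powR p1 Lf).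
by apply: eq_integral => x _; rewrite powE// ger0_norm.
Qed.

(** The test function is the indicator of the event K < h, over which h - K has integral at most
    0. *)
Let dual_ess_sup : p = 1 -> \forall x \ae P, h x <= K.
Proof.
move=> pE; pose A := [set x | K < h x].
have GA : G A by apply: mw_ltr => //; exact: mw_cst.
pose f x : R := \1_A x * 1.
have Lf : LpG P p G f by apply: LpG_indic => //; exact: LpG_cst.
have f0 x : 0 <= f x by rewrite mulr_ge0.
have hf := hK Lf f0.
have mhf : measurable_fun setT (fun x => h x * f x).
  by apply: measurable_funM => //; exact: Lfun_measurable Lf.2.
have ihf : P.-integrable setT (EFin \o (fun x => h x * f x)).
  apply/integrableP; split; first exact/measurable_EFinP.
  under eq_integral do rewrite /= ger0_norm ?mulr_ge0//.
  by rewrite (le_lt_trans hf)// ltry.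
have iKf : P.-integrable setT (EFin \o (fun x => K * f x)).
  exact/integrableRZ/(Lfun_int p1)/Lf.2.
have : \forall x \ae P, h x * f x - K * f x = 0.
  apply: Rintegral_le0_ae_eq0; first exact: integrableRB.
    apply: aeW => x; rewrite -mulrBl /f indicE mulr1.
    have [/set_mem Ax|] := boolP (x \in A); last by rewrite mulr0.
    by rewrite mulr1 subr_ge0 ltW.
  rewrite RintegralB// subr_le0 RintegralZl//; last exact: Lfun_int Lf.2.
  rewrite -lee_fin EFin_Rintegral// (le_trans hf)// lee_fin ler_wpM2l//.
  by rewrite -lee_fin nrm1// EFin_Rintegral//; exact: Lfun_int Lf.2.
apply: filterS => x; rewrite -mulrBl /f indicE mulr1 leNgt => e.
apply/negP => Kh; move: e; rewrite (mem_set (Kh : A x)) mulr1.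
by apply/eqP; rewrite subr_eq0 gt_eqF.
Qed.

(** The extremal function h^(q-1) of the Hoelder inequality is used with min(h, n) in place of h,
    which is bounded and so gives a test function in L_p; then n tends to infinity. *)
Let dual_integral : 1 < p ->
  (\int[P]_x (h x `^ (p / (p - 1)))%:E <= (K `^ (p / (p - 1)))%:E)%E.
Proof.
move=> pgt1; set q := p / (p - 1).
have p0 : 0 < p by exact: lt_trans pgt1.
have p10 : 0 < p - 1 by rewrite subr_gt0.
have q0 : 0 < q by rewrite divr_gt0.
have q_ge0 : 0 <= q by exact: ltW.
have q1 : 0 <= q - 1 by rewrite subr_ge0 ler_pdivlMr// mul1r lerBlDr lerDl.
have qp : (q - 1) * p = q by rewrite /q; field; exact: lt0r_neq0.
pose hn n x := Num.min (h x) n%:R.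
have hn0 n x : 0 <= hn n x by rewrite le_min h0/=.
have mhn n : measurable_wrt G (hn n) by apply: mw_min => //; exact: mw_cst.
have main n : (\int[P]_x (hn n x `^ q)%:E <= (K `^ q)%:E)%E.
  pose f x := hn n x `^ (q - 1).
  have Lf : LpG P p G f.
    apply: (@LpG_bounded _ _ _ P p p1 G sG GM _ (n%:R `^ (q - 1))).
      by apply: (mw_comp (phi := fun x => x `^ (q - 1))) => //; exact: measurable_powR.
    move=> x; rewrite ger0_norm ?powR_ge0//; apply: ge0_ler_powR; rewrite ?nnegrE//.
    by rewrite /hn ge_min lexx orbT.
  have f0 x : 0 <= f x by exact: powR_ge0.
  have fE : ((nrm P p f) `^ p)%:E = (\int[P]_x (hn n x `^ q)%:E)%E.
    rewrite (nrm_powR p1 Lf.2); apply: eq_integral => x _.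
    by rewrite ger0_norm// -powRrM qp.
  have le1 : (nrm P p f) `^ p <= K * nrm P p f.
    rewrite -lee_fin fE; apply: le_trans (hK Lf f0).
    have mE (w : U -> R) : measurable_wrt G w -> measurable_fun setT (fun x => (w x)%:E).
      by move=> mw; apply/measurable_EFinP; exact: measurable_wrt_fun mw.
    apply: ge0_le_integral => //.
    - by move=> x _; rewrite lee_fin powR_ge0.
    - by apply: mE; apply: (mw_comp (phi := fun x => x `^ q)) => //; exact: measurable_powR.
    - by apply: mE; apply: mwM => //; exact: Lf.1.
    - move=> x _; rewrite lee_fin -(mulr_powRB1 (hn0 n x) q0) ler_wpM2r ?powR_ge0//.
      by rewrite /hn ge_min lexx.
  rewrite -fE lee_fin.
  have [N0|N0] := eqVneq (nrm P p f) 0.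
    by rewrite N0 powR0 ?powR_ge0// lt0r_neq0.
  have Ngt0 : 0 < nrm P p f by rewrite lt_def N0 nrm_ge0.
  (* (nrm f)^p <= K nrm f is divided by nrm f; since p = (p-1) q, raising to the power q gives the
     claim. *)
  have le2 : nrm P p f `^ (p - 1) <= K.
    by rewrite -(ler_pM2l Ngt0) mulr_powRB1 ?nrm_ge0// mulrC.
  rewrite (_ : nrm P p f `^ p = (nrm P p f `^ (p - 1)) `^ q).
    by apply: ge0_ler_powR => //; rewrite nnegrE powR_ge0.
  by rewrite -powRrM; congr powR; rewrite /q; field; exact: lt0r_neq0.
have mhnq n : measurable_fun setT (fun x => (hn n x `^ q)%:E).
  apply/measurable_EFinP; apply: (measurable_wrt_fun sG GM).
  by apply: (mw_comp (phi := fun x => x `^ q)) => //; exact: measurable_powR.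
have cv x : ((hn n x `^ q)%:E @[n --> \oo] --> (h x `^ q)%:E)%E.
  apply: cvg_near_cst.
  near=> n; congr (_ `^ _)%:E; apply/min_idPl.
  by near: n; exact: nbhs_infty_ger.
have -> : (\int[P]_x (h x `^ q)%:E = \int[P]_x limn (fun n => (hn n x `^ q)%:E))%E.
  by apply: eq_integral => x _; apply/esym/cvg_lim => //; exact: cv.
rewrite monotone_convergence//; last 2 first.
- by move=> n x _; rewrite lee_fin powR_ge0.
- move=> x _ m n mn; rewrite lee_fin; apply: ge0_ler_powR; rewrite ?nnegrE//.
  by rewrite /hn le_min ge_min lexx/= ge_min ler_nat mn orbT.
apply: lime_le; last exact: nearW.
apply: ereal_nondecreasing_is_cvgn => m n mn; apply: ge0_le_integral => //.
- by move=> x _; rewrite lee_fin powR_ge0.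
- move=> x _; rewrite lee_fin; apply: ge0_ler_powR; rewrite ?nnegrE//.
  by rewrite /hn le_min ge_min lexx/= ge_min ler_nat mn orbT.
Unshelve. all: by end_near. Qed.

Lemma norm_duality : h \in Lfun P (hoelder_conjugate p%:E) /\
  ('N[P]_(hoelder_conjugate p%:E)[EFin \o h] <= K%:E)%E.
Proof.
suff N : ('N[P]_(hoelder_conjugate p%:E)[EFin \o h] <= K%:E)%E.
  split => //; apply/andP; split; rewrite inE//=.
  by rewrite /finite_norm (le_lt_trans N)// ltry.
move: p1; rewrite le_eqVlt => /predU1P[pE|pgt1].
  rewrite -pE hoelder_conjugate1 unlock /= probability_setT lte01.
  apply/ess_sup_inf.ess_supP; apply: filterS (dual_ess_sup (esym pE)) => x hx /=.
  by rewrite ger0_norm// lee_fin.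
have p0 : 0 < p by exact: lt_trans pgt1.
have p10 : 0 < p - 1 by rewrite subr_gt0.
have q0 : 0 < p / (p - 1) by rewrite divr_gt0.
rewrite /hoelder_conjugate /= eqe gt_eqF// inver subr_eq0 gt_eqF//.
rewrite unlock /=.
under eq_integral do rewrite /= ger0_norm//.
have := dual_integral pgt1; set q := p / (p - 1).
set I := (\int[P]_x _)%E => Iq.
have I0 : (0 <= I)%E by apply: integral_ge0 => x _; rewrite lee_fin powR_ge0.
apply: (@le_trans _ _ ((K `^ q)%:E `^ q^-1)%E).
  apply: gt0_ler_poweR => //; rewrite ?invr_ge0 ?ltW//.
  - by rewrite in_itv/= I0 leey.
  - by rewrite in_itv/= lee_fin powR_ge0 leey.
by rewrite poweR_EFin -powRrM mulfV ?powRr1// lt0r_neq0.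
Qed.

End norm_duality.

(** * Probabilities with a density *)

Section probability_density.
Context {d} {U : measurableType d} {R : realType}.
Variables (P : probability U R) (H : set (set U)).
Variables (sH : sigma_algebra setT H) (HM : H `<=` measurable).
Implicit Types (z : U -> R).

Definition has_density (Q : probability (g_sigma_algebraType H) R) z :=
  [/\ measurable_wrt H z, (forall x, 0 <= z x) &
      forall A, H A -> Q A = (\int[P]_(x in A) (z x)%:E)%E].

(** Q gives the event z = 0 mass 0, so by equivalence it is P-null, whence positivity. *)
Lemma exists_prob_density (Q : probability (g_sigma_algebraType H) R) :
  (forall A, H A -> (Q A = 0%E <-> P A = 0%E)) ->
  exists2 z, has_density Q z & \forall x \ae P, 0 < z x.
Proof.
move=> QP.
have Qfin : (Q setT < +oo)%E by rewrite (le_lt_trans (probability_le1 _ _))// ltry.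
have Qac A : H A -> P A = 0%E -> Q A = 0%E by move=> HA; apply (QP A HA).2.
have [z [mz z0 zE]] := exists_density sH HM Qfin Qac.
exists z => //.
pose A := [set x | z x = 0].
have HA : H A.
  rewrite -(measurable_gE sH) -[X in measurable X]setTI.
  exact: (mz measurableT [set 0] (measurable_set1 _)).
have PA : P A = 0%E.
  apply: (QP A HA).1; rewrite zE//; apply: integral0_eq => x Ax.
  by rewrite (Ax : z x = 0).
exists A; split => //; first exact: HM.
move=> x /= h; rewrite /A /=; apply/eqP; apply: contra_notT h => zx.
by rewrite lt_def zx z0.
Qed.

Lemma exists_prob_of_density z : measurable_fun setT z -> (forall x, 0 <= z x) ->
  (\int[P]_x (z x)%:E = 1)%E ->
  exists Q : probability (g_sigma_algebraType H) R,
    forall A, H A -> Q A = (\int[P]_(x in A) (z x)%:E)%E.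
Proof.
move=> mz z0 z1.
have mz' : measurable_fun setT (EFin \o z) by exact/measurable_EFinP.
have [nu nuE] := exists_density_measure sH HM P mz' (fun x => z0 x).
have nuT : nu setT = 1%E by rewrite nuE.
have [Q QE] := exists_probability nuT.
by exists Q => A HA; rewrite QE nuE.
Qed.

Lemma integral_prob_density (Q : probability (g_sigma_algebraType H) R) z
    (phi : U -> \bar R) : has_density Q z ->
  measurable_wrt H phi -> (forall x, (0 <= phi x)%E) ->
  (\int[Q]_x phi x = \int[P]_x (phi x * (z x)%:E))%E.
Proof.
move=> [mz z0 QE] mphi phi0.
have mz' : measurable_fun setT (EFin \o z).
  by apply/measurable_EFinP; exact: measurable_wrt_fun mz.
exact: (integral_density sH HM mz' (fun x => z0 x) QE mphi phi0).
Qed.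

Lemma integral_in_prob_density (Q : probability (g_sigma_algebraType H) R) z
    (phi : U -> \bar R) A : has_density Q z ->
  measurable_wrt H phi -> (forall x, (0 <= phi x)%E) -> H A ->
  (\int[Q]_(x in A) phi x = \int[P]_(x in A) (phi x * (z x)%:E))%E.
Proof.
move=> [mz z0 QE] mphi phi0 HA.
have mz' : measurable_fun setT (EFin \o z).
  by apply/measurable_EFinP; exact: measurable_wrt_fun mz.
exact: (integral_density_in sH HM mz' (fun x => z0 x) QE mphi phi0 HA).
Qed.

Lemma integral_prob_density_ae (Q : probability (g_sigma_algebraType H) R) z
    (g : U -> \bar R) (f : U -> R) : has_density Q z ->
  measurable_wrt H g -> measurable_fun setT f ->
  (\forall x \ae P, g x = (f x)%:E) ->
  P.-integrable setT (EFin \o (fun x => z x * f x)) ->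
  (\int[Q]_x g x = \int[P]_x (z x * f x)%:E)%E.
Proof.
move=> Qz mg mf gf izf; have [mz z0 QE] := Qz.
have mz' := measurable_wrt_fun sH HM mz.
have mg' := measurable_wrt_fun sH HM mg.
have mgp : measurable_wrt H (g^\+)%E.
  exact: (@measurable_funepos _ (g_sigma_algebraType H)).
have mgn : measurable_wrt H (g^\-)%E.
  exact: (@measurable_funeneg _ (g_sigma_algebraType H)).
rewrite integralE [RHS]integralE.
have zE x : (0 <= (z x)%:E)%E by rewrite lee_fin.
congr (_ - _)%E.
- rewrite (integral_prob_density Qz)//.
  apply: ae_eq_integral => //.
  + apply: emeasurable_funM; first exact: measurable_funepos.
    exact/measurable_EFinP.
  + exact/measurable_funepos/measurable_int/izf.
  + apply: filterS gf => x gx _; rewrite !funeposE gx -!EFin_max -EFinM; congr EFin.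
    by rewrite mulrC maxr_pMr// mulr0.
- rewrite (integral_prob_density Qz)//.
  apply: ae_eq_integral => //.
  + apply: emeasurable_funM; first exact: measurable_funeneg.
    exact/measurable_EFinP.
  + exact/measurable_funeneg/measurable_int/izf.
  + apply: filterS gf => x gx _; rewrite !funenegE gx -!EFinN -!EFin_max -EFinM; congr EFin.
    by rewrite mulrC maxr_pMr// mulr0 mulrN.
Qed.

Variables (G : set (set U)).
Variables (sG : sigma_algebra setT G) (GM : G `<=` measurable) (GH : G `<=` H).

(** Q and P agree on G, so a G-measurable g has the same integrals under both; E_Q(u | G) and E_P(z
    u | G) obey the same equations, with no normalizing denominator. *)
Lemma is_ge0_cexp_density (Q : probability (g_sigma_algebraType H) R) z
    (u g : U -> \bar R) : has_density Q z -> (forall A, G A -> Q A = P A) ->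
  measurable_wrt H u -> (forall x, (0 <= u x)%E) ->
  is_ge0_cexp Q G u g <-> is_ge0_cexp P G (fun x => (z x)%:E * u x)%E g.
Proof.
move=> Qz QG mu u0; have [mz z0 QE] := Qz.
have mz' : measurable_fun setT (EFin \o z).
  by apply/measurable_EFinP; exact: measurable_wrt_fun mz.
have uE A : G A -> (\int[Q]_(x in A) u x = \int[P]_(x in A) ((z x)%:E * u x))%E.
  move=> GA; rewrite (integral_in_prob_density Qz)//; last exact: GH.
  by apply: eq_integral => x _; rewrite muleC.
have gE A : G A -> measurable_wrt G g -> (forall x, (0 <= g x)%E) ->
    (\int[Q]_(x in A) g x = \int[P]_(x in A) g x)%E.
  move=> GA mg g0.
  rewrite (integral_in_prob_density Qz)//; [|exact: mw_sub GH mg|exact: GH].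
  have mgA : measurable_wrt G (g \_ A) by exact: measurable_wrt_patch.
  have gA0 x : (0 <= (g \_ A) x)%E by rewrite /patch; case: ifP.
  rewrite integral_mkcond [RHS]integral_mkcond.
  transitivity (\int[P]_x ((g \_ A) x * (EFin \o z) x))%E.
    by apply: eq_integral => x _; rewrite /patch; case: ifP => //; rewrite mul0e.
  rewrite (@integralM_eq _ _ _ P G sG GM _ (cst 1%E))//.
  - by apply: eq_integral => x _; rewrite mule1.
  - move=> B GB; rewrite integral_cst ?mul1e; last exact: GM.
    exact: etrans (esym (QE B (GH GB))) (QG B GB).
split=> -[mg g0 h]; split => //.
- by move=> A GA; rewrite -uE// -gE// h.
- by move=> A GA; rewrite uE// gE// h.
Qed.

Lemma ge0_cexp_density (Q : probability (g_sigma_algebraType H) R) z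
    (u : U -> \bar R) : has_density Q z -> (forall A, G A -> Q A = P A) ->
  measurable_wrt H u -> (forall x, (0 <= u x)%E) ->
  {ae P, forall x : U, ge0_cexp Q G u x = cexp_ge0 P G (fun x => (z x)%:E * u x)%E x}.
Proof.
move=> Qz QG mu u0; have [mz z0 QE] := Qz.
have mzu : measurable_fun setT (fun x => (z x)%:E * u x)%E.
  apply: emeasurable_funM; last exact: measurable_wrt_fun mu.
  by apply/measurable_EFinP; exact: measurable_wrt_fun mz.
have zu0 x : (0 <= (z x)%:E * u x)%E by rewrite mule_ge0// lee_fin.
have cP := cexp_ge0P P sG GM mzu zu0.
apply: (cexp_ge0_unique sG GM _ cP).
apply/(is_ge0_cexp_density _ Qz QG mu u0).
apply: (@xgetPex _ _ [set g | is_ge0_cexp Q G u g]).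
by exists (cexp_ge0 P G (fun x => (z x)%:E * u x)%E); apply/(is_ge0_cexp_density _ Qz QG mu u0).
Qed.

Lemma cexp_density (Q : probability (g_sigma_algebraType H) R) z (Y : U -> R) :
  has_density Q z -> (forall A, G A -> Q A = P A) -> measurable_wrt H Y ->
  {ae P, forall x : U, cexp Q G (fun v => (Y v)%:E) x = wcexp P G z Y x}.
Proof.
move=> Qz QG mY.
have hp : (fun v => (Y v)%:E)^\+%E = pos_part Y.
  by apply/funext => x; rewrite funeposE /pos_part EFin_max.
have hn : (fun v => (Y v)%:E)^\-%E = neg_part Y.
  by apply/funext => x; rewrite funenegE /neg_part EFin_max.
have mp : measurable_wrt H (pos_part Y).
  by apply/(@mw_EFin _ _ _ _ (fun x => Num.max (Y x) 0)); apply: mw_max => //; exact: mw_cst.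
have mn : measurable_wrt H (neg_part Y).
  apply/(@mw_EFin _ _ _ _ (fun x => Num.max (- Y x) 0)).
  by apply: mw_max; [exact: mwN|exact: mw_cst].
have h1 := ge0_cexp_density Qz QG mp (pos_part_ge0 Y).
have h2 := ge0_cexp_density Qz QG mn (neg_part_ge0 Y).
by apply: filterS2 h1 h2 => x e1 e2; rewrite /cexp hp hn e1 e2.
Qed.

Lemma measurable_cexp_prob (Q : probability (g_sigma_algebraType H) R) f :
  measurable_wrt G (cexp Q G f : U -> \bar R).
Proof.
have m (u : U -> \bar R) : measurable_wrt G (ge0_cexp Q G u : U -> \bar R).
  exact: (@measurable_cexp_ge0 _ (g_sigma_algebraType H) _ Q G u).
exact: (@emeasurable_funB _ (g_sigma_algebraType G) _ setT _ _ (m _) (m _)).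
Qed.

End probability_density.

(** * Functions measurable for a trivial sigma-algebra *)

Section trivial_sub_sigma_algebra.
Context {d} {U : measurableType d} {R : realType}.
Variables (P : probability U R) (G : set (set U)).
Variables (sG : sigma_algebra setT G) (GM : G `<=` measurable).
Hypothesis Gtriv : forall A, G A -> P A = 0%E \/ P A = 1%E.

(** A set of probability 1 is nonempty. This turns a.s. relations between constants into relations
    between reals. *)
Lemma ae_const (Q : Prop) : {ae P, forall x : U, Q} -> Q.
Proof.
move=> [A [mA PA]] sub; apply: contrapT => nQ.
have : P A = 1%E.
  rewrite (_ : A = setT); first exact: probability_setT.
  by apply/seteqP; split => // x _; exact: sub.
by rewrite PA => /esym/eqP; rewrite onee_eq0.
Qed.

(** Events of G have probability 0 or 1, so f and its mean have the same integral over each of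
    them. *)
Lemma trivial_ae_cst (f : U -> R) : measurable_wrt G f ->
  P.-integrable setT (EFin \o f) ->
  \forall x \ae P, f x = \int[P]_y f y.
Proof.
move=> mf intf.
have ic (k : R) : P.-integrable setT (EFin \o (fun=> k)).
  exact: finite_measure_integrable_cst.
apply: (mw_ae_eq sG GM mf (mw_cst _) intf (ic _)) => A GA.
have mA := GM GA.
have EC (k : R) : (\int[P]_(x in A) (cst k x)%:E = k%:E * P A)%E.
  by rewrite (@integral_cst _ _ _ P A mA k%:E).
rewrite EC; have [PA|PA] := Gtriv GA.
  rewrite (@null_set_integral _ _ _ P A (fun x => (f x)%:E))//; last first.
    by apply: measurable_funTS; exact: measurable_int intf.
  by rewrite PA mule0.
have PCA : P (~` A) = 0%E by rewrite probability_setC// PA subee.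
rewrite PA mule1 EFin_Rintegral//.
rewrite [RHS](@negligible_integral _ _ _ P setT (~` A))//; last exact: measurableC.
by rewrite setTD setCK.
Qed.

(** The events g <= n cover a set of full measure and have probability 0 or 1; they cannot all be
    null. *)
Lemma trivial_ae_bound (g : U -> \bar R) : measurable_wrt G g ->
  (\forall x \ae P, (g x < +oo)%E) -> exists n : nat, \forall x \ae P, (g x <= n%:R%:E)%E.
Proof.
move=> mg goo.
pose A n := [set x | (g x <= n%:R%:E)%E].
have GA n : G (A n).
  rewrite -(measurable_gE sG) -[X in measurable X]setTI.
  exact: (@emeasurable_fun_infty_c _ (g_sigma_algebraType G)).
have [n PA] : exists n, P (A n) = 1%E.
  apply: contrapT => /forallNP h.
  apply: ae_const.
  have A0 n : P (A n) = 0%E by have [//|/h] := Gtriv (GA n).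
  have : P.-negligible (\bigcup_n A n).
    by apply: negligible_bigcup => n; apply/negligibleP; [exact: (GM (GA n))|exact: A0].
  move=> nA.
  have gA : \forall x \ae P, (\bigcup_n A n) x.
    apply: filterS goo => x gx.
    exists (Num.truncn (fine (g x))).+1 => //; rewrite /A /=.
    case: (g x) gx => [r| |]//= _; last by rewrite leNye.
    by rewrite lee_fin ltW// truncnS_gt.
  have gNA : \forall x \ae P, ~ (\bigcup_n A n) x.
    by apply: negligibleS nA => x /= /contrapT.
  by apply: filterS2 gA gNA.
exists n; exists (~` A n); split => //.
- by apply: measurableC; exact: (GM (GA n)).
- by rewrite probability_setC ?PA ?subee//; exact: (GM (GA n)).
Qed.

End trivial_sub_sigma_algebra.

Section weighted_cexp.
Context {d} {U : measurableType d} {R : realType}.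
Variables (P : probability U R) (G : set (set U)).
Variables (sG : sigma_algebra setT G) (GM : G `<=` measurable).
Implicit Types z Y : U -> R.

Lemma wpos_pos_part z Y : (forall x, 0 <= z x) ->
  wpos z Y = pos_part (fun x => z x * Y x).
Proof.
move=> z0; apply/funext => x; rewrite /wpos /pos_part -EFinM; congr EFin.
by rewrite maxr_pMr// mulr0.
Qed.

Lemma wneg_neg_part z Y : (forall x, 0 <= z x) ->
  wneg z Y = neg_part (fun x => z x * Y x).
Proof.
move=> z0; apply/funext => x; rewrite /wneg /neg_part -EFinM; congr EFin.
by rewrite maxr_pMr// mulr0 mulrN.
Qed.

Lemma wcexp_rcexp z Y : (forall x, 0 <= z x) ->
  P.-integrable setT (EFin \o (fun x => z x * Y x)) ->
  \forall x \ae P, wcexp P G z Y x = (rcexp P G (fun x => z x * Y x) x)%:E.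
Proof.
move=> z0 izY; apply: filterS (rcexpE sG GM izY) => x ->.
by rewrite /wcexp wpos_pos_part// wneg_neg_part.
Qed.

End weighted_cexp.

(** * Strong time-consistent dominated risk measures *)

Section risk_setting.
Context {R : realType} {d : measure_display} {Omega : measurableType d}.
Variables (P : probability Omega R) (T : R) (F : R -> set (set Omega)).
Hypothesis F_filtration : complete_filtration P T F.
Hypothesis F0_trivial : trivial_sigma_algebra P (F 0).
Variables (p : R) (p1 : 1 <= p) (rho : R -> R -> (Omega -> R) -> (Omega -> R)).
Hypothesis rho_risk : fully_dynamic_convex_risk_measure P T F p%:E rho.
Hypothesis rho_consistent : strong_time_consistent P T F p%:E rho.
Variable K : R.
Hypothesis rho_K : domination_constant P F p%:E T (rho 0 T) K.

Local Notation L t := (LpG P p (F t)).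
Local Notation nrm := (nrm P p).
Local Notation integrableR v := (P.-integrable setT (EFin \o v)).
Local Notation ok t := (0 <= t <= T).

Let sF t : ok t -> sigma_algebra setT (F t).
Proof. by move=> h; exact: (filtration_sigma_algebra F_filtration h). Qed.

Let FM t : ok t -> F t `<=` measurable.
Proof. by move=> h; exact: (filtration_sub F_filtration h). Qed.

Let mF t d' (V : measurableType d') (f : Omega -> V) : ok t ->
  measurable_wrt (F t) f -> measurable_fun setT f.
Proof. by move=> okt mf; exact: (measurable_wrt_fun (sF okt) (FM okt) mf). Qed.

Let FsetT t : ok t -> F t setT.
Proof. by move=> okt; rewrite -(measurable_gE (sF okt)); exact: measurableT. Qed.

Let ok_0 t : ok t -> 0 <= (0 : R) <= T.
Proof. by move=> /andP[t0 tT]; rewrite lexx (le_trans t0). Qed.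

Let ok_T t : ok t -> ok T.
Proof. by move=> /andP[t0 tT]; rewrite lexx (le_trans t0). Qed.

Let Fmono s t : 0 <= s -> s <= t -> t <= T -> F s `<=` F t.
Proof. exact: (filtration_mono F_filtration). Qed.

Let Lmono s t X : 0 <= s -> s <= t -> t <= T -> L s X -> L t X.
Proof. by move=> s0 st tT [mX LX]; split => //; exact: mw_sub (Fmono s0 st tT) mX. Qed.

Let ok_l s t : 0 <= s -> s <= t -> t <= T -> ok s.
Proof. by move=> s0 st tT; rewrite s0 (le_trans st tT). Qed.

Let ok_r s t : 0 <= s -> s <= t -> t <= T -> ok t.
Proof. by move=> s0 st tT; rewrite tT (le_trans s0 st). Qed.

Let integ t X : L t X -> integrableR X.
Proof. by move=> [_ LX]; exact: Lfun_int LX. Qed.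

Let rhoL s t X : 0 <= s -> s <= t -> t <= T -> L t X -> L s (rho s t X).
Proof. by move=> s0 st tT LX; exact: (risk_Lp rho_risk). Qed.

(** The mean extracts the real number to which rho_0t(X) is a.s. equal. *)
Definition r0 t X : R := \int[P]_x rho 0 t X x.

Lemma r0E t X : ok t -> L t X -> \forall x \ae P, rho 0 t X x = r0 t X.
Proof.
move=> okt LX; have /andP[t0 tT] := okt.
have ok0 := ok_0 okt.
have Lr := rhoL (lexx 0) t0 tT LX.
apply: (trivial_ae_cst (sF ok0) (FM ok0) F0_trivial); first by case: Lr.
exact: integ Lr.
Qed.

Lemma r0_mono t X Y : ok t -> L t X -> L t Y -> (\forall x \ae P, Y x <= X x) ->
  r0 t X <= r0 t Y.
Proof.
move=> okt LX LY YX; apply: (@ae_const _ _ _ P); have /andP[t0 tT] := okt.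
apply: filterS3 (r0E okt LX) (r0E okt LY)
  (risk_monotone rho_risk (lexx 0) t0 tT LX LY YX).
by move=> x <- <-.
Qed.

Lemma r0_convex t X Y (l : R) : ok t -> L t X -> L t Y -> 0 <= l <= 1 ->
  r0 t (fun x => l * X x + (1 - l) * Y x) <= l * r0 t X + (1 - l) * r0 t Y.
Proof.
move=> okt LX LY l01; apply: (@ae_const _ _ _ P); have /andP[t0 tT] := okt.
have LXY : L t (fun x => l * X x + (1 - l) * Y x) by apply: LpGD => //; exact: LpGZ.
have h := risk_convex rho_risk (lexx 0) t0 tT LX LY l01.
have e : \forall x \ae P, rho 0 t X x = r0 t X /\ rho 0 t Y x = r0 t Y.
  by apply: filterI; exact: r0E.
by apply: filterS3 e (r0E okt LXY) h => x [<- <-] <-.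
Qed.

Lemma r0_trans t X (k : R) : ok t -> L t X ->
  r0 t (fun x => X x + k) = r0 t X - k.
Proof.
move=> okt LX; apply: (@ae_const _ _ _ P); have /andP[t0 tT] := okt.
have L0k : L 0 (cst k) by exact: LpG_cst.
have LXk : L t (fun x => X x + k) by apply: LpGD => //; exact: LpG_cst.
apply: filterS3 (r0E okt LX) (r0E okt LXk)
  (risk_translation rho_risk (lexx 0) t0 tT LX L0k).
by move=> x <- <-.
Qed.

Lemma r0_consistent s t X : 0 <= s -> s <= t -> t <= T -> L t X ->
  r0 t X = r0 s (fun x => - rho s t X x).
Proof.
move=> s0 st tT LX; apply: (@ae_const _ _ _ P).
have Lr : L s (fun x => - rho s t X x) by apply: LpGN => //; exact: rhoL.
apply: filterS3 (r0E (ok_r s0 st tT) LX) (r0E (ok_l s0 st tT) Lr)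
  (rho_consistent (lexx 0) s0 st tT LX).
by move=> x <- <-.
Qed.

(** Since rho_st(f + rho_st(0)) = -f, time consistency returns [r0 s f]. The correction rho_st(0)
    stands in for a normalization of rho_st. *)
Lemma r0_down s t f : 0 <= s -> s <= t -> t <= T -> L s f ->
  r0 s f = r0 t (fun x => f x + rho s t (cst 0) x).
Proof.
move=> s0 st tT Lf; have oks := ok_l s0 st tT; have okt := ok_r s0 st tT.
have L0 : L t (cst 0) by exact: LpG_cst.
have Lr := rhoL s0 st tT L0.
have Lg : L s (fun x => f x + rho s t (cst 0) x) by exact: LpGD.
have Lgt := Lmono s0 st tT Lg.
rewrite (r0_consistent s0 st tT Lgt).
have Lrg : L s (fun x => - rho s t (fun y => f y + rho s t (cst 0) y) x).
  by apply: LpGN => //; exact: rhoL.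
have E : \forall x \ae P, - rho s t (fun y => f y + rho s t (cst 0) y) x = f x.
  have := risk_translation rho_risk s0 st tT L0 Lg.
  rewrite (_ : (fun w => cst 0 w + _) = fun y => f y + rho s t (cst 0) y).
    by apply: filterS => x ->; lra.
  by apply/funext => y; rewrite add0r.
by apply/le_anti/andP; split; apply: r0_mono => //; apply: filterS E => x ->.
Qed.

(** The slope is that of time T; the norm of rho_tT(0) enters the constant only. *)
Lemma r0_le t : ok t -> exists C, forall X, L t X -> r0 t X <= K * nrm X + C.
Proof.
move=> okt; have /andP[t0 tT] := okt; have [K0 [C CP]] := rho_K.
have okT := ok_T okt.
have T0 : 0 <= T by case/andP : okT.
have CT X : L T X -> r0 T X <= K * nrm X + C.
  move=> LX; apply: (@ae_const _ _ _ P).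
  apply: filterS2 (r0E okT LX) (CP _ LX) => x <-.
  by rewrite -(nrmE p1 LX.2) -EFinM -EFinD lee_fin.
have L0 : L T (cst 0) by exact: LpG_cst.
have Lr := rhoL t0 tT (lexx T) L0.
exists (K * nrm (rho t T (cst 0)) + C) => X LX.
rewrite (r0_down t0 tT (lexx T) LX).
have LX' : L t (fun x => X x + rho t T (cst 0) x) by exact: LpGD.
apply: le_trans (CT _ (Lmono t0 tT (lexx T) LX')) _.
rewrite addrA lerD2r -mulrDr ler_wpM2l//; first exact: ltW.
exact: nrmD LX.2 Lr.2.
Qed.

(** An event of F_0 or its complement is P-null, hence Q-null. *)
Lemma trivial_restricts t (Q : prob_at F t) : ok t -> equiv_P P Q ->
  restricts_to_P P 0 Q.
Proof.
move=> okt QP A F0A; have /andP[t0 tT] := okt.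
have ok0 := ok_0 okt.
have FA := Fmono (lexx 0) t0 tT F0A.
have [PA|PA] := F0_trivial F0A; first by rewrite PA; apply/(QP _ FA).
have F0C : F 0 (~` A) by have [_ sC _] := sF ok0; rewrite -setTD; exact: sC.
have FC := Fmono (lexx 0) t0 tT F0C.
have PC : P (~` A) = 0%E.
  by rewrite probability_setC ?PA ?subee//; exact: (FM ok0 F0A).
have QC : Q (~` A) = 0%E by apply/(QP _ FC).
have mA : measurable (A : set (g_sigma_algebraType (F t))).
  by rewrite (measurable_gE (sF okt)).
have QAC : (1 - Q A = 0)%E by rewrite -QC; exact/esym/(probability_setC Q mA).
have fQ : Q A \is a fin_num by exact: (fin_num_measure Q).
rewrite PA; move: QAC; case: (Q A) fQ => // q _ [] /eqP.
by rewrite subr_eq0 => /eqP <-.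
Qed.

Section penalty.
Variables (s t : R).
Hypotheses (s0 : 0 <= s) (st : s <= t) (tT : t <= T).
Variables (Q : prob_at F t) (z : Omega -> R).
Hypotheses (Qz : has_density P Q z) (Qs : restricts_to_P P s Q).

Let oks : ok s := ok_l s0 st tT.
Let okt : ok t := ok_r s0 st tT.
Let alpha := min_penalty P F p%:E rho s Q.

Lemma cond_density_of_prob : cond_density P (F s) (F t) z.
Proof.
have [mz z0 zE] := Qz; split => // A FA.
by rewrite -(zE _ (Fmono s0 st tT FA)); exact: Qs.
Qed.

Lemma cexp_wcexp Y : L t Y ->
  {ae P, forall x : Omega, cexp Q (F s) (fun v => (Y v)%:E) x = wcexp P (F s) z Y x}.
Proof.
move=> [mY _].
exact: (cexp_density (sF okt) (FM okt) (sF oks) (FM oks) (Fmono s0 st tT) Qz Qs mY).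
Qed.

(** Each member of the defining family is rewritten under P, up to a null set, so that the lemmas on
    densities apply to the penalty. *)
Lemma min_penaltyP : is_fam_ess_sup P (F s)
  [set (fun x => wcexp P (F s) z (fun v => - X v)%R x - (rho s t X x)%:E)%E | X in L t]
  alpha.
Proof.
pose S := [set (fun x => cexp Q (F s) (fun w => (- X w)%:E) x - (rho s t X x)%:E)%E
  | X in Lp P F p%:E t].
have S0 : S !=set0.
  by eexists; exists (cst 0) => //; exact: LpG_cst.
have mS f : S f -> measurable_wrt (F s) f.
  move=> [X LX <-]; apply: (@emeasurable_funB _ (g_sigma_algebraType (F s))).
    exact: measurable_cexp_prob.
  by apply/mw_EFin; have [] := rhoL s0 st tT LX.
have := fam_ess_supP P (sF oks) (FM oks) S0 mS.
apply: is_fam_ess_sup_ae_eq => _ [X LX <-].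
- exists (fun x => wcexp P (F s) z (fun v => - X v)%R x - (rho s t X x)%:E)%E.
    by exists X.
  have LNX : L t (fun x => - X x) by exact: LpGN.
  by apply: filterS (cexp_wcexp LNX) => x ->.
- exists (fun x => cexp Q (F s) (fun w => (- X w)%:E) x - (rho s t X x)%:E)%E.
    by exists X.
  have LNX : L t (fun x => - X x) by exact: LpGN.
  by apply: filterS (cexp_wcexp LNX) => x ->.
Qed.

Lemma min_penalty_ub X : L t X ->
  \forall x \ae P, (wcexp P (F s) z (fun v => - X v)%R x - (rho s t X x)%:E <= alpha x)%E.
Proof. by move=> LX; have [_ h _] := min_penaltyP; apply: h; exists X. Qed.

Lemma min_penalty_le a : measurable_wrt (F s) a -> penalty_le P p (F s) (F t) (rho s t) z a ->
  \forall x \ae P, (alpha x <= (a x)%:E)%E.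
Proof.
move=> ma pa; have [_ _ h] := min_penaltyP; apply: h; first exact/mw_EFin.
by move=> _ [X LX <-]; exact: pa.
Qed.

Lemma min_penalty_ge : \forall x \ae P, ((- rho s t (cst 0) x)%:E <= alpha x)%E.
Proof.
have L0 : L t (cst 0) by exact: LpG_cst.
have N0 := cexp_ge0_cst0 P (sF oks) (FM oks).
apply: filterS2 N0 (min_penalty_ub L0) => x e1.
have hp : wpos z (fun x => - (cst 0 : Omega -> R) x) = cst 0%E.
  by apply/funext => y; rewrite /wpos /pos_part /= oppr0 maxxx mule0.
have hn : wneg z (fun x => - (cst 0 : Omega -> R) x) = cst 0%E.
  by apply/funext => y; rewrite /wneg /neg_part /= !oppr0 maxxx mule0.
by rewrite /wcexp hp hn e1 sube0 add0e.
Qed.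

Lemma dual_le X : L t X ->
  \forall x \ae P, (cexp Q (F s) (fun v => (- X v)%:E) x - alpha x <= (rho s t X x)%:E)%E.
Proof.
move=> LX; have LNX : L t (fun x => - X x) by exact: LpGN.
apply: filterS2 (cexp_wcexp LNX) (min_penalty_ub LX) => x ->.
(* In the case analysis +oo - +oo is -oo, so an infinite penalty is harmless. *)
move: (wcexp _ _ _ _ _) (alpha x) (rho s t X x) => [a| |] [b| |] c //=;
  rewrite ?leey ?leNye// -?EFinB ?lee_fin; lra.
Qed.

End penalty.

(** For Q with density z and every z X integrable, this is alpha_0t(Q) <= c as an inequality between
    reals. *)
Definition bounded_by t (z : Omega -> R) (c : R) :=
  forall X, L t X -> - (\int[P]_x (z x * X x)) <= r0 t X + c.

Lemma bounded_by_down s t z c : 0 <= s -> s <= t -> t <= T ->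
  (forall X, L t X -> integrableR (fun x => z x * X x)) ->
  bounded_by t z c -> exists c', bounded_by s z c'.
Proof.
move=> s0 st tT iz zc.
have L0 : L t (cst 0) by exact: LpG_cst.
have Lk := rhoL s0 st tT L0.
have Lkt := Lmono s0 st tT Lk.
exists (c + \int[P]_x (z x * rho s t (cst 0) x)) => f Lf.
have Lft := Lmono s0 st tT Lf.
rewrite (r0_down s0 st tT Lf) addrA -lerBlDr.
apply: le_trans (zc _ _); last exact: LpGD.
rewrite -opprD lerN2 -RintegralD//; [|exact: iz|exact: iz].
apply: Rintegral_ae_le; first by apply/iz/LpGD.
  by apply: integrableRD; exact: iz.
by apply: aeW => x; rewrite mulrDr.
Qed.

(** Testing on -l X with l large leaves only the slope: an expectation with finite penalty is a
    functional of norm at most K. *)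
Lemma bounded_by_le t z c X : ok t ->
  (forall X, L t X -> integrableR (fun x => z x * X x)) -> bounded_by t z c ->
  L t X -> (\int[P]_x (z x * X x)) <= K * nrm X.
Proof.
move=> okt iz zc LX; have [C CP] := r0_le okt.
apply: (ler_of_scaled (c := C + c)) => l l0.
have LlX : L t (fun x => (- l) * X x) by exact: LpGZ.
have h1 := zc _ LlX; have h2 := CP _ LlX.
rewrite (nrmZ p1 _ LX.2) normrN (gtr0_norm l0) in h2.
have E : - (\int[P]_x (z x * (- l * X x))) = l * \int[P]_x (z x * X x).
  rewrite -mulN1r -!RintegralZl//; [|exact: iz|exact: iz].
  by apply: eq_Rintegral => x _; ring.
rewrite E in h1; lra.
Qed.

Let wcexp_trivial t z X : ok t -> (forall x, 0 <= z x) ->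
  (forall X, L t X -> integrableR (fun x => z x * X x)) -> L t X ->
  \forall x \ae P, wcexp P (F 0) z (fun v => - X v)%R x = (- \int[P]_x (z x * X x))%:E.
Proof.
move=> okt z0 iz LX; have /andP[t0 tT] := okt.
have ok0 := ok_0 okt.
have F0T := FsetT ok0.
have LNX : L t (fun x => - X x) by exact: LpGN.
have i1 := iz _ LNX.
have i2 := integrable_rcexp (sF ok0) (FM ok0) i1.
have h2 := trivial_ae_cst (sF ok0) (FM ok0) F0_trivial
  (@measurable_rcexp _ _ _ P (F 0) (fun x => z x * - X x)) i2.
have h3 : (\int[P]_y rcexp P (F 0) (fun x => z x * - X x) y) = - \int[P]_x (z x * X x).
  rewrite -RintegralMN; last exact: iz.
  apply: EFin_inj; rewrite (EFin_Rintegral i2) (EFin_Rintegral i1).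
  exact: (integral_rcexp (sF ok0) (FM ok0) i1 F0T).
rewrite h3 in h2.
by apply: filterS2 (wcexp_rcexp (sF ok0) (FM ok0) z0 i1) h2 => x -> ->.
Qed.

(** The penalty and E(z|X| | F_0) are a.s. below +oo and F_0-measurable, hence bounded above by
    constants. *)
Lemma finite_penalty_bounded t (Q : prob_at F t) z : ok t -> has_density P Q z ->
  finite_penalty P p%:E rho Q ->
  (forall X, L t X -> integrableR (fun x => z x * X x)) /\
  exists c, bounded_by t z c.
Proof.
move=> okt Qz [QP Qoo]; have /andP[t0 tT] := okt.
have ok0 := ok_0 okt.
have Qs := trivial_restricts okt QP.
have dz := cond_density_of_prob (lexx 0) t0 tT Qz Qs.
have [ma ub _] := min_penaltyP (lexx 0) t0 tT Qz Qs.
have [n hn] := trivial_ae_bound (sF ok0) (FM ok0) F0_trivial ma Qoo.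
have pz : penalty_le P p (F 0) (F t) (rho 0 t) z (cst n%:R).
  move=> Y LY; apply: filterS2 hn (min_penalty_ub (lexx 0) t0 tT Qz Qs LY).
  by move=> x h1 h2; exact: le_trans h2 h1.
have [mz z0 zE] := Qz.
have mz' := mF okt mz.
have mL X : L t X -> measurable_fun setT X.
  by move=> [_ LX]; exact: Lfun_measurable LX.
have F0T := FsetT ok0.
have iz X : L t X -> integrableR (fun x => z x * X x).
  move=> LX; have LaX : L t (fun x => `|X x|) by exact: LpG_abs.
  have mw := measurable_wpos mz' (mL _ LaX).
  have w0 x : (0 <= wpos z (fun x => `|X x|)%R x)%E by exact: wpos_ge0.
  have Noo := penalty_le_lty p1 (sF ok0) (FM ok0) (sF okt) (FM okt) dz pz LaX.
  have [m hm] := trivial_ae_bound (sF ok0) (FM ok0) F0_trivial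
    (@measurable_cexp_ge0 _ _ _ P (F 0) _) Noo.
  apply/integrableP; split.
    by apply/measurable_EFinP; apply: measurable_funM => //; exact: mL.
  apply: (@le_lt_trans _ _ (\int[P]_x wpos z (fun x => `|X x|)%R x)%E).
    apply: ge0_le_integral => //.
    - apply: measurableT_comp => //.
      by apply/measurable_EFinP; apply: measurable_funM => //; exact: mL.
    - move=> x _; rewrite /wpos /pos_part /= -EFinM lee_fin normrM.
      by rewrite (ger0_norm (z0 x)) max_l.
  have [_ _ E] := cexp_ge0P P (sF ok0) (FM ok0) mw w0.
  rewrite -E//; apply: (@le_lt_trans _ _ (\int[P]_x cst m%:R%:E x)%E).
    apply: ae_ge0_le_integral => //.
    - by move=> x _; exact: cexp_ge0_ge0.
    - by apply: (mF ok0); exact: measurable_cexp_ge0.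
    - by move=> x _; rewrite lee_fin.
    - by apply: filterS hm => x h _; exact: h.
  by rewrite integral_cst// ltey_eq fin_numM// fin_num_measure.
split=> //; exists n%:R => X LX.
apply: (@ae_const _ _ _ P).
apply: filterS3 (wcexp_trivial okt z0 iz LX) (pz _ LX) (r0E okt LX) => x -> + <-.
by rewrite -EFinB lee_fin /=; lra.
Qed.

Lemma finite_penalty_of_bounded t (Q : prob_at F t) z c : ok t -> has_density P Q z ->
  equiv_P P Q -> (forall X, L t X -> integrableR (fun x => z x * X x)) ->
  bounded_by t z c -> finite_penalty P p%:E rho Q.
Proof.
move=> okt Qz QP iz zc; have /andP[t0 tT] := okt.
have ok0 := ok_0 okt.
have Qs := trivial_restricts okt QP.
have [mz z0 zE] := Qz.
have F0T := FsetT ok0.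
split=> //.
suff pz : penalty_le P p (F 0) (F t) (rho 0 t) z (cst c).
  apply: filterS (min_penalty_le (lexx 0) t0 tT Qz Qs (mw_cst _) pz) => x h.
  by rewrite (le_lt_trans h)// ltry.
move=> X LX.
apply: filterS2 (wcexp_trivial okt z0 iz LX) (r0E okt LX) => x -> ->.
by rewrite -EFinB lee_fin lerBlDr addrC; exact: zc.
Qed.

(** * The recession functional and domination of rho_0t *)

Let slope t X l := (r0 t (fun x => l * X x) - r0 t (cst 0)) / l.

Let slopes t X := [set slope t X l | l in [set l | 0 < l]].

Let recession t X := sup (slopes t X).

Let has_sup_slopes t X : ok t -> L t X -> has_sup (slopes t X).
Proof.
move=> okt LX; have [C CP] := r0_le okt.
have L0 : L t (cst 0) by exact: LpG_cst.
split; first by exists (slope t X 1), 1 => //=; exact: ltr01.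
pose B := r0 t (cst 0).
(* For l >= 1 the growth bound applies; for l < 1 convexity bounds the slope by the one at 1. *)
exists (Num.max (K * nrm X + `|C - B|) (r0 t X - B)) => _ [l /= l0 <-].
have LlX : L t (fun x => l * X x) by exact: LpGZ.
rewrite le_max /slope -/B !ler_pdivrMr//.
have [l1|l1] := leP 1 l; apply/orP; [left|right].
  have := CP _ LlX; rewrite (nrmZ p1 _ LX.2) (gtr0_norm l0).
  have := ler_norm (C - B); have := normr_ge0 (C - B); nra.
have l01 : 0 <= l <= 1 by rewrite !ltW.
have := r0_convex okt LX L0 l01.
rewrite (_ : (fun x => l * X x + _) = fun x => l * X x); last first.
  by apply/funext => x; rewrite mulr0 addr0.
rewrite -/B; nra.
Qed.

Let slope_le t X l : ok t -> L t X -> 0 < l -> slope t X l <= recession t X.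
Proof.
by move=> okt LX l0; apply: sup_upper_bound; [exact: has_sup_slopes|exists l].
Qed.

Let recession_le t X M : ok t -> L t X -> (forall l, 0 < l -> slope t X l <= M) ->
  recession t X <= M.
Proof.
move=> okt LX h; apply: ge_sup; first by case: (has_sup_slopes okt LX).
by move=> _ [l l0 <-]; exact: h.
Qed.

(* The recession functional of r0 is the smallest coherent risk measure
   dominating r0 - r0 0. *)
Lemma dominated_r0 t : ok t -> dominated P F p%:E t (rho 0 t).
Proof.
move=> okt; have L0 : L t (cst 0) by exact: LpG_cst.
exists (recession t); last first.
  move=> X LX; have := slope_le okt LX ltr01.
  rewrite /slope divr1 (_ : (fun x => 1 * X x) = X); last first.
    by apply/funext => x; rewrite mul1r.
  by move=> h; apply: filterS2 (r0E okt LX) (r0E okt L0) => x -> ->.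
split=> [X Y LX LY YX|X k LX|X Y LX LY|X l LX].
- apply: recession_le => // l l0; apply: le_trans (slope_le okt LY l0).
  rewrite /slope ler_pM2r ?invr_gt0// lerD2r.
  apply: r0_mono => //; [exact: LpGZ|exact: LpGZ|].
  by apply: filterS YX => x h; rewrite ler_pM2l.
- have LXk : L t (fun x => X x + k) by apply: LpGD => //; exact: LpG_cst.
  have E l : 0 < l -> slope t (fun x => X x + k) l = slope t X l - k.
    move=> l0; rewrite /slope.
    rewrite (_ : (fun x => l * (X x + k)) = fun x => l * X x + l * k); last first.
      by apply/funext => x; rewrite mulrDr.
    rewrite r0_trans//; last exact: LpGZ.
    by field; exact: lt0r_neq0.
  apply/le_anti/andP; split.
    by apply: recession_le => // l l0; rewrite E// lerD2r slope_le.
  rewrite lerBlDr; apply: recession_le => // l l0.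
  by rewrite -lerBlDr -E// slope_le.
- have LXY : L t (fun x => X x + Y x) by exact: LpGD.
  apply: recession_le => // l l0.
  (* l (X + Y) is the midpoint of 2 l X and 2 l Y, so its slope at l is at most the sum of the
     slopes at 2 l. *)
  have l2 : 0 < 2 * l by rewrite mulr_gt0.
  apply: le_trans (lerD (slope_le okt LX l2) (slope_le okt LY l2)).
  have Lx : L t (fun x => 2 * l * X x) by exact: LpGZ.
  have Ly : L t (fun x => 2 * l * Y x) by exact: LpGZ.
  have h01 : 0 <= (2^-1 : R) <= 1 by lra.
  have := r0_convex okt Lx Ly h01.
  rewrite (_ : (fun x => 2^-1 * _ + _) = fun x => l * (X x + Y x)); last first.
    by apply/funext => x; field.
  rewrite /slope; set a := r0 t _; set b := r0 t _; set e := r0 t _ => h.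
  rewrite -mulrDl ler_pdivrMr// mulrAC ler_pdivlMr//.
  have : a <= 2^-1 * b + (1 - 2^-1) * e by []; nra.
- move=> l0; have [->|ln0] := eqVneq l 0.
    rewrite mul0r (_ : (fun w => _) = cst 0); last first.
      by apply/funext => x; rewrite mul0r.
    have E m : slope t (cst 0) m = 0.
      rewrite /slope (_ : (fun x => _) = cst 0) ?subrr ?mul0r//.
      by apply/funext => x; rewrite mulr0.
    apply/le_anti/andP; split; first by apply: recession_le => // m m0; rewrite E.
    by rewrite -[leLHS](E 1); exact: slope_le.
  have {l0 ln0}l0 : 0 < l by rewrite lt_def ln0.
  have LlX : L t (fun x => l * X x) by exact: LpGZ.
  have E m : 0 < m -> slope t (fun x => l * X x) m = l * slope t X (m * l).
    move=> m0; rewrite /slope.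
    rewrite (_ : (fun x => m * _) = fun x => m * l * X x); last first.
      by apply/funext => x; rewrite mulrA.
    by field; rewrite !lt0r_neq0.
  apply/le_anti/andP; split.
    apply: recession_le => // m m0; rewrite E// ler_pM2l//.
    by apply: slope_le => //; exact: mulr_gt0.
  rewrite -ler_pdivlMl//; apply: recession_le => // m m0.
  rewrite ler_pdivlMl//; have ml : 0 < m / l by exact: divr_gt0.
  have := slope_le okt LlX ml; rewrite E// divfK//; exact: lt0r_neq0.
Qed.

Lemma integral_pos_eq0 (z : Omega -> R) (A : set Omega) : measurable A -> measurable_fun setT z ->
  (\forall x \ae P, 0 < z x) -> (forall x, 0 <= z x) ->
  (\int[P]_(x in A) (z x)%:E = 0)%E <-> P A = 0%E.
Proof.
move=> mA mz z_gt0 z0.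
have mzE : measurable_fun A (EFin \o z) by apply: measurable_funTS; exact/measurable_EFinP.
split=> [|PA]; last exact: null_set_integral.
rewrite (eq_integral (fun x => `|(EFin \o z) x|)%E); last first.
  by move=> x _; rewrite gee0_abs ?lee_fin.
move/(ae_eq_integral_abs _ mA mzE) => h.
apply/negligibleP; first by [].
suff nA : \forall x \ae P, ~ A x by case: nA => B [mB PB sB]; exists B; split => // x Ax; apply: sB => /=; exact.
by apply: filterS2 h z_gt0 => x h zx /h [] zx0; move: zx; rewrite zx0 ltxx.
Qed.

(** The given probability is restricted to F_t. Its density z there has the same integrals as [zT]
    against F_t-measurable functions, so the penalty bound obtained from [bounded_by_down] holds for
    z. *)
Lemma exists_sensitive_density t : ok t -> sensitive P F p%:E rho T ->
  exists (Q : prob_at F t) z, [/\ has_density P Q z, finite_penalty P p%:E rho Q,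
    (\forall x \ae P, 0 < z x),
    (forall X, L t X -> integrableR (fun x => z x * X x)) &
    exists c, bounded_by t z c].
Proof.
move=> okt [QT QToo]; have /andP[t0 tT] := okt.
have okT := ok_T okt.
have [zT QTz zT_gt0] := exists_prob_density (sF okT) (FM okT) QToo.1.
have [izT [c zTc]] := finite_penalty_bounded okT QTz QToo.
have [c' zTc'] := bounded_by_down t0 tT (lexx T) izT zTc.
have [mzT zT0 zTE] := QTz.
have mzT' := mF okT mzT.
have FTT := FsetT okT.
have zT1 : (\int[P]_x (zT x)%:E = 1)%E.
  by rewrite -(zTE _ FTT); exact: probability_setT.
have [Q QE] := exists_prob_of_density (sF okt) (FM okt) mzT' zT0 zT1.
have QP : equiv_P P Q.
  move=> A FA; rewrite (QE _ FA).
  exact: integral_pos_eq0 (FM okt FA) mzT' zT_gt0 zT0.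
have [z Qz z_gt0] := exists_prob_density (sF okt) (FM okt) QP.
have [mz z0 zE] := Qz.
have mz' := mF okt mz.
have mzE : measurable_fun setT (EFin \o z) by exact/measurable_EFinP.
have mzTE : measurable_fun setT (EFin \o zT) by exact/measurable_EFinP.
have tr (phi : Omega -> \bar R) : measurable_wrt (F t) phi -> (forall x, 0 <= phi x)%E ->
    (\int[P]_x (phi x * (z x)%:E) = \int[P]_x (phi x * (zT x)%:E))%E.
  move=> mphi phi0.
  apply: (@integralM_eq _ _ _ P _ (sF okt) (FM okt) (EFin \o z) (EFin \o zT)) => //.
  by move=> A FA; rewrite -(QE _ FA) -(zE _ FA).
have iz X : L t X -> integrableR (fun x => z x * X x).
  move=> LX; have [mX _] := LX.
  have izTX := izT _ (Lmono t0 tT (lexx T) LX).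
  have mX' := mF okt mX.
  apply/integrableP; split; first by apply/measurable_EFinP; exact: measurable_funM.
  have h (w : Omega -> R) : (forall x, 0 <= w x) ->
     (\int[P]_x `|(EFin \o (fun x => (w x * X x)%R)) x| =
      \int[P]_x ((EFin \o (fun x => `|X x|%R)) x * (w x)%:E))%E.
    move=> w0; apply: eq_integral => x _ /=.
    by rewrite normrM (ger0_norm (w0 x)) mulrC.
  rewrite h// tr//; [by rewrite -h//; case/integrableP : izTX| |by move=> x; rewrite lee_fin].
  by apply/(@mw_EFin _ _ _ _ (fun x => `|X x|)); exact: mw_abs.
have zI X : L t X -> (\int[P]_x (z x * X x)) = \int[P]_x (zT x * X x).
  move=> LX; have [mX _] := LX.
  have izTX := izT _ (Lmono t0 tT (lexx T) LX).
  apply: EFin_inj; rewrite (EFin_Rintegral izTX) (EFin_Rintegral (iz _ LX)).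
  have pE (w : Omega -> R) : (forall x, 0 <= w x) -> (EFin \o (fun x => (w x * X x)%R))^\+%E =
      (fun x => pos_part X x * (w x)%:E)%E.
    move=> w0; apply/funext => x; rewrite funeposE /pos_part /= -EFin_max -EFinM.
    by congr EFin; rewrite mulrC [RHS]mulrC maxr_pMr// mulr0 mulrC.
  have nE (w : Omega -> R) : (forall x, 0 <= w x) -> (EFin \o (fun x => (w x * X x)%R))^\-%E =
      (fun x => neg_part X x * (w x)%:E)%E.
    move=> w0; apply/funext => x; rewrite funenegE /neg_part /= -EFin_max -EFinM.
    by congr EFin; rewrite [RHS]mulrC maxr_pMr// mulr0 mulrN.
  rewrite [LHS]integralE [RHS]integralE (pE z)// (pE zT)// (nE z)// (nE zT)//.
  have mp : measurable_wrt (F t) (pos_part X).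
    by apply/(@mw_EFin _ _ _ _ (fun x => Num.max (X x) 0)); apply: mw_max => //; exact: mw_cst.
  have mn : measurable_wrt (F t) (neg_part X).
    apply/(@mw_EFin _ _ _ _ (fun x => Num.max (- X x) 0)).
    by apply: mw_max; [exact: mwN|exact: mw_cst].
  by rewrite (tr _ mp (pos_part_ge0 X)) (tr _ mn (neg_part_ge0 X)).
have zc : bounded_by t z c' by move=> X LX; rewrite zI//; exact: zTc'.
exists Q, z; split => //; last by exists c'.
exact: finite_penalty_of_bounded okt Qz QP iz zc.
Qed.

Lemma sensitive_r0 t : ok t -> sensitive P F p%:E rho T -> sensitive P F p%:E rho t.
Proof.
by move=> okt /(exists_sensitive_density okt)[Q [z [_ Qoo _ _ _]]]; exists Q.
Qed.

(** Enlarging [calP] keeps every value below rho_st(X) as long as members are equivalent to P and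
    equal to P on F_s, and the supremum is already reached within [calP]. Leaving S free covers
    [calPtilde] too. *)
Lemma representation s t (S : set (prob_at F t)) X : 0 <= s -> s <= t -> t <= T ->
  sensitive P F p%:E rho T -> calP P F p%:E rho s t `<=` S ->
  (forall Q, S Q -> equiv_P P Q /\ restricts_to_P P s Q) -> L t X ->
  \forall x \ae P, (rho s t X x)%:E =
    fam_ess_sup P (F s)
      [set (fun w => cexp Q (F s) (fun v => (- X v)%:E) w
                     - min_penalty P F p%:E rho s Q w)%E | Q in S] x.
Proof.
move=> s0 st tT rhoS PS Seq LX.
have oks := ok_l s0 st tT; have okt := ok_r s0 st tT.
have [_ [zt [[mzt zt0 _] _ zt_gt0 izt [c ztc]]]] := exists_sensitive_density okt rhoS.
have [c' ztc'] := bounded_by_down s0 st tT izt ztc.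
have [C CP] := r0_le okt.
have K_ge0 : 0 <= K by case: rho_K => /ltW.
have cm : c <= Num.max c c' by rewrite le_max lexx.
have c'm : c' <= Num.max c c' by rewrite le_max lexx orbT.
have FsT := FsetT oks.
have LNX : L t (fun x => - X x) by exact: LpGN.
have [z [a [zP hP]]] := @approximate_dual_representation _ _ _ P p p1 (F s) (F t) (sF oks) (FM oks)
  (sF okt) (FM okt) (Fmono s0 st tT) (rho s t)
  (fun X LX => rhoL s0 st tT LX)
  (fun X Y LX LY => risk_monotone rho_risk s0 st tT LX LY)
  (fun X Y l LX LY => risk_convex rho_risk s0 st tT LX LY)
  (fun X f LX Lf => risk_translation rho_risk s0 st tT LX Lf)
  (r0 s) (r0 t) K C (Num.max c c')
  (fun X Y LX LY => r0_mono oks LX LY)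
  (fun X LX => r0_consistent s0 st tT LX)
  (fun X Y l LX LY => r0_convex okt LX LY) K_ge0 CP zt mzt zt0 zt_gt0 izt
  (fun f Lf => le_trans (ztc' f Lf) (lerD (lexx _) c'm))
  (fun f Lf => le_trans (ztc f Lf) (lerD (lexx _) cm)) X LX.
apply: fam_ess_sup_eq; split.
- by apply/mw_EFin; have [] := rhoL s0 st tT LX.
- move=> _ [Q SQ <-]; have [QP Qs] := Seq _ SQ.
  have [zQ Qz _] := exists_prob_density (sF okt) (FM okt) QP.
  by have := dual_le s0 st tT Qz Qs LX.
move=> h mh hS; apply: hP => n.
have [dz z_gt0 La pa] := zP n; have [mz z0 zE] := dz.
have mz' := mF okt mz.
have z1 : (\int[P]_x (z n x)%:E = 1)%E by rewrite (zE _ FsT) probability_setT.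
have [Q QE] := exists_prob_of_density (sF okt) (FM okt) mz' z0 z1.
have Qz : has_density P Q (z n) by [].
have QP : equiv_P P Q.
  move=> A FA; rewrite (QE _ FA).
  exact: integral_pos_eq0 (FM okt FA) mz' z_gt0 z0.
have Qs : restricts_to_P P s Q.
  by move=> A FA; rewrite QE ?zE//; exact: Fmono s0 st tT _ FA.
have ub := min_penalty_le s0 st tT Qz Qs La.1 pa.
have lb := min_penalty_ge s0 st tT Qz Qs.
have [malpha _ _] := min_penaltyP s0 st tT Qz Qs.
(* The penalty lies between -rho_st(0) and [a n], both in L_p(F_s). *)
have CPQ : calP P F p%:E rho s t Q.
  split => //; exists (fine \o min_penalty P F p%:E rho s Q); last first.
    apply: filterS2 ub lb => x h1 h2 /=; rewrite fineK// fin_numElt.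
    by rewrite (lt_le_trans _ h2) ?ltNyr// (le_lt_trans h1) ?ltry.
  have L0 : L t (cst 0) by exact: LpG_cst.
  have mf := mw_fine malpha.
  have Lr := rhoL s0 st tT L0.
  have [] // := @LpG_le _ _ _ P p p1 (F s) (sF oks) (FM oks)
    (fine \o min_penalty P F p%:E rho s Q)
    (fun x => `|a n x| + `|rho s t (cst 0) x|) mf.
    by apply: LfunD => //; apply: Lfun_abs => //; [case: La|case: Lr].
  apply: filterS2 ub lb => x /=.
  case: (min_penalty _ _ _ _ _ _ _) => [r| |]//=; rewrite !lee_fin => h1 h2.
  rewrite [leRHS]ger0_norm ?addr_ge0// ler_norml.
  have := ler_norm (a n x); have := ler_norm (rho s t (cst 0) x).
  have := normr_ge0 (a n x); have := normr_ge0 (rho s t (cst 0) x).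
  by move=> *; apply/andP; split; lra.
have := hS _ (ex_intro2 _ _ Q (PS _ CPQ) erefl).
apply: filterS3 ub (cexp_wcexp s0 st tT Qz Qs LNX) => x h1 -> h2.
by apply: le_trans h2; exact: leeB.
Qed.

(** [bounded_by_le] bounds E_Q of the penalty by K times its norm, whatever Q in [calQ]. *)
Lemma calP_calPtilde s t : 0 <= s -> s <= t -> t <= T ->
  calP P F p%:E rho s t `<=` calPtilde P T F p%:E rho s t.
Proof.
move=> s0 st tT Q' [Q'P Q's [f Lf alphaf]].
have oks := ok_l s0 st tT; have okt := ok_r s0 st tT.
have sT : s <= T by case/andP : oks.
have T0 : 0 <= T by exact: le_trans sT.
have okT : ok T by rewrite lexx T0.
have [z' Q'z' _] := exists_prob_density (sF okt) (FM okt) Q'P.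
have [malpha _ _] := min_penaltyP s0 st tT Q'z' Q's.
have LfT := Lmono s0 sT (lexx T) Lf.
split => //; apply: (@le_lt_trans _ _ (K * nrm f)%:E); last exact: ltry.
apply: ge_ereal_sup => _ [Q Qoo <-].
have [z Qz _] := exists_prob_density (sF okT) (FM okT) Qoo.1.
have [iz [c zc]] := finite_penalty_bounded okT Qz Qoo.
rewrite (integral_prob_density_ae (sF okT) (FM okT) Qz _ _ alphaf (iz _ LfT)).
- by rewrite -EFin_Rintegral ?lee_fin; [exact: bounded_by_le zc LfT|exact: iz].
- exact: mw_sub (Fmono s0 sT (lexx T)) malpha.
- exact: Lfun_measurable Lf.2.
Qed.

(** * The functional E_Q(E_Q'(X | F_s)) and its density *)

Section composed_kernel.
Variables (s t : R).
Hypotheses (s0 : 0 <= s) (st : s <= t) (tT : t <= T).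
Variables (Q : prob_at F T) (Q' : prob_at F t).
Hypotheses (Qoo : calQ P T F p%:E rho Q) (Q'oo : calPtilde P T F p%:E rho s t Q').
Variables (zQ z : Omega -> R).
Hypotheses (QzQ : has_density P Q zQ) (zQ_gt0 : \forall x \ae P, 0 < zQ x).
Hypothesis Q'z : has_density P Q' z.

Let oks : ok s := ok_l s0 st tT.
Let okt : ok t := ok_r s0 st tT.
Let sT : s <= T. Proof. by case/andP : oks. Qed.
Let okT : ok T. Proof. by rewrite lexx (le_trans s0 sT). Qed.
Let alpha := min_penalty P F p%:E rho s Q'.
Let N := cexp_ge0 P (F s).
Let K_ge0 : 0 <= K. Proof. by case: rho_K => /ltW. Qed.

Let zQ0 x : 0 <= zQ x. Proof. by case: QzQ. Qed.
Let z0 x : 0 <= z x. Proof. by case: Q'z. Qed.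
Let mzQ : measurable_fun setT zQ.
Proof. by have [m _ _] := QzQ; exact: (mF okT m). Qed.
Let mz : measurable_fun setT z.
Proof. by have [m _ _] := Q'z; exact: (mF okt m). Qed.

Let izQ X : L T X -> integrableR (fun x => zQ x * X x).
Proof. by have [h _] := finite_penalty_bounded okT QzQ Qoo; exact: h. Qed.

Let izQs X : L s X -> integrableR (fun x => zQ x * X x).
Proof. by move=> LX; apply/izQ/(Lmono s0 sT (lexx T)). Qed.

Let Q's : restricts_to_P P s Q'. Proof. by case: Q'oo. Qed.

Let malpha : measurable_wrt (F s) alpha.
Proof. by have [] := min_penaltyP s0 st tT Q'z Q's. Qed.

Let b x := fine (alpha^\+%E x).

Let mb : measurable_wrt (F s) b.
Proof.
have mp : measurable_wrt (F s) alpha^\+%E.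
  exact: (@measurable_funepos _ (g_sigma_algebraType (F s))).
exact: mw_fine mp.
Qed.

(** Membership in [calPtilde] bounds E_Q(alpha) from above only. The negative part of alpha is at
    most |rho_st(0)|, which is Q-integrable, so the positive part is Q-integrable as well. *)
Let b_alpha :
  (\forall x \ae P, (alpha x <= (b x)%:E)%E) /\ integrableR (fun x => zQ x * b x).
Proof.
have Lr : L s (rho s t (cst 0)) by apply: rhoL => //; exact: LpG_cst.
have malphaT : measurable_wrt (F T) alpha by exact: mw_sub (Fmono s0 sT (lexx T)) malpha.
have mpT : measurable_wrt (F T) alpha^\+%E.
  exact: (@measurable_funepos _ (g_sigma_algebraType (F T))).
have mnT : measurable_wrt (F T) alpha^\-%E.
  exact: (@measurable_funeneg _ (g_sigma_algebraType (F T))).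
have mp := mF okT mpT.
have mn := mF okT mnT.
have mzE : measurable_fun setT (EFin \o zQ) by exact/measurable_EFinP.
have neg_oo : (\int[Q]_x alpha^\-%E x < +oo)%E.
  rewrite (integral_prob_density (sF okT) (FM okT) QzQ)//.
  have /integrableP[_] := izQs Lr; apply: le_lt_trans.
  apply: ae_ge0_le_integral => //.
  - by move=> x _; rewrite mule_ge0// lee_fin.
  - exact: emeasurable_funM.
  - by apply: measurableT_comp => //; exact: measurable_int (izQs Lr).
  apply: filterS (min_penalty_ge s0 st tT Q'z Q's) => x h _ /=.
  rewrite normrM (ger0_norm (zQ0 x)) muleC EFinM lee_wpmul2l// ?lee_fin//.
  rewrite funenegE ge_max lee_fin normr_ge0 andbT.
  by rewrite leeNl (le_trans _ h)// lee_fin lerN2 ler_norm.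
have oo : (\int[Q]_x alpha x < +oo)%E.
  have [_ _ h] := Q'oo; apply: le_lt_trans h.
  by apply: ereal_sup_ubound; exists Q.
have pos_oo : (\int[Q]_x alpha^\+%E x < +oo)%E.
  move: oo neg_oo; rewrite integralE.
  have : (0 <= \int[Q]_x alpha^\-%E x)%E by exact: integral_ge0.
  case: (\int[Q]_x alpha^\-%E x)%E => // r _.
  by case: (\int[Q]_x alpha^\+%E x)%E => [u| |]// _ _; rewrite ltry.
move: pos_oo; rewrite (integral_prob_density (sF okT) (FM okT) QzQ)// => pos_oo.
have mpz : measurable_fun setT (fun x => alpha^\+%E x * (zQ x)%:E)%E.
  exact: emeasurable_funM.
have pz0 x : (0 <= alpha^\+%E x * (zQ x)%:E)%E by rewrite mule_ge0// lee_fin.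
have ipz : P.-integrable setT (fun x => alpha^\+%E x * (zQ x)%:E)%E.
  apply/integrableP; split => //.
  by under eq_integral do rewrite gee0_abs//.
(* [zQ] is positive a.e., so a finite product with [zQ] forces the other factor to be finite. *)
have bE : \forall x \ae P, alpha^\+%E x = (b x)%:E.
  apply: filterS2 (integrable_ae measurableT ipz) zQ_gt0 => x /(_ I) h zx.
  rewrite /b fineK// ge0_fin_numE//; move: h.
  have : (0 <= alpha^\+%E x)%E by [].
  by case: (alpha^\+%E x) => [r| |]//= _; rewrite ?ltry// mulyr gtr0_sg// mul1e.
split.
  apply: filterS bE => x <-; by rewrite funeposE le_max lexx.
have mb' := mF oks mb.
apply: integrable_ae_le ipz _; first exact: measurable_funM.
by apply: filterS bE => x ->; rewrite muleC -EFinM.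
Qed.

Let scaled_bound f l : L t f -> (forall x, 0 <= f x) -> 0 < l ->
  \forall x \ae P, (l%:E * N (wpos z f) x <=
    (b x + rho s t (fun v => - l * f v)%R x)%:E)%E.
Proof.
move=> Lf f0 l0.
have LX : L t (fun v => - l * f v) by exact: LpGZ.
have mf := Lfun_measurable Lf.2.
have hp : wpos z (fun v => - (- l * f v)) = ((cst l%:E) \* wpos z f)%E.
  apply/funext => x; rewrite /wpos /pos_part /= -!EFinM; congr EFin.
  rewrite mulNr opprK !max_l ?f0 ?mulr_ge0//; first by ring.
  exact: ltW.
have hn : wneg z (fun v => - (- l * f v)) = cst 0%E.
  apply/funext => x; rewrite /wneg /neg_part /= mulNr opprK max_r ?mule0//.
  by rewrite oppr_le0 mulr_ge0// ltW.
have ml : measurable_wrt (F s) (cst l%:E : Omega -> \bar R).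
  by apply/(@mw_EFin _ _ _ _ (cst l)); exact: mw_cst.
have lN := cexp_ge0M P (sF oks) (FM oks) (measurable_wpos mz mf)
  (fun x => wpos_ge0 f (z0 x)) ml (fun x => ltW l0).
have N0 := cexp_ge0_cst0 P (sF oks) (FM oks).
have ub := min_penalty_ub s0 st tT Q'z Q's LX.
apply: filterS3 (filterI lN N0) ub b_alpha.1 => x [h1 h2].
rewrite /wcexp hp hn h1 h2 sube0 /= => h3 h4.
by rewrite EFinD -leeBlDr// (le_trans h3).
Qed.

(** The scaled inequality at l = 1 makes E_Q'(f | F_s) finite and Q-integrable; large l then
    isolates the slope K. *)
Let kernel_bound f : L t f -> (forall x, 0 <= f x) ->
  exists g : Omega -> R, [/\ measurable_wrt (F s) g, (forall x, 0 <= g x),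
    \forall x \ae P, N (wpos z f) x = (g x)%:E,
    integrableR (fun x => zQ x * g x) & (\int[P]_x (zQ x * g x)) <= K * nrm f].
Proof.
move=> Lf f0; pose g := fine \o N (wpos z f).
have g0 x : 0 <= g x by rewrite fine_ge0//; exact: cexp_ge0_ge0.
have mg : measurable_wrt (F s) g by apply: mw_fine; exact: measurable_cexp_ge0.
have rL l : L s (rho s t (fun v => - l * f v)) by apply: rhoL => //; exact: LpGZ.
have gN : \forall x \ae P, N (wpos z f) x = (g x)%:E.
  apply: filterS (scaled_bound Lf f0 ltr01) => x; rewrite mul1e => h.
  rewrite /g /= fineK// ge0_fin_numE; last exact: cexp_ge0_ge0.
  by rewrite (le_lt_trans h)// ltry.
have gb l : 0 < l -> \forall x \ae P, l * g x <= b x + rho s t (fun v => - l * f v) x.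
  move=> l0; apply: filterS2 gN (scaled_bound Lf f0 l0) => x ->.
  by rewrite -EFinM lee_fin.
have ibr l : integrableR (fun x => zQ x * b x + zQ x * rho s t (fun v => - l * f v) x).
  by apply: integrableRD; [case: b_alpha|exact: izQs].
have mg' := mF oks mg.
have izg : integrableR (fun x => zQ x * g x).
  apply: integrable_ae_le (ibr 1) _; first exact: measurable_funM.
  apply: filterS (gb _ ltr01) => x; rewrite mul1r => h /=.
  rewrite lee_fin ger0_norm ?mulr_ge0// -mulrDr (le_trans _ (ler_norm _))//.
  by rewrite ler_wpM2l.
exists g; split => //.
have [c zc] : exists c, bounded_by T zQ c.
  by have [_] := finite_penalty_bounded okT QzQ Qoo.
have [c' zc'] := bounded_by_down s0 sT (lexx T) izQ zc.
have [C CP] := r0_le okt.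
apply: (ler_of_scaled (c := (\int[P]_x (zQ x * b x)) + (C + c'))) => l l0.
pose r := rho s t (fun v => - l * f v).
have Ir : (\int[P]_x (zQ x * r x)) <= l * (K * nrm f) + (C + c').
  have LX : L t (fun v => - l * f v) by exact: LpGZ.
  (* The penalty bound at the position -r gives E_Q(r) <= r0 s (-r) + c', and by time consistency r0
     s (-r) is the value of [r0 t] at -l f. *)
  have := zc' _ (LpGN p1 (rL l)); rewrite -/r -r0_consistent//.
  have := CP _ LX; rewrite (nrmZ p1 _ Lf.2) normrN (gtr0_norm l0).
  rewrite RintegralMN; last exact: izQs (rL l).
  by rewrite opprK; lra.
rewrite -RintegralZl//.
apply: (@le_trans _ _ (\int[P]_x (zQ x * b x + zQ x * r x))).
  apply: Rintegral_ae_le; [exact: integrableRZ|exact: ibr|].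
  by apply: filterS (gb _ l0) => x h; rewrite mulrCA -mulrDr ler_wpM2l.
rewrite RintegralD//; [|by case: b_alpha|exact: izQs (rL l)].
by rewrite addrCA lerD2l.
Qed.

Let m := fine \o N (EFin \o zQ).
(** E(zQ | F_s) z, the density of the probability that follows Q up to time s and Q' from s to t. *)
Let h x := m x * z x.

(** Conditional expectation is self-adjoint: E(m z f) = E(m E(z f | F_s)) = E(zQ E(z f | F_s)),
    where m = E(zQ | F_s). *)
Let kernel_integral f : L t f -> (forall x, 0 <= f x) ->
  exists g : Omega -> R, [/\ measurable_wrt (F s) g,
    \forall x \ae P, N (wpos z f) x = (g x)%:E,
    integrableR (fun x => zQ x * g x), (\int[P]_x (zQ x * g x)) <= K * nrm f &
    (\int[P]_x (h x * f x)%:E = \int[P]_x (zQ x * g x)%:E)%E].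
Proof.
move=> Lf f0; have [g [mg g0 gN izg bg]] := kernel_bound Lf f0.
exists g; split => //.
have mf := Lfun_measurable Lf.2.
have mzf := measurable_wpos mz mf.
have zf0 x : (0 <= wpos z f x)%E by exact: wpos_ge0.
have mzQE : measurable_fun setT (EFin \o zQ) by exact/measurable_EFinP.
have zQE0 x : (0 <= (EFin \o zQ) x)%E by rewrite lee_fin.
have izQ1 : P.-integrable setT (EFin \o zQ).
  have := izQ (LpG_cst P p (F T) 1); congr integrable.
  by apply/funext => x /=; rewrite mulr1.
have mN : measurable_wrt (F s) (N (EFin \o zQ)) by exact: measurable_cexp_ge0.
have mNf : measurable_wrt (F s) (N (wpos z f)) by exact: measurable_cexp_ge0.
have mNE : \forall x \ae P, N (EFin \o zQ) x = (m x)%:E.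
  apply: filterS (cexp_ge0_fin_num (sF oks) (FM oks) izQ1 zQE0) => x e.
  by rewrite /m /= fineK.
have mm : measurable_wrt (F s) m by exact: mw_fine.
have mm' := mF oks mm.
have mN' := mF oks mN.
have mNf' := mF oks mNf.
have m0 x : (0 <= (EFin \o m) x)%E by rewrite lee_fin fine_ge0//; exact: cexp_ge0_ge0.
transitivity (\int[P]_x ((EFin \o m) x * wpos z f x))%E.
  apply: eq_integral => x _; rewrite /h /wpos /pos_part /= -!EFinM max_l//.
  by rewrite mulrA.
rewrite -(integral_mul_cexp_ge0 P (sF oks) (FM oks) mzf zf0 _ m0); last exact/mw_EFin.
transitivity (\int[P]_x (N (wpos z f) x * N (EFin \o zQ) x))%E.
  apply: ae_eq_integral => //.
  - by apply: emeasurable_funM => //; apply/measurable_EFinP.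
  - exact: emeasurable_funM.
  - by apply: filterS mNE => x -> _; rewrite muleC.
rewrite (integral_mul_cexp_ge0 P (sF oks) (FM oks) mzQE zQE0)//; last first.
  by move=> x; exact: cexp_ge0_ge0.
apply: ae_eq_integral => //.
- exact: emeasurable_funM.
- exact: measurable_int izg.
- by apply: filterS gN => x -> _; rewrite muleC -EFinM.
Qed.

(** Nonnegative test functions suffice for [norm_duality]; a signed X is then split into its parts,
    whose integrals are finite by [kernel_integral]. *)
Lemma composed_kernel_bound : exists h : Omega -> R,
  [/\ Lp P F (hoelder_conjugate p%:E) t h,
      ('N[P]_(hoelder_conjugate p%:E)[EFin \o h] <= K%:E)%E &
      forall X, L t X ->
        (\int[Q]_x cexp Q' (F s) (EFin \o X) x = \int[P]_x (h x * X x)%:E)%E].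
Proof.
have mm : measurable_wrt (F s) m by apply: mw_fine; exact: measurable_cexp_ge0.
have mh : measurable_wrt (F t) h.
  by apply: mwM; [exact: mw_sub (Fmono s0 st tT) mm|case: Q'z].
have h0 x : 0 <= h x by rewrite mulr_ge0// fine_ge0//; exact: cexp_ge0_ge0.
have [Lh Nh] : h \in Lfun P (hoelder_conjugate p%:E) /\
    ('N[P]_(hoelder_conjugate p%:E)[EFin \o h] <= K%:E)%E.
  apply: (norm_duality (sF okt) (FM okt) p1 mh h0 K_ge0) => f Lf f0.
  have [g [_ _ izg bg ->]] := kernel_integral Lf f0.
  by rewrite -EFin_Rintegral// lee_fin.
exists h; split => // X LX.
have mh' := mF okt mh.
have Lc : L t (cst 0) by exact: LpG_cst.
have LNX : L t (fun x => - X x) by exact: LpGN.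
pose Xp x := Num.max (X x) 0.
pose Xn x := Num.max (- X x) 0.
have LXp : L t Xp by apply: LpG_max => //; [exact: sF|exact: FM].
have LXn : L t Xn by apply: LpG_max => //; [exact: sF|exact: FM].
have Xp0 x : 0 <= Xp x by rewrite le_max lexx orbT.
have Xn0 x : 0 <= Xn x by rewrite le_max lexx orbT.
have XE x : Xp x - Xn x = X x.
  rewrite /Xp /Xn; have [X0|X0] := leP (X x) 0.
    by rewrite max_l ?oppr_ge0// sub0r opprK.
  by rewrite max_r ?oppr_le0 ?subr0// ltW.
have [g1 [mg1 g1N izg1 _ E1]] := kernel_integral LXp Xp0.
have [g2 [mg2 g2N izg2 _ E2]] := kernel_integral LXn Xn0.
have ih f g : L t f -> (forall x, 0 <= f x) -> integrableR (fun x => zQ x * g x) ->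
    (\int[P]_x (h x * f x)%:E = \int[P]_x (zQ x * g x)%:E)%E ->
    integrableR (fun x => h x * f x).
  move=> Lf f0 izg e; apply/integrableP; split.
    by apply/measurable_EFinP; apply: measurable_funM => //; exact: Lfun_measurable Lf.2.
  rewrite (eq_integral (fun x => (h x * f x)%:E)).
    by rewrite e -EFin_Rintegral// ltry.
  by move=> x _; rewrite gee0_abs// lee_fin mulr_ge0.
have ih1 := ih _ _ LXp Xp0 izg1 E1; have ih2 := ih _ _ LXn Xn0 izg2 E2.
have gE : \forall x \ae P, cexp Q' (F s) (EFin \o X) x = (g1 x - g2 x)%:E.
  have hp : wpos z X = wpos z Xp.
    apply/funext => x; rewrite /wpos /pos_part; congr (_ * _%:E)%E.
    by rewrite [RHS]max_l.
  have hn : wneg z X = wpos z Xn.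
    apply/funext => x; rewrite /wneg /wpos /neg_part /pos_part; congr (_ * _%:E)%E.
    by rewrite [RHS]max_l.
  apply: filterS3 (cexp_wcexp s0 st tT Q'z Q's LX) g1N g2N => x -> e1 e2.
  by rewrite /wcexp hp hn -/N e1 e2 EFinB.
have izg : integrableR (fun x => zQ x * (g1 x - g2 x)).
  have := integrableRB izg1 izg2; congr integrable.
  by apply/funext => x /=; rewrite mulrBr.
rewrite (integral_prob_density_ae (sF okT) (FM okT) QzQ _ _ gE izg).
- rewrite -(EFin_Rintegral izg).
  have ihX : integrableR (fun x => h x * X x).
    have := integrableRB ih1 ih2; congr integrable; apply/funext => x /=.
    by rewrite -mulrBr XE.
  rewrite -(EFin_Rintegral ihX); congr EFin.
  transitivity ((\int[P]_x (zQ x * g1 x)) - \int[P]_x (zQ x * g2 x)).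
    by rewrite -RintegralB//; apply: eq_Rintegral => x _; ring.
  rewrite /Rintegral -E1 -E2 -/(Rintegral _ _ _) -RintegralB//.
  apply: eq_Rintegral => x _.
  by rewrite -mulrBr XE.
- by apply: mw_sub (Fmono s0 sT (lexx T)) _; exact: measurable_cexp_prob.
- apply: (mF oks); exact: mwB.
Qed.

End composed_kernel.

End risk_setting.

Theorem proposition2p48 (R : realType) (d : measure_display)
    (Omega : measurableType d) (P : probability Omega R)
    (T : R) (T_gt0 : 0 < T) (F : R -> set (set Omega))
    (F_filtration : complete_filtration P T F)
    (F0_trivial : trivial_sigma_algebra P (F 0))
    (p : R) (p_ge1 : 1 <= p)
    (rho : R -> R -> (Omega -> R) -> (Omega -> R))
    (rho_risk : fully_dynamic_convex_risk_measure P T F p%:E rho)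
    (rho_consistent : strong_time_consistent P T F p%:E rho)
    (K : R)
    (rho_dominated : dominated P F p%:E T (rho 0 T))
    (rho_dominatedK : domination_constant P F p%:E T (rho 0 T) K)
    (rho_sensitive : sensitive P F p%:E rho T) :
  [/\ (forall t : R, 0 <= t <= T ->
         dominated P F p%:E t (rho 0 t) /\ sensitive P F p%:E rho t),
      (forall s t : R, 0 <= s -> s <= t -> t <= T ->
         forall X, Lp P F p%:E t X ->
         \forall x \ae P, (rho s t X x)%:E =
           fam_ess_sup P (F s)
             [set (fun w => cexp Q' (F s) (fun v => (- X v)%:E) w
                            - min_penalty P F p%:E rho s Q' w)%E
                | Q' in calP P F p%:E rho s t] x),
      (forall s t : R, 0 <= s -> s <= t -> t <= T ->
         forall (Q : prob_at F T) (Q' : prob_at F t),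
         calQ P T F p%:E rho Q -> calPtilde P T F p%:E rho s t Q' ->
         exists h : Omega -> R,
           [/\ Lp P F (hoelder_conjugate p%:E) t h,
               ('N[P]_(hoelder_conjugate p%:E)[EFin \o h] <= K%:E)%E &
               forall X, Lp P F p%:E t X ->
                 (\int[Q]_x cexp Q' (F s) (EFin \o X) x
                  = \int[P]_x (h x * X x)%:E)%E]) &
      (forall s t : R, 0 <= s -> s <= t -> t <= T ->
         forall X, Lp P F p%:E t X ->
         \forall x \ae P, (rho s t X x)%:E =
           fam_ess_sup P (F s)
             [set (fun w => cexp Q' (F s) (fun v => (- X v)%:E) w
                            - min_penalty P F p%:E rho s Q' w)%E
                | Q' in calPtilde P T F p%:E rho s t] x)].
Proof.
split.
- move=> t okt; split.
    exact (dominated_r0 F_filtration F0_trivial p_ge1 rho_risk rho_consistent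
      rho_dominatedK okt).
  exact (sensitive_r0 F_filtration F0_trivial p_ge1 rho_risk rho_consistent
    okt rho_sensitive).
- move=> s t s0 st tT X LX.
  apply: (representation F_filtration F0_trivial p_ge1 rho_risk rho_consistent
    rho_dominatedK s0 st tT rho_sensitive _ _ LX) => // Q [QP Qs _].
  by split.
- move=> s t s0 st tT Q Q' Qoo Q'oo.
  have T_ge0 := ltW T_gt0.
  have okT : 0 <= T <= T by rewrite T_ge0 lexx.
  have okt : 0 <= t <= T by rewrite tT (le_trans s0 st).
  have sFM u (h : 0 <= u <= T) := conj (filtration_sigma_algebra F_filtration h)
    (filtration_sub F_filtration h).
  have [zQ QzQ zQ_gt0] := exists_prob_density (sFM T okT).1 (sFM T okT).2 Qoo.1.
  have [Q'P _ _] := Q'oo.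
  have [z Q'z _] := exists_prob_density (sFM t okt).1 (sFM t okt).2 Q'P.
  exact (composed_kernel_bound F_filtration F0_trivial p_ge1 rho_risk rho_consistent
    rho_dominatedK s0 st tT Qoo Q'oo QzQ zQ_gt0 Q'z).
- move=> s t s0 st tT X LX.
  apply: (representation F_filtration F0_trivial p_ge1 rho_risk rho_consistent
    rho_dominatedK s0 st tT rho_sensitive _ _ LX) => [|Q [QP Qs _]]; last by split.
  exact (calP_calPtilde F_filtration F0_trivial p_ge1 rho_risk rho_consistent
    rho_dominatedK s0 st tT).
Qed.
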